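(* Let $u_0\in H^1(\mathbb S)$ with $h:=\int_{\mathbb S}u_{0x}^2\,dx\neq1$. Then the local solution $(\gamma,U,V,W,Q)$ of the system below, with the initial data below, is global. Moreover, $$(\gamma(t),U(t),V(t),W(t),Q(t))\in[W^{1,\infty}(\mathbb S)]^2\times[L^\infty(\mathbb S)]^3\quad\text{for all } t\ge0.$$ The system is $$\begin{aligned} \gamma_t&=-U^2,\\ U_t&=K(\xi)-P(1)(\gamma+\mathrm{Id})(\xi)-\frac{1}{1-h}\int_{\mathbb S}(2QV-Q)(\eta)\big(K(\eta)-P(1)(\gamma+\mathrm{Id})(\eta)\big)\,d\eta,\\ V_t&=-2UW+2WVP(1),\\ W_t&=2UV-U-2V^2P(1)+VP(1),\\ Q_t&=-2WQP(1). \end{aligned}$$ The initial data are $\gamma_0=y_0-\mathrm{Id}$ and $$y_0(\xi)+\int_0^{y_0(\xi)}u_{0x}^2\,dx=(1+h)\xi,\qquad U_0=u_0\circ y_0,\qquad V_0=\frac{1}{1+u_{0x}^2\circ y_0},\qquad W_0=\frac{u_{0x}\circ y_0}{1+u_{0x}^2\circ y_0},\qquad Q_0=1+h.$$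
   Context: $\mathbb S=\mathbb R/\mathbb Z$ (1-periodic functions on $\mathbb R$), $\xi\in\mathbb S$. The Banach space is $Y=H^1(\mathbb S)\times H^1(\mathbb S)\times L^\infty(\mathbb S)^3$. We write $y=\gamma+\mathrm{Id}$. In the system: - $P(1)=\int_{\mathbb S}(2UQV-UQ)(\zeta)\,d\zeta$; - $K(\xi)=\int_{y^{-1}(t,0)}^{\xi}(2UQV-UQ)(\eta)\,d\eta$, where $y^{-1}(t,0)$ denotes a point $\xi_0$ with $y(t,\xi_0)=0$. The ''local solution'' is a solution in $L^\infty([0,T];Y)$ for some $T>0$ (its existence is known). The claim asserts that it extends to all $t\ge0$. *)

(* Defs.v *)
From HB Require Import structures.
From mathcomp Require Import all_boot all_order all_algebra.
From mathcomp Require Import all_classical all_reals all_analysis.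
Set Implicit Arguments. Unset Strict Implicit. Unset Printing Implicit Defensive.
Import Order.TTheory GRing.Theory Num.Theory.
Import numFieldNormedType.Exports.
Local Open Scope classical_set_scope.
Local Open Scope ring_scope.

Section Defs.
Variable R : realType.
Local Notation mu := (@lebesgue_measure R).

(* functions on S = R/Z are represented as 1-periodic functions R -> R *)
Definition periodic1 (f : R -> R) : Prop := forall x, f (x + 1) = f x.

Definition int01 (f : R -> R) : R := Rintegral mu `[0, 1] f.

Definition ointg (a b : R) (f : R -> R) : R :=
  if a <= b then Rintegral mu `[a, b] f else - Rintegral mu `[b, a] f.

Definition inL2 (g : R -> R) : Prop :=
  periodic1 g /\ measurable_fun (`[0, 1] : set R) g /\ mu.-integrable `[0, 1] (fun x => (g x ^+ 2)%:E).

Definition inLinf (g : R -> R) : Prop :=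
  periodic1 g /\ measurable_fun (`[0, 1] : set R) g /\
  exists M : R, mu [set x | 0 <= x <= 1 /\ M < `|g x|] = 0%E.

(* Sobolev spaces on S: f is the primitive of a weak derivative g *)
Definition inH1 (f : R -> R) : Prop :=
  periodic1 f /\ exists g, inL2 g /\ forall x, 0 <= x <= 1 -> f x = f 0 + ointg 0 x g.

Definition inW1inf (f : R -> R) : Prop :=
  periodic1 f /\ exists g, inLinf g /\ forall x, 0 <= x <= 1 -> f x = f 0 + ointg 0 x g.

(* norms; for f in H^1(S), derive1 f agrees a.e. with the weak derivative *)
Definition H1norm (f : R -> R) : R :=
  Num.sqrt (int01 (fun x => f x ^+ 2) + int01 (fun x => (derive1 f x) ^+ 2)).

Definition Linfnorm (g : R -> R) : R :=
  inf [set M : R | 0 <= M /\ mu [set x | 0 <= x <= 1 /\ M < `|g x|] = 0%E].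

Definition inY (a b c d e : R -> R) : Prop :=
  [/\ inH1 a, inH1 b, inLinf c, inLinf d & inLinf e].

Definition normY (a b c d e : R -> R) : R :=
  H1norm a + H1norm b + Linfnorm c + Linfnorm d + Linfnorm e.

Definition Pone (U V Q : R -> R) : R :=
  int01 (fun z => 2 * U z * Q z * V z - U z * Q z).

(* K(xi) = \int_{xi0}^{xi} (2UQV - UQ), with y(xi0) = 0 *)
Definition Kfun (U V Q : R -> R) (xi0 xi : R) : R :=
  ointg xi0 xi (fun z => 2 * U z * Q z * V z - U z * Q z).

Definition rhsU (h : R) (gam U V Q : R -> R) (xi0 : R) (xi : R) : R :=
  let P := Pone U V Q in
  Kfun U V Q xi0 xi - P * (gam xi + xi)
  - (1 - h)^-1 * int01 (fun eta => (2 * Q eta * V eta - Q eta) *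
                                  (Kfun U V Q xi0 eta - P * (gam eta + eta))).

(* solution on [0,T], classical (strong) sense in Y, bounded in Y.
   Components are functions of (t, xi). xi0 t is a point with y(t, xi0 t) = 0. *)
Definition is_sol_on (h T : R) (gam0 U0 V0 W0 Q0 : R -> R)
  (gam U V W Q : R -> R -> R) (xi0 : R -> R) : Prop :=
  [/\ (forall t, 0 <= t <= T -> inY (gam t) (U t) (V t) (W t) (Q t)),
      (exists M, forall t, 0 <= t <= T -> normY (gam t) (U t) (V t) (W t) (Q t) <= M),
      normY (fun x => gam 0 x - gam0 x) (fun x => U 0 x - U0 x) (fun x => V 0 x - V0 x)
            (fun x => W 0 x - W0 x) (fun x => Q 0 x - Q0 x) = 0,
      (forall t, 0 <= t <= T -> gam t (xi0 t) + xi0 t = 0) &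
      (forall t, 0 <= t <= T ->
        let P := Pone (U t) (V t) (Q t) in
        forall e : R, 0 < e -> exists2 d : R, 0 < d & forall s : R, s != 0 -> `|s| < d ->
          0 <= t + s <= T ->
          normY
            (fun x => (gam (t + s) x - gam t x) / s - (- (U t x) ^+ 2))
            (fun x => (U (t + s) x - U t x) / s - rhsU h (gam t) (U t) (V t) (Q t) (xi0 t) x)
            (fun x => (V (t + s) x - V t x) / s - (- 2 * U t x * W t x + 2 * W t x * V t x * P))
            (fun x => (W (t + s) x - W t x) / s -
                      (2 * U t x * V t x - U t x - 2 * V t x ^+ 2 * P + V t x * P))
            (fun x => (Q (t + s) x - Q t x) / s - (- 2 * W t x * Q t x * P))
          <= e)].

End Defs.

(* Main.v *)
(* In the variables f = 2 arctan u_x and r = ln Q one has V = (1 + cos f) / 2, W = sin f / 2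
   and Q = e^r. If P(1) is replaced by a constant p, the system becomes an ODE
     f_t = 2 U - p (1 + cos f),   r_t = - p sin f,
   where U is the primitive of B = e^r sin f / 2 normalised by \int A U = p, A = e^r cos f.
   The vector field is bounded and Lipschitz on every set where r is bounded, and
   |r(t) - r(0)| <= |p| t rules out blow-up, so Euler's scheme with dyadic steps converges
   for all times. The quantities \int B, \int QV - 1 and \int A - (1 - h) solve a homogeneous
   linear system; they vanish initially, by the change of variables x = y_0(xi), hence for
   ever. Then P(1) = p, U_xi = QW and (gamma + Id)_xi = QV, so the original system holds.
   For uniqueness, the right-hand side is Lipschitz for the L^1 distance on bounded sets of
   L^infinity, so the L^1 distance of two solutions obeys a Gronwall inequality. *)
Require Import Defs.
From HB Require Import structures.
From mathcomp Require Import all_boot all_order all_algebra.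
From mathcomp Require Import all_classical all_reals all_analysis.
From mathcomp Require Import measurable_realfun.
From mathcomp Require Import ring lra.
Set Implicit Arguments. Unset Strict Implicit. Unset Printing Implicit Defensive.
Import Order.TTheory GRing.Theory Num.Theory.
Import numFieldNormedType.Exports.
Local Open Scope classical_set_scope.
Local Open Scope ring_scope.

(** * Oriented integrals *)

(** The obstacle is the nonlocal equation for U. Once P(1) is a constant, U need not be evolved at
    all: it is a function of the angle and of ln Q. The vector field must then make sense on every
    periodic state, also where the constraints fail, as they may along Euler polygons. Hence the
    mean of B is subtracted to keep U periodic, and the additive constant of U is computed as if A
    had integral 1 - h; this division is where h != 1 enters. Of gam, only the value at x = 0 is
    evolved. States are functions defined at every point and compared in the sup distance, so the
    scheme meets no null sets. Almost everywhere arguments are confined to the data, where the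
    pointwise derivative of u_0 is a weak derivative only almost everywhere, and to competing
    solutions. The L^1 distance is weak enough to be dominated by the norm of Y, so that difference
    quotients in Y can be inserted directly, and it avoids comparing space derivatives of gam and U.
    Equality in Y follows at the end from continuity. That the local solution is global means here:
    a global solution exists, and it agrees with every solution on every [0, T]. *)

Section OrientedIntegral.
Variable R : realType.
Implicit Types (f g : R -> R) (a b c : R).
Local Notation mu := (@lebesgue_measure R).

Definition locint f := measurable_fun setT f /\
  forall a b, mu.-integrable `[a, b] (EFin \o f).

(** The bound holds at every point, so that sup estimates and products involve no exceptional
    sets. *)
Definition bmeas f := measurable_fun setT f /\ exists M : R, forall x, `|f x| <= M.

Lemma bmeas_locint f : bmeas f -> locint f.
Proof.
move=> [mf [M fM]]; split=> // a b.
apply: measurable_bounded_integrable => //.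
- have := lebesgue_measure_itv (`[a, b] : interval R) => /= ->.
  by case: ifP => // _; rewrite -EFinD ltry.
- exact: measurable_funTS.
- exists M; split; first by rewrite num_real.
  by move=> y My x _ /=; rewrite (le_trans (fM x))// ltW.
Qed.

Lemma bmeas_cst c : bmeas (fun=> c).
Proof. by split; [exact: measurable_cst|exists `|c|]. Qed.

Lemma bmeasD f g : bmeas f -> bmeas g -> bmeas (fun x => f x + g x).
Proof.
move=> [mf [M fM]] [mg [N gN]]; split; first exact: measurable_funD.
by exists (M + N) => x; rewrite (le_trans (ler_normD _ _))// lerD.
Qed.

Lemma bmeasM f g : bmeas f -> bmeas g -> bmeas (fun x => f x * g x).
Proof.
move=> [mf [M fM]] [mg [N gN]]; split; first exact: measurable_funM.
by exists (M * N) => x; rewrite normrM ler_pM.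
Qed.

Lemma bmeasZ c f : bmeas f -> bmeas (fun x => c * f x).
Proof. by move=> bf; apply: bmeasM => //; exact: bmeas_cst. Qed.

Lemma bmeasN f : bmeas f -> bmeas (fun x => - f x).
Proof.
by move=> bf; under eq_fun do rewrite -mulN1r; exact: bmeasZ.
Qed.

Lemma bmeasB f g : bmeas f -> bmeas g -> bmeas (fun x => f x - g x).
Proof. by move=> bf bg; apply: bmeasD => //; exact: bmeasN. Qed.

Lemma locintD f g : locint f -> locint g -> locint (fun x => f x + g x).
Proof.
move=> [mf If] [mg Ig]; split; first exact: measurable_funD.
by move=> a b; have := integrableD _ (If a b) (Ig a b); exact.
Qed.

Lemma locintM f g : bmeas f -> locint g -> locint (fun x => f x * g x).
Proof.
move=> [mf [M fM]] [mg Ig]; split; first exact: measurable_funM.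
move=> a b; have mab : measurable (`[a, b] : set (measurableTypeR R)) by [].
have Ig' := integrableZl mab M (Ig a b).
apply: (le_integrable mab _ _ Ig').
- exact/measurable_EFinP/measurable_funTS/measurable_funM.
- move=> x _ /=; rewrite lee_fin !normrM ler_wpM2r//.
  by rewrite (le_trans (fM x))// ler_norm.
Qed.

Lemma locintZ c f : locint f -> locint (fun x => c * f x).
Proof. by move=> lf; apply: locintM => //; exact: bmeas_cst. Qed.

Lemma locintN f : locint f -> locint (fun x => - f x).
Proof. by move=> bf; under eq_fun do rewrite -mulN1r; exact: locintZ. Qed.

Lemma locintB f g : locint f -> locint g -> locint (fun x => f x - g x).
Proof. by move=> lf lg; apply: locintD => //; exact: locintN. Qed.

Lemma locint_cst c : locint (fun=> c).
Proof. exact/bmeas_locint/bmeas_cst. Qed.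

Lemma locint_norm f : locint f -> locint (fun x => `|f x|).
Proof.
move=> [mf If]; split; first exact: measurableT_comp.
by move=> a b; have /integrable_abse := If a b.
Qed.

Lemma Rint_cat f a b c : locint f -> a <= b -> b <= c ->
  Rintegral mu `[a, c] f = Rintegral mu `[a, b] f + Rintegral mu `[b, c] f.
Proof.
move=> [mf If] ab bc.
have := @Rintegral_itvB _ f (BLeft a) (BRight c) b (If a c).
rewrite !bnd_simp ab bc => /(_ isT isT).
rewrite Rintegral_itv_obnd_cbnd; last first.
  by apply: (integrableS _ _ _ (If b c)) => //; exact: subset_itv_oc_cc.
by move=> /eqP; rewrite subr_eq addrC => /eqP.
Qed.

Lemma ointgE a b f : a <= b -> ointg a b f = Rintegral mu `[a, b] f.
Proof. by rewrite /ointg => ->. Qed.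

(** Measured from a common lower bound [z], the oriented integral loses its case distinction; this
    turns the additivity in [ointg_cat] into linear arithmetic. *)
Lemma ointg_base f z a b : locint f -> z <= a -> z <= b ->
  ointg a b f = Rintegral mu `[z, b] f - Rintegral mu `[z, a] f.
Proof.
move=> lf za zb; rewrite /ointg; case: ifPn => [ab|].
  by rewrite (Rint_cat lf za ab) addrAC subrr add0r.
by rewrite -ltNge => /ltW ba; rewrite (Rint_cat lf zb ba) opprD addrA subrr add0r.
Qed.

Lemma ointg_cat f a b c : locint f ->
  ointg a b f + ointg b c f = ointg a c f.
Proof.
move=> lf; pose z := Num.min (Num.min a b) c.
have [za zb zc] : [/\ z <= a, z <= b & z <= c].
  by rewrite /z; split; rewrite !ge_min lexx ?orbT.
rewrite (ointg_base lf za zb) (ointg_base lf zb zc) (ointg_base lf za zc).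
lra.
Qed.

Lemma ointg_id f a : ointg a a f = 0.
Proof. by rewrite ointgE// set_itv1 Rintegral_set1. Qed.

Lemma ointgC f a b : locint f -> ointg a b f = - ointg b a f.
Proof.
by move=> lf; apply/eqP; rewrite -addr_eq0 (ointg_cat _ _ _ lf) ointg_id.
Qed.

Lemma ointgD f g a b : locint f -> locint g ->
  ointg a b (fun x => f x + g x) = ointg a b f + ointg a b g.
Proof.
move=> [_ If] [_ Ig]; rewrite /ointg; case: ifP => _; rewrite RintegralD//.
by rewrite opprD.
Qed.

Lemma ointgZ f c a b : locint f ->
  ointg a b (fun x => c * f x) = c * ointg a b f.
Proof.
move=> [_ If]; rewrite /ointg; case: ifP => _; rewrite RintegralZl//.
by rewrite mulrN.
Qed.

Lemma ointgN f a b : locint f -> ointg a b (fun x => - f x) = - ointg a b f.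
Proof.
by move=> lf; under eq_fun do rewrite -mulN1r; rewrite ointgZ// mulN1r.
Qed.

Lemma ointgB f g a b : locint f -> locint g ->
  ointg a b (fun x => f x - g x) = ointg a b f - ointg a b g.
Proof. by move=> lf lg; rewrite ointgD ?ointgN//; exact: locintN. Qed.

Lemma ointg_cst c a b : ointg a b (fun=> c) = c * (b - a).
Proof.
have E (x y : R) : x <= y -> Rintegral mu `[x, y] (fun=> c) = c * (y - x).
  move=> xy; rewrite Rintegral_cst//; have := lebesgue_measure_itv (`[x, y] : interval R) => /= ->.
  rewrite lte_fin.
  case: (ltP x y) => //= yx; have -> : x = y by apply/le_anti; rewrite xy yx.
  by rewrite subrr.
rewrite /ointg; case: ifPn => [/E//|]; rewrite -ltNge => /ltW/E ->; lra.
Qed.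

Lemma ointg_le f g a b : locint f -> locint g -> a <= b ->
  (forall x, a <= x <= b -> f x <= g x) -> ointg a b f <= ointg a b g.
Proof.
move=> [_ If] [_ Ig] ab fg; rewrite !ointgE//; exact: le_Rintegral.
Qed.

Lemma ointg_norm f a b : locint f -> a <= b ->
  `|ointg a b f| <= ointg a b (fun x => `|f x|).
Proof. by move=> [_ If] ab; rewrite !ointgE//; exact: le_normr_Rintegral. Qed.

Lemma ointg_bound f M a b : locint f -> a <= b ->
  (forall x, a <= x <= b -> `|f x| <= M) -> `|ointg a b f| <= M * (b - a).
Proof.
move=> lf ab fM; rewrite (le_trans (ointg_norm lf ab))// -ointg_cst.
by apply: ointg_le => //; [exact: locint_norm|exact: locint_cst].
Qed.

Lemma int01E f : int01 f = ointg 0 1 f.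
Proof. by rewrite ointgE. Qed.

Lemma ointg_lipschitz f M : locint f -> (forall x, `|f x| <= M) ->
  forall a x y, `|ointg a x f - ointg a y f| <= M * `|x - y|.
Proof.
move=> lf fM a x y.
wlog xy : x y / x <= y => [H|].
  case: (leP x y) => [/H//|/ltW/H]; by rewrite distrC [X in _ * X]distrC.
rewrite distrC -(ointg_cat a x y lf) addrAC subrr add0r.
by rewrite distrC (ger0_norm (_ : 0 <= y - x)) ?subr_ge0//; exact: ointg_bound.
Qed.

Lemma lipschitz_continuous f M : (forall x y, `|f x - f y| <= M * `|x - y|) ->
  continuous f.
Proof.
move=> fM x; apply/cvgrPdist_lt => e e0; near=> y.
rewrite (le_lt_trans (fM x y))//.
have : `|x - y| < e / (`|M| + 1).
  near: y; apply: (cvgr_dist_lt (T := R) (F := nbhs x)) => //; rewrite divr_gt0// ltr_wpDl.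
rewrite ltr_pdivlMr ?ltr_wpDl// => H; rewrite (le_lt_trans _ H)// mulrC.
by rewrite ler_wpM2l// (le_trans (ler_norm _))// lerDl.
Unshelve. all: by end_near. Qed.

Lemma lipschitz_measurable f M : (forall x y, `|f x - f y| <= M * `|x - y|) ->
  measurable_fun setT f.
Proof. by move=> fM; apply: continuous_measurable_fun; exact: lipschitz_continuous fM. Qed.

Lemma measurable_ointg f a : bmeas f -> measurable_fun setT (fun x => ointg a x f).
Proof.
move=> bf; have [_ [M fM]] := bf; apply: (@lipschitz_measurable _ M).
by apply: ointg_lipschitz => //; exact: bmeas_locint.
Qed.

Lemma aeS (P Q : R -> Prop) : (forall x, P x -> Q x) ->
  {ae mu, forall x, P x} -> {ae mu, forall x, Q x}.
Proof. by move=> PQ; apply: filterS => //; exact: (ae_filter_ringOfSetsType mu). Qed.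

Lemma aeI (P Q : R -> Prop) : {ae mu, forall x, P x} -> {ae mu, forall x, Q x} ->
  {ae mu, forall x, P x /\ Q x}.
Proof. by move=> aP aQ; apply: filterI => //; exact: (ae_filter_ringOfSetsType mu). Qed.

Lemma ae_eq_Rint f g a b : locint f -> locint g ->
  {ae mu, forall x, a <= x <= b -> f x = g x} ->
  Rintegral mu `[a, b] f = Rintegral mu `[a, b] g.
Proof.
move=> [mf _] [mg _] fg; congr fine; apply: ae_eq_integral => //.
- exact/measurable_EFinP/measurable_funTS.
- exact/measurable_EFinP/measurable_funTS.
- by apply: aeS fg => x fg /=; rewrite in_itv/= => /fg ->.
Qed.

(** [g] is replaced by [Num.max (f x) (g x)], which equals it almost everywhere on the interval and
    dominates [f] everywhere; the comparison is then pointwise. Writing the maximum through the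
    absolute value gives its integrability. *)
Lemma le_ointg_ae f g a b : locint f -> locint g -> a <= b ->
  {ae mu, forall x, a <= x <= b -> f x <= g x} -> ointg a b f <= ointg a b g.
Proof.
move=> lf lg ab fg.
have lm : locint (fun x => Num.max (f x) (g x)).
  have -> : (fun x => Num.max (f x) (g x)) = (fun x => 2^-1 * (f x + g x) + 2^-1 * `|f x - g x|).
    apply/funext => x; by rewrite maxr_absE; lra.
  apply: locintD; first exact/locintZ/locintD.
  exact/locintZ/locint_norm/locintB.
have -> : ointg a b g = ointg a b (fun x => Num.max (f x) (g x)).
  rewrite !ointgE//; apply: ae_eq_Rint => //.
  by apply: aeS fg => x fg /fg/max_idPr.
by apply: ointg_le => // x _; rewrite le_max lexx.
Qed.

End OrientedIntegral.

(** * Periodic functions *)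

Lemma integrable_setU d (T : measurableType d) (R : realType)
    (mu : {measure set T -> \bar R}) (A B : set T) (f : T -> \bar R) :
  measurable A -> measurable B -> mu.-integrable A f -> mu.-integrable B f ->
  mu.-integrable (A `|` B) f.
Proof.
move=> mA mB /integrableP[mfA fA] /integrableP[mfB fB].
have mU : measurable_fun (A `|` B) f by apply/measurable_funU.
have mBA : measurable (B `\` A) by exact: measurableD.
apply/integrableP; split => //; have -> : A `|` B = A `|` (B `\` A).
  by rewrite setDE setUIr setUv setIT.
rewrite ge0_integral_setU//; last 2 first.
- by rewrite setDE setUIr setUv setIT; exact: measurableT_comp.
- by apply/eqP; rewrite setDE setICA setICr setI0.
apply: lte_add_pinfty => //; apply: le_lt_trans fB.
by apply: ge0_subset_integral => //; exact: measurableT_comp.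
Qed.

Section Translation.
Variable R : realType.
Implicit Types (f g : R -> R) (a b c : R).
Local Notation mu := (@lebesgue_measure R).

Definition shift_by c (x : measurableTypeR R) : measurableTypeR R := x + c.

Lemma measurable_shift_by c : measurable_fun setT (shift_by c).
Proof. exact: measurable_funD. Qed.

Lemma preimage_shift_by c a b :
  shift_by c @^-1` `[a + c, b + c] = `[a, b]%classic.
Proof. by apply/seteqP; split => x /=; rewrite !in_itv/= /shift_by !lerD2r. Qed.

(** A measure that agrees with Lebesgue measure on half-open intervals is Lebesgue measure, so only
    intervals ]a, b] have to be translated. *)
Lemma lebesgue_measure_shift_by c (A : set R) : measurable A ->
  pushforward mu (shift_by c) A = mu A.
Proof.
move=> mA; apply/esym/lebesgue_measure_unique => //=; first exact: measurable_shift_by.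
move=> _ X [[a b]] _ <-; rewrite /pushforward.
have -> : shift_by c @^-1` `]a, b] = `]a - c, b - c]%classic.
  by apply/seteqP; split => x /=; rewrite !in_itv/= /shift_by ltrBlDr lerBrDr.
have := lebesgue_measure_itv (`]a, b] : interval R) => /= ->.
have := lebesgue_measure_itv (`]a - c, b - c] : interval R) => /= ->.
rewrite !lte_fin ltrD2r; case: ifP => // _; rewrite -!EFinD; congr (_%:E); lra.
Qed.

Lemma ge0_integral_shift_by (f : R -> \bar R) a b c :
  measurable_fun `[a + c, b + c] f -> (forall x, 0 <= f x)%E ->
  (\int[mu]_(x in `[a, b]) f (x + c)%R = \int[mu]_(x in `[(a + c)%R, (b + c)%R]) f x)%E.
Proof.
move=> mf f0; rewrite -(preimage_shift_by c).
rewrite -(ge0_integral_pushforward (measurable_shift_by c))//.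
by apply: eq_measure_integral; [exact: measurable_shift_by|move=> ? A mA AS; exact: lebesgue_measure_shift_by].
Qed.

Lemma measurable_fun_shift f a b c : measurable_fun `[a + c, b + c] f ->
  measurable_fun `[a, b] (fun x => f (x + c)).
Proof.
move=> mf; rewrite -(preimage_shift_by c).
apply: (measurable_comp (F := `[a + c, b + c]) (g := shift_by c)) => //.
- by move=> _ [x xab <-].
- apply: (measurable_funS measurableT) => //; exact: measurable_funD.
Qed.

Lemma integral_shift_by f a b c : measurable_fun `[a + c, b + c] f ->
  (\int[mu]_(x in `[a, b]) (f (x + c)%R)%:E = \int[mu]_(x in `[(a + c)%R, (b + c)%R]) (f x)%:E)%E.
Proof.
move=> mf; rewrite integralE [RHS]integralE; congr (_ - _)%E.
- rewrite -(ge0_integral_shift_by (f := (EFin \o f)^\+%E))//.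
    by apply: eq_integral => x _; rewrite !funeposE.
  exact/measurable_funepos/measurable_EFinP.
- rewrite -(ge0_integral_shift_by (f := (EFin \o f)^\-%E))//.
    by apply: eq_integral => x _; rewrite !funenegE.
  exact/measurable_funeneg/measurable_EFinP.
Qed.

Lemma integrable_shift_by f a b c : mu.-integrable `[a + c, b + c] (EFin \o f) ->
  mu.-integrable `[a, b] (EFin \o (fun x => f (x + c))).
Proof.
move=> /integrableP[/measurable_EFinP mf fi]; apply/integrableP; split.
  apply/measurable_EFinP; have H := measurable_fun_shift mf; exact: H.
rewrite (ge0_integral_shift_by (f := fun x => `|(f x)%:E|%E))//.
by apply: measurableT_comp => //; exact/measurable_EFinP.
Qed.

End Translation.

Section Periodic.
Variable R : realType.
Implicit Types (f g : R -> R) (a b c : R).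
Local Notation mu := (@lebesgue_measure R).

Lemma periodic1_int f (n : int) x : periodic1 f -> f (x + n%:~R) = f x.
Proof.
move=> pf; have H (k : nat) y : f (y + k%:R) = f y.
  by elim: k => [|k IH]; rewrite ?addr0// -natr1 addrA pf.
case: n => k; first exact: H.
by rewrite NegzE mulrNz -(H k.+1 (x - _)) subrK.
Qed.

Lemma periodic1_reduce f x : periodic1 f -> exists2 z, 0 <= z <= 1 & f x = f z.
Proof.
move=> pf; exists (x - (Num.floor x)%:~R).
  have := floor_le x; have := floorD1_gt x; rewrite intrD.
  by move=> *; apply/andP; split; lra.
by rewrite -mulrNz periodic1_int.
Qed.

(** Each cell [n, n + 1] is a translate of [0, 1], and [-n, n] grows by one cell at either end.
    Measurability on the whole line comes with it, although the hypothesis speaks of [0, 1] only. *)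
Lemma periodic1_locint f : periodic1 f -> mu.-integrable `[0, 1] (EFin \o f) -> locint f.
Proof.
move=> pf fi.
have I1 (n : int) : mu.-integrable `[n%:~R, n%:~R + 1] (EFin \o f).
  have -> : f = (fun x => f (x + - n%:~R)).
    by apply/funext => x; rewrite -mulrNz periodic1_int.
  apply: (@integrable_shift_by _ f n%:~R (n%:~R + 1) (- n%:~R)).
  by rewrite subrr addrAC subrr add0r.
have IN (n : nat) : mu.-integrable `[- n%:R, n%:R] (EFin \o f).
  elim: n => [|n IH].
    rewrite oppr0; apply: integrableS fi => //.
    by apply: subset_itvl; rewrite bnd_simp ler01.
  have -> : `[- n.+1%:R, n.+1%:R]%classic =
      (`[- n.+1%:R, - n.+1%:R + 1] `|` `[- n%:R, n%:R]) `|` `[n%:R : R, n%:R + 1].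
    rewrite -natr1; have n0 : 0 <= n%:R :> R by [].
    apply/seteqP; split => x /=; rewrite !in_itv/=.
      move=> /andP[x1 x2].
      case: (leP x (- (n%:R + 1) + 1)) => h1; first by left; left; apply/andP.
      case: (leP x n%:R) => h2; last by right; apply/andP; split => //; exact: ltW.
      left; right; apply/andP; split; lra.
    by move=> [[]|] /andP[x1 x2]; apply/andP; split; lra.
  apply: integrable_setU => //; last exact: (I1 (Posz n)).
    exact: measurableU.
  apply: integrable_setU => //; have := I1 (- (n.+1)%:Z); by rewrite mulrNz.
split.
  have -> : [set: R] = \bigcup_n `[- n%:R : R, n%:R]%classic.
    apply/seteqP; split => // x _ /=; exists (Num.truncn `|x|).+1 => //=.
    by rewrite in_itv/= -ler_norml ltW// truncnS_gt.
  apply/measurable_fun_bigcup => // n.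
  by have /integrableP[/measurable_EFinP] := IN n.
move=> a b; pose n := (Num.truncn (`|a| + `|b|)).+1.
apply: integrableS (IN n) => //; have := truncnS_gt (`|a| + `|b|); rewrite -/n => nab.
move=> x /=; rewrite !in_itv/= => /andP[ax xb].
have := ler_norm b; have := ler_norm (- a); rewrite normrN.
have := normr_ge0 a; have := normr_ge0 b.
by move=> *; apply/andP; split; lra.
Qed.

Lemma ointg_shift1 f a b : periodic1 f -> locint f ->
  ointg (a + 1) (b + 1) f = ointg a b f.
Proof.
move=> pf [mf _].
have E x y : Rintegral mu `[x + 1, y + 1] f = Rintegral mu `[x, y] f.
  congr fine; rewrite -integral_shift_by; last exact: measurable_funTS.
  by apply: eq_integral => z _; rewrite pf.
by rewrite /ointg lerD2r !E.
Qed.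

Lemma ointg_period f x : periodic1 f -> locint f -> ointg x (x + 1) f = int01 f.
Proof.
move=> pf lf; rewrite -(ointg_cat x 0 _ lf) -(ointg_cat 0 1 (x + 1) lf).
rewrite -{2}(add0r 1) ointg_shift1// (ointgC _ _ lf) int01E; lra.
Qed.

Lemma ointg0D1 f x : periodic1 f -> locint f ->
  ointg 0 (x + 1) f = ointg 0 x f + int01 f.
Proof. by move=> pf lf; rewrite -(ointg_period x pf lf) ointg_cat. Qed.

Lemma periodic1_ointg f : periodic1 f -> locint f ->
  periodic1 (fun x => ointg 0 x f - x * int01 f).
Proof. by move=> pf lf x; rewrite ointg0D1//; lra. Qed.

Lemma int01_ge0 f : (forall x, 0 <= f x) -> 0 <= int01 f.
Proof. by move=> f0; apply: Rintegral_ge0. Qed.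

(** The primitive is a periodic function plus the drift [x * int01 f]. The drift costs |x| copies of
    the norm; the other two bound the two terms of the periodic part on [0, 1]. *)
Lemma periodic1_ointg_bound f x : periodic1 f -> locint f ->
  `|ointg 0 x f| <= (`|x| + 2) * int01 (fun x => `|f x|).
Proof.
move=> pf lf; set N := int01 _.
have lN : locint (fun x => `|f x|) by exact: locint_norm.
have fN : `|int01 f| <= N by rewrite /N !int01E; exact: ointg_norm.
have [z /andP[z0 z1]] := periodic1_reduce x (periodic1_ointg pf lf).
move=> /eqP; rewrite subr_eq => /eqP ->.
have H : `|ointg 0 z f| <= N.
  rewrite (le_trans (ointg_norm lf z0))// /N int01E -(ointg_cat 0 z 1 lN) lerDl.
  by rewrite ointgE// Rintegral_ge0.
have zN : `|z * int01 f| <= N.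
  rewrite normrM ger0_norm// -[X in _ <= X]mul1r ler_pM//.
have xN : `|x * int01 f| <= `|x| * N by rewrite normrM ler_wpM2l.
have := ler_normD (ointg 0 z f - z * int01 f) (x * int01 f).
have := ler_normB (ointg 0 z f) (z * int01 f).
lra.
Qed.

End Periodic.

(** * Almost everywhere statements *)

Section AlmostEverywhere.
Variable R : realType.
Implicit Types (f g : R -> R) (a b c : R).
Local Notation mu := (@lebesgue_measure R).

(** [mu] is defined on all sets as an outer measure, so monotonicity needs no measurability. This
    matters because the superlevel sets in [Linfnorm] belong to arbitrary functions. *)
Lemma lebesgue_null_subset (A B : set R) : A `<=` B -> mu B = 0%E -> mu A = 0%E.
Proof.
move=> AB B0; apply/eqP; rewrite eq_le; apply/andP; split.
  have H : (mu A <= mu B)%E := le_outer_measure (mu_ext (wlength (idfun : R -> R))) A B AB.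
  by rewrite B0 in H.
exact: mu_ext_ge0.
Qed.

Lemma lebesgue_null_setU (A B : set R) : mu A = 0%E -> mu B = 0%E -> mu (A `|` B) = 0%E.
Proof.
move=> A0 B0; apply/eqP; rewrite eq_le; apply/andP; split; last exact: mu_ext_ge0.
rewrite -[leRHS]adde0 -{1}A0 -B0.
exact: (outer_measureU2 (mu_ext (wlength idfun))).
Qed.

Definition ae01 (P : R -> Prop) := {ae mu, forall x, 0 <= x <= 1 -> P x}.

Lemma ae01S (P Q : R -> Prop) : (forall x, 0 <= x <= 1 -> P x -> Q x) -> ae01 P -> ae01 Q.
Proof. by move=> PQ; apply: aeS => x Px x01; exact/PQ/Px. Qed.

Lemma ae01I (P Q : R -> Prop) : ae01 P -> ae01 Q -> ae01 (fun x => P x /\ Q x).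
Proof. by move=> aP aQ; apply: aeS (aeI aP aQ) => x [Px Qx] x01; split; auto. Qed.

Lemma ae01W (P : R -> Prop) : (forall x, 0 <= x <= 1 -> P x) -> ae01 P.
Proof. by move=> H; apply: aeW. Qed.

Lemma ae01_null (P : R -> Prop) : ae01 P -> mu [set x | 0 <= x <= 1 /\ ~ P x] = 0%E.
Proof.
move=> [N [mN N0 AN]]; apply: lebesgue_null_subset N0 => x [x01 nP].
by apply: AN => /= /(_ x01).
Qed.

(** Differentiation results hold in the open interval; the two end points join the null set. *)
Lemma ae01_open (P : R -> Prop) : {ae mu, forall x, 0 < x < 1 -> P x} -> ae01 P.
Proof.
move=> [N [mN N0 AN]].
have n1 c : mu.-negligible [set c].
  by exists [set c]; split => //; exact: lebesgue_measure_set1.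
have [M [mM M0 NM]] : mu.-negligible (N `|` ([set 0] `|` [set 1])).
  by apply: (negligibleU _ (negligibleU (n1 0) (n1 1))); exists N; split.
exists M; split => // x /= /not_implyP[/andP[x0 x1] nP]; apply: NM.
have [->|xn0] := eqVneq x 0; first by right; left.
have [->|xn1] := eqVneq x 1; first by right; right.
left; apply: AN => /= H; apply: nP; apply: H.
by rewrite lt_neqAle eq_sym xn0 x0 lt_neqAle xn1.
Qed.

Lemma le_int01_ae f g : locint f -> locint g -> ae01 (fun x => f x <= g x) ->
  int01 f <= int01 g.
Proof. by move=> lf lg fg; rewrite !int01E; exact: le_ointg_ae. Qed.

Import HBNNSimple.

(* No measurability is assumed: multiplying a simple function by the indicator of
   the complement of a null set does not change its integral. *)
Lemma ge0_le_integral_ae d (T : measurableType d) (m : {measure set T -> \bar R})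
    (f g : T -> \bar R) (N : set T) :
  measurable N -> m N = 0%E -> (forall x, 0 <= f x)%E -> (forall x, 0 <= g x)%E ->
  (forall x, ~ N x -> f x = g x) -> (\int[m]_x f x <= \int[m]_x g x)%E.
Proof.
move=> mN N0 f0 g0 fg; rewrite !ge0_integralTE//.
apply: ub_ereal_sup => _ [k kf <-].
have mC : measurable (~` N) by exact: measurableC.
pose k' := proj_nnsfun k mC.
have -> : sintegral m k = sintegral m k'.
  rewrite -!integralT_nnsfun; apply: ge0_ae_eq_integral => //.
  - exact/measurable_EFinP.
  - exact/measurable_EFinP.
  - by move=> x _; rewrite lee_fin.
  - by move=> x _; rewrite lee_fin.
  - exists N; split => // x /= H; apply: contrapT => Nx; apply: H => _.
    by rewrite mindicE mem_set// mulr1.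
apply: ereal_sup_ubound; exists k' => // x /=; rewrite mindicE.
have [xN|xN] := boolP (x \in ~` N); last by rewrite mulr0.
by rewrite mulr1 -fg; [exact: kf|by rewrite inE in xN].
Qed.

(** Meant for the square of a pointwise derivative [derive1 u], whose measurability is not
    established; for nonnegative functions both integrals are suprema over simple functions. *)
Lemma ge0_int01_ae f g : (forall x, 0 <= f x) -> (forall x, 0 <= g x) ->
  ae01 (fun x => f x = g x) -> int01 f = int01 g.
Proof.
move=> f0 g0 [N [mN N0 AN]]; congr fine.
rewrite integral_mkcond [RHS]integral_mkcond.
have H (u v : R -> R) : (forall x, 0 <= u x) -> (forall x, 0 <= v x) ->
    (forall x, ~ N x -> 0 <= x <= 1 -> u x = v x) ->
    (\int[mu]_x ((EFin \o u) \_ `[0%R, 1%R]) x <= \int[mu]_x ((EFin \o v) \_ `[0%R, 1%R]) x)%E.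
  move=> u0 v0 uv; apply: (ge0_le_integral_ae mN N0).
  - by move=> x; rewrite patchE; case: ifP => // _; rewrite lee_fin.
  - by move=> x; rewrite patchE; case: ifP => // _; rewrite lee_fin.
  - move=> x Nx; rewrite !patchE; case: ifPn => //; rewrite inE /= in_itv/= => x01.
    by rewrite uv.
apply/eqP; rewrite eq_le; apply/andP; split; apply: H => // x Nx x01.
  by apply: contrapT => E; apply: Nx; apply: AN => /= /(_ x01).
by apply: contrapT => E; apply: Nx; apply: AN => /= /(_ x01) /esym.
Qed.

(** Lebesgue's differentiation theorem applies to the primitive of [g]; near an interior point [f]
    is that primitive up to a constant, so the derivatives agree. *)
Lemma derive1_primitive f g : locint g ->
  (forall x, 0 <= x <= 1 -> f x = f 0 + ointg 0 x g) ->
  ae01 (fun x => derive1 f x = g x).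
Proof.
move=> lg fE; apply: ae01_open; have [mg Ig] := lg.
have := @FTC1 R g (BLeft 0) (Ig 0).
have lig : locally_integrable [set: R] g.
  split => //; first exact: openT.
  move=> K _ cK; have [M [Mr MK]] := compact_bounded cK.
  have KM : K `<=` `[- (M + 1), M + 1].
    move=> x Kx; rewrite /= in_itv/= -ler_norml; apply: MK Kx.
    by rewrite ltrDl.
  have /integrableP[_] := Ig (- (M + 1)) (M + 1); apply: le_lt_trans.
  apply: ge0_subset_integral => //; first exact: compact_measurable.
  by apply/measurable_EFinP; apply: measurableT_comp => //; exact: measurable_funTS.
move=> /(_ lig) /=; apply: aeS => x H /andP[x0 x1].
have [dF <-] := H x0.
rewrite !derive1E; set F := fun y : R => _ in dF *.
have := @deriveD R R R (cst (f 0)) F x 1 (derivable_cst _ _ _) dF.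
rewrite derive_cst add0r => <-.
apply: near_eq_derive; near=> z.
have z0 : 0 < z by near: z; exact: lt_nbhsr.
have z1 : z < 1 by near: z; exact: lt_nbhsl.
by rewrite /= fE ?ointgE// ltW//= ltW.
Unshelve. all: by end_near. Qed.

End AlmostEverywhere.

(** * Norms *)

Section Norms.
Variable R : realType.
Implicit Types (f g : R -> R) (a b c : R).
Local Notation mu := (@lebesgue_measure R).

Lemma null_ae01 f M : measurable_fun (`[0, 1] : set R) f ->
  mu [set x | 0 <= x <= 1 /\ M < `|f x|] = 0%E -> ae01 (fun x => `|f x| <= M).
Proof.
move=> mf f0; exists (`[0, 1] `&` (fun x => M < `|f x|) @^-1` [set true]); split.
- by apply: measurable_fun_ltr => //; exact: measurableT_comp.
- by apply: lebesgue_null_subset f0 => x /= [+ Mf]; rewrite in_itv.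
- move=> x /= /not_implyP[x01 /negP]; rewrite -ltNge => Mf.
  by rewrite in_itv.
Qed.

Lemma ae01_forall (P : nat -> R -> Prop) : (forall n, ae01 (P n)) ->
  ae01 (fun x => forall n, P n x).
Proof.
move=> aP; have := negligible_bigcup aP; apply: negligibleS => x /=.
move=> /not_implyP[x01 /existsNP[n nP]]; exists n => //= H; exact/nP/H.
Qed.

Lemma inLinfP f : inLinf f <->
  [/\ periodic1 f, measurable_fun (`[0, 1] : set R) f & exists M, ae01 (fun x => `|f x| <= M)].
Proof.
split=> [[pf [mf [M fM]]]|[pf mf [M fM]]].
  by split => //; exists M; exact: null_ae01.
split => //; split => //; exists M; have := ae01_null fM.
by apply: lebesgue_null_subset => x /= [x01 Mf]; split => //; apply/negP; rewrite -ltNge.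
Qed.

Lemma Linfnorm_ge0 f : 0 <= Linfnorm f.
Proof.
rewrite /Linfnorm; set A := [set _ | _].
(* The infimum of the empty set is 0 by convention. *)
have [->|A0] := eqVneq A set0; first by rewrite inf0.
by apply: lb_le_inf; [exact/set0P|move=> x []].
Qed.

Lemma Linfnorm_le f e : 0 <= e -> ae01 (fun x => `|f x| <= e) -> Linfnorm f <= e.
Proof.
move=> e0 fe; apply: ge_inf; first by exists 0 => x [].
split => //; have := ae01_null fe.
by apply: lebesgue_null_subset => x /= [x01 Mf]; split => //; apply/negP; rewrite -ltNge.
Qed.

(** The infimum is attained: the bounds [Linfnorm f + n.+1%:R^-1] hold outside null sets whose
    countable union is null. *)
Lemma Linfnorm_ae f : inLinf f -> ae01 (fun x => `|f x| <= Linfnorm f).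
Proof.
move=> /inLinfP[pf mf [M fM]].
have hi : has_inf [set M : R | 0 <= M /\ mu [set x | 0 <= x <= 1 /\ M < `|f x|] = 0%E].
  split; last by exists 0 => x [].
  exists `|M|; split => //.
  have := ae01_null fM; apply: lebesgue_null_subset => x /= [x01 Mf]; split => //.
  by apply/negP; rewrite -ltNge (le_lt_trans (ler_norm M)).
have H n : ae01 (fun x => `|f x| <= Linfnorm f + n.+1%:R^-1).
  have [|e [e0 en] eI] := inf_adherent _ hi (eps := n.+1%:R^-1); first by rewrite invr_gt0.
  by apply: ae01S (null_ae01 mf en) => x _ /le_trans; apply; exact: ltW.
apply: ae01S (ae01_forall H) => x _ {}H; apply/ler_addgt0Pr => e e0.
have [n ne] := ltr_add_invr (ltr_wpDl (lexx 0) e0 : 0 < 0 + e).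
rewrite (le_trans (H n))// lerD2l ltW//; move: ne; by rewrite !add0r.
Qed.

Lemma eq_Linfnorm f g : ae01 (fun x => f x = g x) -> Linfnorm f = Linfnorm g.
Proof.
move=> fg; congr inf; apply/seteqP.
have H (u v : R -> R) M : ae01 (fun x => u x = v x) ->
    mu [set x | 0 <= x <= 1 /\ M < `|u x|] = 0%E ->
    mu [set x | 0 <= x <= 1 /\ M < `|v x|] = 0%E.
  move=> /ae01_null uv u0; apply: lebesgue_null_subset (lebesgue_null_setU u0 uv).
  move=> x /= [x01 Mv]; have [->|/eqP] := eqVneq (u x) (v x); first by left.
  by right.
split => M /= [M0 fM]; split => //; [exact: H fg fM|apply: H fM].
by apply: ae01S fg.
Qed.

Lemma inLinf_locint f : inLinf f -> locint f.
Proof.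
move=> /inLinfP[pf mf [M fM]]; apply: periodic1_locint => //.
apply/integrableP; split; first exact/measurable_EFinP.
have m01 : measurable (`[0, 1] : set (measurableTypeR R)) by [].
have [_ /(_ 0 1)/integrableP[_]] := locint_cst M; apply: le_lt_trans.
apply: ae_ge0_le_integral => //.
- by apply: measurableT_comp => //; exact/measurable_EFinP.
- apply: aeS fM => x fM; rewrite /= in_itv/= lee_fin => /fM H.
  by rewrite (le_trans H)// ler_norm.
Qed.

Lemma bmeas_inLinf f : periodic1 f -> bmeas f -> inLinf f.
Proof.
move=> pf [mf [M fM]]; apply/inLinfP; split => //; first exact: measurable_funTS.
by exists M; apply: ae01W.
Qed.

Lemma inLinfD f g : inLinf f -> inLinf g -> inLinf (fun x => f x + g x).
Proof.
move=> /inLinfP[pf mf [M fM]] /inLinfP[pg mg [N gN]]; apply/inLinfP; split.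
- by move=> x; rewrite pf pg.
- exact: measurable_funD.
- exists (M + N); apply: ae01S (ae01I fM gN) => x _ [h1 h2].
  by rewrite (le_trans (ler_normD _ _))// lerD.
Qed.

Lemma inLinfM f g : inLinf f -> inLinf g -> inLinf (fun x => f x * g x).
Proof.
move=> /inLinfP[pf mf [M fM]] /inLinfP[pg mg [N gN]]; apply/inLinfP; split.
- by move=> x; rewrite pf pg.
- exact: measurable_funM.
- exists (M * N); apply: ae01S (ae01I fM gN) => x _ [h1 h2].
  by rewrite normrM ler_pM.
Qed.

Lemma inLinf_cst c : inLinf (fun=> c).
Proof. by apply: bmeas_inLinf => //; exact: bmeas_cst. Qed.

Lemma inLinfN f : inLinf f -> inLinf (fun x => - f x).
Proof.
by move=> lf; under eq_fun do rewrite -mulN1r; apply: inLinfM => //; exact: inLinf_cst.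
Qed.

Lemma inLinfB f g : inLinf f -> inLinf g -> inLinf (fun x => f x - g x).
Proof. by move=> lf lg; apply: inLinfD => //; exact: inLinfN. Qed.

(** Cauchy-Schwarz on an interval of length one, read off from the nonnegative variance of |f|
    around its mean [c]. *)
Lemma sqr_int01_le f : locint f -> locint (fun x => f x ^+ 2) ->
  int01 (fun x => `|f x|) ^+ 2 <= int01 (fun x => f x ^+ 2).
Proof.
move=> lf lf2; set c := int01 _.
have : 0 <= int01 (fun x => (`|f x| - c) ^+ 2) by apply: int01_ge0 => x; exact: sqr_ge0.
have ln := locint_norm lf.
have -> : (fun x => (`|f x| - c) ^+ 2) = (fun x => (f x ^+ 2 - 2 * c * `|f x|) + c ^+ 2).
  apply/funext => x; rewrite -[f x ^+ 2]real_normK ?num_real//; ring.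
rewrite int01E ointgD; [|exact/locintB/locintZ|exact: locint_cst].
rewrite ointgB//; last exact: locintZ.
rewrite ointgZ// ointg_cst -!int01E -/c; lra.
Qed.

Lemma int01_le_Linfnorm f : inLinf f -> int01 (fun x => `|f x|) <= Linfnorm f.
Proof.
move=> lf; have -> : Linfnorm f = int01 (fun=> Linfnorm f).
  by rewrite int01E ointg_cst; lra.
apply: le_int01_ae; [exact/locint_norm/inLinf_locint|exact: locint_cst|exact: Linfnorm_ae].
Qed.

Lemma int01_le_H1norm f : inLinf f -> int01 (fun x => `|f x|) <= H1norm f.
Proof.
move=> lf; rewrite /H1norm.
have l1 := inLinf_locint lf; have l2 : locint (fun x => f x ^+ 2).
  by under eq_fun do rewrite expr2; exact/inLinf_locint/inLinfM.
have h1 := sqr_int01_le l1 l2.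
have h2 : 0 <= int01 (fun x => (derive1 f x) ^+ 2) by apply: int01_ge0 => x; exact: sqr_ge0.
have h3 : 0 <= int01 (fun x => `|f x|) by exact: int01_ge0.
rewrite -(ger0_norm h3) -sqrtr_sqr ler_sqrt; first lra.
by rewrite addr_ge0// int01_ge0// => x; exact: sqr_ge0.
Qed.

Lemma H1norm_ge0 f : 0 <= H1norm f.
Proof. exact: sqrtr_ge0. Qed.

(** The bound |f| <= 1 + f^2 gives integrability over one period, and periodicity extends it. *)
Lemma inL2_locint f : inL2 f -> locint f /\ locint (fun x => f x ^+ 2).
Proof.
move=> [pf [mf If]]; split; apply: periodic1_locint => //; last by move=> x; rewrite pf.
have m01 : measurable (`[0, 1] : set (measurableTypeR R)) by [].
have I1 : mu.-integrable `[0, 1] (EFin \o (fun=> 1)).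
  by have [_] := locint_cst (1 : R); apply.
have := integrableD m01 I1 If; apply: le_integrable => //.
  exact/measurable_EFinP.
move=> x _ /=; rewrite lee_fin [leRHS]ger0_norm ?addr_ge0 ?sqr_ge0//.
rewrite -[f x ^+ 2]real_normK ?num_real//.
have := sqr_ge0 (`|f x| - 1); have := normr_ge0 (f x); nra.
Qed.

Lemma H1norm_primitive f g : inL2 g ->
  (forall x, 0 <= x <= 1 -> f x = f 0 + ointg 0 x g) ->
  H1norm f = Num.sqrt (int01 (fun x => f x ^+ 2) + int01 (fun x => g x ^+ 2)).
Proof.
move=> /inL2_locint[lg lg2] fE; rewrite /H1norm; congr (Num.sqrt (_ + _)).
apply: ge0_int01_ae; [by move=> x; exact: sqr_ge0..|].
by apply: ae01S (derive1_primitive lg fE) => x _ ->.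
Qed.

(** As [g] may be unbounded, its primitive need not be Lipschitz; measurability comes from
    continuity on [0, 1]. *)
Lemma measurable_primitive g : locint g ->
  measurable_fun (`[0, 1] : set R) (fun x => ointg 0 x g).
Proof.
move=> [mg Ig].
have -> : measurable_fun (`[0, 1] : set R) (fun x => ointg 0 x g) =
  measurable_fun (`[0, 1] : set R) (fun x => Rintegral mu `[0, x] g).
  apply/propext; split; apply: eq_measurable_fun => x; rewrite inE/= in_itv/= => /andP[x0 _];
   by rewrite ointgE.
apply: subspace_continuous_measurable_fun => //.
exact: (parameterized_integral_continuous _ (Ig 0 1)).
Qed.

Lemma inH1_inLinf f : inH1 f -> inLinf f.
Proof.
move=> [pf [g [/inL2_locint[lg _] fE]]]; apply/inLinfP; split => //.
  have -> : measurable_fun (`[0, 1] : set R) f =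
    measurable_fun (`[0, 1] : set R) (fun x => f 0 + ointg 0 x g).
    apply/propext; split; apply: eq_measurable_fun => x; rewrite inE/= in_itv/= => /fE //.
  by apply: measurable_funD => //; exact: measurable_primitive.
exists (`|f 0| + int01 (fun x => `|g x|)); apply: ae01W => x x01.
rewrite fE// (le_trans (ler_normD _ _))// lerD2l.
have /andP[x0 x1] := x01; have ln := locint_norm lg.
rewrite (le_trans (ointg_norm lg x0))// int01E -(ointg_cat 0 x 1 ln) lerDl.
by rewrite ointgE// Rintegral_ge0.
Qed.

(** Sobolev embedding: |f z| exceeds |f y| by at most the L^1 norm of [g], and averaging over [y]
    replaces |f y| by the L^1 norm of [f]. Each of the two norms is at most [H1norm f], whence the
    factor 2. *)
Lemma inH1_bound f x : inH1 f -> `|f x| <= 2 * H1norm f.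
Proof.
move=> Hf; have lf := inLinf_locint (inH1_inLinf Hf).
have [pf [g [g2 fE]]] := Hf; have [lg lg2] := inL2_locint g2.
have ln := locint_norm lg; have lnf := locint_norm lf.
have [z z01 ->] := periodic1_reduce x pf.
have h1 : int01 (fun x => `|g x|) <= H1norm f.
  have g0 : 0 <= int01 (fun x => `|g x|) by exact: int01_ge0.
  have f20 : 0 <= int01 (fun x => f x ^+ 2) by apply: int01_ge0 => y; exact: sqr_ge0.
  have g20 : 0 <= int01 (fun x => g x ^+ 2) by apply: int01_ge0 => y; exact: sqr_ge0.
  rewrite (H1norm_primitive g2 fE) -(ger0_norm g0) -sqrtr_sqr ler_sqrt ?addr_ge0//.
  by have := sqr_int01_le lg lg2; lra.
have h2 := int01_le_H1norm (inH1_inLinf Hf).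
have D y : 0 <= y <= 1 -> `|f z| <= `|f y| + int01 (fun x => `|g x|).
  move=> y01; have -> : f z = f y + ointg y z g.
    by rewrite (fE _ z01) (fE _ y01) -addrA (ointg_cat 0 y z lg).
  rewrite (le_trans (ler_normD _ _))// lerD2l.
  have H (a b : R) : 0 <= a -> a <= b -> b <= 1 -> `|ointg a b g| <= int01 (fun x => `|g x|).
    move=> a0 ab b1; rewrite (le_trans (ointg_norm lg ab))// int01E.
    rewrite -(ointg_cat 0 a 1 ln) -(ointg_cat a b 1 ln) !ointgE//.
    by rewrite addrCA lerDl addr_ge0// Rintegral_ge0.
  have /andP[z0 z1] := z01; have /andP[y0 y1] := y01.
  case: (leP y z) => [/H|/ltW yz]; first exact.
  by rewrite ointgC// normrN; exact: H.
have : int01 (fun=> `|f z|) <= int01 (fun y => `|f y| + int01 (fun x => `|g x|)).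
  apply: le_int01_ae; [exact: locint_cst|exact/locintD/locint_cst|exact: ae01W].
rewrite int01E ointg_cst int01E ointgD//; last exact: locint_cst.
rewrite ointg_cst -!int01E; lra.
Qed.

(** Both integrals of squares are at most e^2; the factor 2 is a crude bound for the square root of
    2. *)
Lemma H1norm_le f g e : bmeas f -> bmeas g -> periodic1 g -> 0 <= e ->
  (forall x, 0 <= x <= 1 -> f x = f 0 + ointg 0 x g) ->
  (forall x, `|f x| <= e) -> (forall x, `|g x| <= e) -> H1norm f <= 2 * e.
Proof.
move=> bf bg pg e0 fE fe ge.
have sq (u : R -> R) : bmeas u -> (forall x, `|u x| <= e) -> int01 (fun x => u x ^+ 2) <= e ^+ 2.
  move=> bu ue; have -> : e ^+ 2 = int01 (fun=> e ^+ 2) by rewrite int01E ointg_cst; lra.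
  have bu2 : bmeas (fun x => u x ^+ 2) by under eq_fun do rewrite expr2; exact: bmeasM.
  apply: le_int01_ae; [exact: bmeas_locint|exact: locint_cst|].
  by apply: ae01W => x _; rewrite -(real_normK (num_real (u x))) lerXn2r ?nnegrE.
have g2 : inL2 g.
  have bg2 : bmeas (fun x => g x ^+ 2) by under eq_fun do rewrite expr2; exact: bmeasM.
  split => //; split; first by apply: measurable_funTS; case: bg.
  by have [_] := bmeas_locint bg2; apply.
rewrite (H1norm_primitive g2 fE).
have -> : 2 * e = Num.sqrt ((2 * e) ^+ 2) by rewrite sqrtr_sqr ger0_norm// mulr_ge0.
rewrite ler_sqrt ?sqr_ge0//.
by have := sq f bf fe; have := sq g bg ge; have := sqr_ge0 e; nra.
Qed.

Lemma bmeas_inW1inf f g : periodic1 f -> periodic1 g -> bmeas g ->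
  (forall x, f x = f 0 + ointg 0 x g) -> inW1inf f.
Proof. by move=> pf pg bg fE; split => //; exists g; split => //; exact: bmeas_inLinf. Qed.

Lemma bmeas_inH1 f g : periodic1 f -> periodic1 g -> bmeas g ->
  (forall x, f x = f 0 + ointg 0 x g) -> inH1 f.
Proof.
move=> pf pg bg fE; split => //; exists g; split => //.
have bg2 : bmeas (fun x => g x ^+ 2) by under eq_fun do rewrite expr2; exact: bmeasM.
split => //; split; first by apply: measurable_funTS; case: bg.
by have [_] := bmeas_locint bg2; apply.
Qed.

End Norms.

(** * Measures given by a nonnegative density *)

Section DensityMeasure.
Context d (T : measurableType d) (R : realType).
Variables (m : {measure set T -> \bar R}) (g : T -> R).
Hypotheses (mg : measurable_fun setT g) (g0 : forall x, 0 <= g x).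

Definition density_measure (A : set T) : \bar R := (\int[m]_(x in A) (g x)%:E)%E.

Let density0 : density_measure set0 = 0%E.
Proof. by rewrite /density_measure integral_set0. Qed.

Let density_ge0 A : (0 <= density_measure A)%E.
Proof. by apply: integral_ge0 => x _; rewrite lee_fin. Qed.

Let density_sigma_additive : semi_sigma_additive density_measure.
Proof.
move=> /= F mF tF mUF; rewrite /density_measure; apply: cvg_toP.
  apply: ereal_nondecreasing_is_cvgn => a b ab.
  by apply: lee_sum_nneg_natr => // k _ _; exact: density_ge0.
rewrite ge0_integral_bigcup//=; last by move=> x _; rewrite lee_fin.
by apply/measurable_EFinP; exact: measurable_funTS.
Qed.

HB.instance Definition _ := isMeasure.Build _ _ _
  density_measure density0 density_ge0 density_sigma_additive.

Definition density : {measure set T -> \bar R} := density_measure.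

Import HBNNSimple.

Lemma integral_density_nnsfun (k : {nnsfun T >-> R}) :
  (\int[density]_x (k x)%:E = \int[m]_x (k x * g x)%:E)%E.
Proof.
rewrite integralT_nnsfun sintegralE.
transitivity (\int[m]_x (\sum_(y \in range k) (y * (\1_(k @^-1` [set y]) x * g x))%:E))%E; last first.
  apply: eq_integral => x _; rewrite [in RHS]fimfunE fsumEFin//; congr (_%:E).
  rewrite -[RHS]mulrC mulr_fsumr; apply: eq_fsbigr => y _; ring.
rewrite ge0_integral_fsum//; last 2 first.
- move=> y; apply/measurable_EFinP; apply: measurable_funM => //.
  by apply: measurable_funM.
- move=> y x _; rewrite lee_fin mulrA mulr_ge0// -lee_fin.
  exact: nnfun_muleindic_ge0.
apply: eq_fsbigr => y /[!inE] -[z _ <-].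
under eq_integral do rewrite EFinM.
rewrite ge0_integralZl_EFin//.
- congr (_ * _)%E; rewrite /density/= /density_measure integral_mkcond.
  apply: eq_integral => x _; rewrite /patch indicE; case: ifP => _; by rewrite ?mul1r ?mul0r.
- by move=> x _; rewrite lee_fin mulr_ge0.
- by apply/measurable_EFinP; apply: measurable_funM.
Qed.

(** Simple functions are covered by [integral_density_nnsfun]; monotone convergence on both sides
    does the rest. *)
Lemma ge0_integral_density (f : T -> R) : measurable_fun setT f -> (forall x, 0 <= f x) ->
  (\int[density]_x (f x)%:E = \int[m]_x (f x * g x)%:E)%E.
Proof.
move=> mf f0; have mf' : measurable_fun setT (EFin \o f) by exact/measurable_EFinP.
pose h := nnsfun_approx measurableT mf'.
have f0' x : setT x -> (0 <= (EFin \o f) x)%E by rewrite lee_fin.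
have hf x : ((h n x)%:E @[n --> \oo] --> (f x)%:E)%E.
  exact: (cvg_nnsfun_approx measurableT mf' f0').
have hnd x : {homo (fun n => h n x) : a b / (a <= b)%N >-> a <= b}.
  by move=> a b ab; exact/lefP/nd_nnsfun_approx.
transitivity (limn (fun n => \int[density]_x (h n x)%:E)%E).
  rewrite -monotone_convergence//.
  - by apply: eq_integral => x _; apply/esym/cvg_lim.
  - by move=> n; exact/measurable_EFinP.
  - by move=> n x _; rewrite lee_fin.
  - by move=> x _ a b ab; rewrite lee_fin; exact: hnd.
under eq_fun do rewrite integral_density_nnsfun.
rewrite -monotone_convergence//.
- apply: eq_integral => x _; apply/cvg_lim => //.
  under eq_fun do rewrite EFinM.
  by rewrite EFinM; exact: cvgeZr.
- by move=> n; apply/measurable_EFinP; exact: measurable_funM.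
- by move=> n x _; rewrite lee_fin mulr_ge0.
- by move=> x _ a b ab; rewrite lee_fin ler_wpM2r//; exact: hnd.
Qed.

End DensityMeasure.

(** * Exceptional sets of periodic statements *)

Section PeriodicAe.
Variable R : realType.
Implicit Types (f g : R -> R) (a b c : R).
Local Notation mu := (@lebesgue_measure R).

Lemma negligible_shift c (A : set R) : mu.-negligible A ->
  mu.-negligible [set x | A (x + c)].
Proof.
move=> [N [mN N0 AN]]; exists (shift_by c @^-1` N); split.
- by rewrite -[X in measurable X]setTI; exact: measurable_shift_by.
- by rewrite -[LHS]/(pushforward mu (shift_by c) N) lebesgue_measure_shift_by.
- by move=> x /=; exact: AN.
Qed.

(** The exceptional set is covered by countably many integer translates of its part in [0, 1]. *)
Lemma ae01_periodic (P : R -> Prop) : (forall x, P (x + 1) <-> P x) -> ae01 P ->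
  {ae mu, forall x, P x}.
Proof.
move=> pP aP.
have pPn (n : nat) x : P (x + n%:R) <-> P x.
  elim: n x => [|n IH] x; first by rewrite addr0.
  by rewrite -natr1 addrA pP.
have := negligibleU (negligible_bigcup (fun n => negligible_shift n%:R aP))
  (negligible_bigcup (fun n => negligible_shift (- n%:R) aP)).
apply: negligibleS => x /= nPx; pose k := Num.floor x.
have k1 : 0 <= x - k%:~R <= 1.
  have := floor_le x; have := floorD1_gt x; rewrite intrD -/k.
  by move=> *; apply/andP; split; lra.
case Ek : k => [n|n]; rewrite Ek in k1.
- right; exists n => //= /(_ k1) H; apply: nPx.
  by have := (pPn n (x - n%:R)).2 H; rewrite subrK.
- left; exists n.+1 => //= H; apply: nPx; apply/(pPn n.+1 x).1; apply: H.
  by move: k1; rewrite NegzE mulrNz opprK.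
Qed.

Lemma ge0_Rintegral_ae f g a b : (forall x, 0 <= f x) -> (forall x, 0 <= g x) ->
  {ae mu, forall x, f x = g x} -> Rintegral mu `[a, b] f = Rintegral mu `[a, b] g.
Proof.
move=> f0 g0 [N [mN N0 AN]]; congr fine.
rewrite integral_mkcond [RHS]integral_mkcond.
have fgN x : ~ N x -> f x = g x by move=> Nx; apply: contrapT => E; exact/Nx/AN.
apply/eqP; rewrite eq_le; apply/andP; split; apply: (ge0_le_integral_ae mN N0).
- by move=> x; rewrite patchE; case: ifP => // _; rewrite lee_fin.
- by move=> x; rewrite patchE; case: ifP => // _; rewrite lee_fin.
- by move=> x Nx; rewrite !patchE; case: ifPn => //; rewrite fgN.
- by move=> x; rewrite patchE; case: ifP => // _; rewrite lee_fin.
- by move=> x; rewrite patchE; case: ifP => // _; rewrite lee_fin.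
- by move=> x Nx; rewrite !patchE; case: ifPn => //; rewrite fgN.
Qed.

Lemma derive1_periodic f : periodic1 f -> periodic1 (derive1 f).
Proof.
move=> pf x; rewrite /derive1.
have -> : (fun t : R => t^-1 *: (f (t + (x + 1)) - f (x + 1))) =
    (fun t => t^-1 *: (f (t + x) - f x)) by apply/funext => t; rewrite addrA !pf.
by [].
Qed.

End PeriodicAe.

(** * The Lagrangian coordinate *)

(** [inH1] provides the primitive on [0, 1] only. Periodicity of [u] forces [q] to have mean zero,
    so the primitive of [q] is periodic as well and the identity extends to the line. *)
Lemma inH1_weak_derivative (R : realType) (u : R -> R) : inH1 u ->
  exists q : R -> R, [/\ periodic1 q, locint q, locint (fun x => q x ^+ 2),
    {ae (@lebesgue_measure R), forall x, derive1 u x = q x} &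
    forall x, u x = u 0 + ointg 0 x q].
Proof.
move=> [pu [q [q2 uE]]]; have [lq lq2] := inL2_locint q2; have [pq _] := q2.
exists q; split => //.
  apply: ae01_periodic; first by move=> x; rewrite derive1_periodic// pq.
  exact: derive1_primitive.
have q0 : int01 q = 0.
  have : u (0 + 1) = u 0 + ointg 0 1 q by rewrite add0r; apply: uE; rewrite ler01 lexx.
  by rewrite pu int01E; lra.
have pd : periodic1 (fun x => u x - ointg 0 x q).
  by move=> x; rewrite pu ointg0D1// q0 addr0.
move=> x; have [z z01 /= zx] := periodic1_reduce x pd.
by move: zx; rewrite (uE z z01); lra.
Qed.

Section LagrangianCoordinate.
Variable R : realType.
Variables (q y : R -> R) (h : R).
Local Notation mu := (@lebesgue_measure R).
Hypotheses (pq : periodic1 q) (lq : locint q) (lq2 : locint (fun x => q x ^+ 2)).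
Hypothesis hE : h = int01 (fun x => q x ^+ 2).
Hypothesis yE : forall xi, y xi + ointg 0 (y xi) (fun x => q x ^+ 2) = (1 + h) * xi.

(** Divided by [1 + h], the defining equation of [y] reads G (y xi) = xi: [G] is the explicit
    inverse of [y], and [g] is its derivative. All properties of [y] are derived from [G]. *)
Let G x := (x + ointg 0 x (fun x => q x ^+ 2)) / (1 + h).
Let g x := (1 + q x ^+ 2) / (1 + h).

Lemma energy_ge0 : 0 <= h.
Proof. by rewrite hE; apply: int01_ge0 => x; exact: sqr_ge0. Qed.

Let h1 : 0 < 1 + h. Proof. by have := energy_ge0; lra. Qed.

Let g0 x : 0 <= g x.
Proof. by apply: divr_ge0; [rewrite addr_ge0 ?sqr_ge0|exact: ltW]. Qed.

Let lg : locint g.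
Proof.
have -> : g = (fun x => (1 + h)^-1 * (1 + q x ^+ 2)) by apply/funext => x; rewrite mulrC.
exact/locintZ/locintD/lq2/locint_cst.
Qed.

Let GB a b : ointg a b g = G b - G a.
Proof.
have -> : g = (fun x => (1 + h)^-1 * (1 + q x ^+ 2)) by apply/funext => x; rewrite mulrC.
rewrite ointgZ; last exact/locintD/lq2/locint_cst.
rewrite ointgD//; last exact: locint_cst.
rewrite ointg_cst /G -(ointg_cat 0 a b lq2); field.
by rewrite gt_eqF.
Qed.

(** The energy term is nondecreasing, so [G] grows at rate at least 1 / (1 + h). This yields both
    strict monotonicity and the Lipschitz constant 1 + h of [y]. *)
Let G_le a b : a <= b -> (b - a) / (1 + h) <= G b - G a.
Proof.
move=> ab; rewrite /G -mulrBl ler_pM2r ?invr_gt0//.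
rewrite -(ointg_cat 0 a b lq2).
have : 0 <= ointg a b (fun x => q x ^+ 2).
  by rewrite ointgE// Rintegral_ge0// => x _; exact: sqr_ge0.
lra.
Qed.

Let G_mono : {mono G : a b / a <= b}.
Proof.
apply: le_mono => a b ab; have := G_le (ltW ab).
have : 0 < (b - a) / (1 + h) by rewrite divr_gt0// subr_gt0.
lra.
Qed.

Let Gy x : G (y x) = x.
Proof. by rewrite /G yE mulrAC mulfV ?mul1r// gt_eqF. Qed.

Let yG x : y (G x) = x.
Proof. by apply: (inc_inj G_mono); rewrite Gy. Qed.

Let G_lt a b : (G a < G b) = (a < b).
Proof. exact: (leW_mono G_mono). Qed.

Let y_le : {mono y : a b / a <= b}.
Proof. by move=> a b; rewrite -G_mono !Gy. Qed.

Lemma lagrangian_lipschitz a b : `|y a - y b| <= (1 + h) * `|a - b|.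
Proof.
wlog ab : a b / b <= a => [H|].
  case: (leP b a) => [/H//|/ltW/H]; by rewrite distrC [X in _ * X]distrC.
have yab : y b <= y a by rewrite y_le.
have := G_le yab; rewrite !Gy ler_pdivrMr// => H.
by rewrite !ger0_norm ?subr_ge0// mulrC.
Qed.

Lemma lagrangian_measurable : measurable_fun setT y.
Proof. exact: lipschitz_measurable lagrangian_lipschitz. Qed.

Lemma lagrangian0 : y 0 = 0.
Proof. by apply: (inc_inj G_mono); rewrite Gy /G ointg_id addr0 mul0r. Qed.

Lemma lagrangianD1 x : y (x + 1) = y x + 1.
Proof.
apply: (inc_inj G_mono); rewrite Gy /G ointg0D1//; last by move=> z; rewrite pq.
rewrite -hE; have := yE x => yx.
have -> : y x + 1 + (ointg 0 (y x) (fun x => q x ^+ 2) + h) = (1 + h) * (x + 1) by lra.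
by rewrite mulrAC mulfV ?mul1r// gt_eqF.
Qed.

Let Gm : measurableTypeR R -> measurableTypeR R := G.

Let mG : measurable_fun setT Gm.
Proof. by apply: nondecreasing_measurable => // a b ab; rewrite /Gm G_mono. Qed.

Let mg : measurable_fun setT (g : measurableTypeR R -> R).
Proof. by case: lg. Qed.

Let nu := density mu mg g0.

Let preimG a b : Gm @^-1` `[a, b] = `[y a, y b]%classic.
Proof.
have E1 x : (y a <= x) = (a <= G x) by rewrite -(G_mono (y a)) Gy.
have E2 x : (x <= y b) = (G x <= b) by rewrite -(G_mono x) Gy.
by apply/seteqP; split => x /=; rewrite !in_itv/= E1 E2.
Qed.

(** The preimage of ]a, b] under [G] is ]y a, y b], whose mass for the density [g] is G (y b) - G (y
    a) = b - a; uniqueness of Lebesgue measure gives all other sets. *)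
Let nuG (A : set R) : measurable A -> pushforward nu Gm A = mu A.
Proof.
move=> mA; apply/esym/lebesgue_measure_unique => //=.
move=> X [[a b]] _ <-; rewrite /pushforward/=.
have -> : Gm @^-1` `]a, b] = `]y a, y b]%classic.
  have E1 x : (y a < x) = (a < G x) by rewrite -(G_lt (y a)) Gy.
  have E2 x : (x <= y b) = (G x <= b) by rewrite -(G_mono x) Gy.
  by apply/seteqP; split => x /=; rewrite !in_itv/= E1 E2.
have := lebesgue_measure_itv (`]a, b] : interval R) => /= ->.
rewrite lte_fin /density_measure; case: ltP => ab; last first.
  by rewrite set_itv_ge ?integral_set0// bnd_simp -leNgt y_le.
have yab : y a <= y b by rewrite y_le ltW.
have [_ Ig] := lg.
rewrite integral_itv_obnd_cbnd; last exact/measurable_EFinP/measurable_funTS.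
rewrite -[RHS]fineK; last exact: integrable_fin_num.
by rewrite -EFinD -[fine _]/(Rintegral mu `[y a, y b] g) -(ointgE g yab) GB !Gy.
Qed.

(** Transport by [nuG]: the identity y (G x) = x cancels the composition, and the interval is
    carried along as an indicator. *)
Let change_ge0 (F : R -> R) a b : measurable_fun setT F -> (forall x, 0 <= F x) ->
  Rintegral mu `[a, b] (F \o y) = Rintegral mu `[y a, y b] (fun x => F x * g x).
Proof.
move=> mF F0; congr fine.
transitivity (\int[pushforward nu Gm]_(x in `[a, b]) ((EFin \o (F \o y)) x))%E.
  by apply: eq_measure_integral => // A mA _; exact/esym/nuG.
have mFy : measurable_fun setT (F \o y) by apply: measurableT_comp => //; exact: lagrangian_measurable.
rewrite ge0_integral_pushforward//; last 2 first.
- exact/measurable_EFinP/measurable_funTS.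
- by move=> x _; rewrite lee_fin F0.
rewrite preimG integral_mkcond.
transitivity (\int[nu]_x ((F x * \1_(`[y a, y b]%classic : set R) x)%:E))%E.
  apply: eq_integral => x _; rewrite /patch indicE.
  by case: ifP => _; rewrite ?mulr1 ?mulr0//= yG.
rewrite ge0_integral_density//; last 2 first.
- by apply: measurable_funM => //; exact: measurable_indic.
- by move=> x; rewrite mulr_ge0// indicE.
rewrite [RHS]integral_mkcond; apply: eq_integral => x _; rewrite /patch indicE.
by case: ifP => _; rewrite ?mulr1// mulr0 mul0r.
Qed.

Lemma lagrangian_change_of_variables (F : R -> R) a b : bmeas F -> a <= b ->
  ointg a b (F \o y) = ointg (y a) (y b) (fun x => F x * g x).
Proof.
move=> bF ab; have [mF [M FM]] := bF; have yab : y a <= y b by rewrite y_le.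
have bFy : bmeas (F \o y).
  split; first by apply: measurableT_comp => //; exact: lagrangian_measurable.
  by exists M => x; exact: FM.
have lF : locint (fun x => F x * g x) by exact: locintM.
(* Adding the bound [M] makes the integrand nonnegative; the formula for the constant [M] is
   subtracted afterwards. *)
have H1 : ointg a b (fun x => F (y x) + M) = ointg (y a) (y b) (fun x => (F x + M) * g x).
  rewrite !ointgE//; apply: (change_ge0 (F := fun x => F x + M)).
    exact: measurable_funD.
  by move=> x; have := FM x; rewrite ler_norml => /andP[+ _]; lra.
have H2 : ointg a b (fun=> M) = ointg (y a) (y b) (fun x => M * g x).
  rewrite !ointgE//; apply: (change_ge0 (F := fun x => M)) => // x.
  by rewrite (le_trans _ (FM x)).
have lM : locint (fun x => M * g x) by exact: locintZ.
have E : (fun x => (F x + M) * g x) = (fun x => F x * g x + M * g x).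
  by apply/funext => x; rewrite mulrDl.
have H3 : ointg a b (fun x => F (y x) + M) = ointg a b (F \o y) + ointg a b (fun=> M).
  by apply: ointgD; [exact: bmeas_locint|exact: locint_cst].
rewrite H3 E (ointgD _ _ lF lM) in H1.
by move: H1; rewrite H2 => /addIr.
Qed.

(** The inverse [G] is absolutely continuous: the measure of the preimage of a null set [N] under
    [y] is the integral of [g] over [N], hence 0. Needed because the initial data compose an almost
    everywhere defined derivative with [y]. *)
Lemma lagrangian_ae (P : R -> Prop) : {ae mu, forall x, P x} ->
  {ae mu, forall x, P (y x)}.
Proof.
move=> [N [mN N0 PN]]; exists (y @^-1` N); split.
- by rewrite -[X in measurable X]setTI; exact: lagrangian_measurable.
- rewrite -nuG; last by rewrite -[X in measurable X]setTI; exact: lagrangian_measurable.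
  rewrite /pushforward -comp_preimage.
  have -> : (y \o G) @^-1` N = N by apply/funext => x /=; rewrite yG.
  rewrite /nu/= /density_measure; apply: null_set_integral => //.
  exact/measurable_EFinP/measurable_funTS.
- by move=> x /= H; exact: PN.
Qed.

End LagrangianCoordinate.

(** * Euler scheme *)

Section DyadicLimits.
Variable R : realType.
Implicit Types (u : nat -> R) (a b C : R).

Lemma le_dyadic a b C : (forall n, a <= b + C * 2^-1 ^+ n) -> a <= b.
Proof.
move=> H; have h2 : `|2^-1 : R| < 1 by rewrite ger0_norm ?invr_ge0//; lra.
have c1 : b + C * 2^-1 ^+ n @[n --> \oo] --> b + C * 0.
  by apply: cvgD; [exact: cvg_cst|apply: cvgMl_tmp; exact: cvg_expr].
have -> : b = lim (b + C * 2^-1 ^+ n @[n --> \oo]).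
  by rewrite (cvg_lim _ c1)// mulr0 addr0.
apply: limr_ge; first by apply/cvg_ex; exists (b + C * 0).
by apply: nearW.
Qed.

(** With r n = 2 C 2^-n the intervals [u n - r n, u n + r n] are nested, since the radius loses
    exactly the C 2^-n by which the centre may move. The limit is the supremum of the left end
    points. *)
Lemma cvg_dyadic u C : (forall n, `|u n.+1 - u n| <= C * 2^-1 ^+ n) ->
  forall n, `|u n - lim (u @ \oo)| <= 2 * C * 2^-1 ^+ n.
Proof.
move=> uC.
have h2 : `|2^-1 : R| < 1 by rewrite ger0_norm ?invr_ge0//; lra.
pose r n : R := 2 * C * 2^-1 ^+ n.
have r1 n : r n.+1 = r n / 2 by rewrite /r exprS; field.
have rE n : C * 2^-1 ^+ n = r n / 2 by rewrite /r; field.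
have v_nd : nondecreasing_seq (fun n => u n - r n).
  apply/nondecreasing_seqP => n; have := uC n; rewrite rE r1 ler_norml => /andP[+ _]; lra.
have w_ni : nonincreasing_seq (fun n => u n + r n).
  apply/nonincreasing_seqP => n; have := uC n; rewrite rE r1 ler_norml => /andP[_ +]; lra.
have r0 n : 0 <= r n by have := uC n; have := normr_ge0 (u n.+1 - u n); rewrite rE; lra.
have vw m n : u m - r m <= u n + r n.
  have h1 := v_nd _ _ (leq_maxl m n); have h3 := w_ni _ _ (leq_maxr m n).
  by have := r0 (maxn m n); lra.
pose l := sup (range (fun n => u n - r n)).
have hs : has_sup (range (fun n => u n - r n)).
  by split; [exists (u 0%N - r 0%N); exists 0%N|exists (u 0%N + r 0%N) => _ [m _ <-]].
have ul n : `|u n - l| <= r n.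
  rewrite ler_norml; apply/andP; split.
    have : l <= u n + r n by apply: ge_sup; [case: hs|move=> _ [m _ <-]].
    lra.
  have : u n - r n <= l by apply: ub_le_sup; [case: hs|exists n].
  lra.
have rc : r n @[n --> \oo] --> 0.
  by rewrite -[X in _ --> X](mulr0 (2 * C)); apply: cvgMl_tmp; exact: cvg_expr.
have uc : u @ \oo --> l.
  apply/cvgrPdist_le => e e0; move/cvgrPdist_le: rc => /(_ e e0).
  by apply: filterS => n; rewrite sub0r normrN distrC => /(le_trans (ler_norm _)); exact: le_trans.
by move=> n; rewrite (cvg_lim _ uc)//; exact: ul.
Qed.

Lemma is_cvg_dyadic u C l : (forall n, `|u n - l| <= C * 2^-1 ^+ n) -> u @ \oo --> l.
Proof.
move=> ul; have h2 : `|2^-1 : R| < 1 by rewrite ger0_norm ?invr_ge0//; lra.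
have rc : C * 2^-1 ^+ n @[n --> \oo] --> 0.
  by rewrite -[X in _ --> X](mulr0 C); apply: cvgMl_tmp; exact: cvg_expr.
apply/cvgrPdist_le => e e0; move/cvgrPdist_le: rc => /(_ e e0).
by apply: filterS => n; rewrite sub0r normrN distrC => /(le_trans (ler_norm _)); exact: le_trans.
Qed.

End DyadicLimits.

(** * Euler's scheme on a family of growing domains *)

Section EulerScheme.
(** [D t] is thought of as the states reachable by time [t]. A step of length [r] leads from [D t]
    into [D (t + r)], so all iterates up to time T lie in [D T], where [F] has the bound [B T] and
    the Lipschitz constant [L T]; no global Lipschitz constant is required. Closeness is uniform
    over the indices in [X]. *)
Variables (R : realType) (X : Type) (F : (X -> R) -> X -> R).
Variables (D : R -> (X -> R) -> Prop) (L B : R -> R) (x0 : X -> R).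
Hypothesis D_mono : forall s t x, s <= t -> D s x -> D t x.
Hypothesis D_lim : forall t (u : nat -> X -> R) x, (forall n, D t (u n)) ->
  (forall i, u n i @[n --> \oo] --> x i) -> D t x.
Hypothesis D_step : forall t r x, 0 <= t -> 0 <= r -> D t x ->
  D (t + r) (fun i => x i + r * F x i).
Hypothesis D0 : D 0 x0.
Hypothesis L_ge0 : forall t, 0 <= L t.
Hypothesis B_ge0 : forall t, 0 <= B t.
Hypothesis F_lipschitz : forall t x y e, 0 <= t -> D t x -> D t y ->
  (forall i, `|x i - y i| <= e) -> forall i, `|F x i - F y i| <= L t * e.
Hypothesis F_bound : forall t x i, 0 <= t -> D t x -> `|F x i| <= B t.

Let step (r : R) (x : X -> R) (i : X) := x i + r * F x i.
Let tau (n : nat) : R := 2^-1 ^+ n.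
Let E n k := iter k (step (tau n)) x0.

Let tau_gt0 n : 0 < tau n. Proof. by rewrite exprn_gt0. Qed.
Let tau_ge0 n : 0 <= tau n. Proof. exact/ltW. Qed.
Let tauS n : tau n.+1 = tau n / 2. Proof. by rewrite /tau exprS mulrC. Qed.
Let tau_le1 n : tau n <= 1.
Proof. by rewrite exprn_ile1// ?invr_ge0//; lra. Qed.

Let DE n k : D (k%:R * tau n) (E n k).
Proof.
elim: k => [|k IH]; first by rewrite mul0r.
by rewrite -natr1 mulrDl mul1r; apply: D_step => //; rewrite mulr_ge0.
Qed.

Let DET T n k : k%:R * tau n <= T -> D T (E n k).
Proof. by move=> kT; apply: D_mono (DE n k). Qed.

Let T_ge0 T n k : k%:R * tau n <= T -> 0 <= T.
Proof. by apply: le_trans; rewrite mulr_ge0. Qed.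

Let kS n k T : k.+1%:R * tau n <= T -> k%:R * tau n <= T.
Proof. by apply: le_trans; rewrite ler_wpM2r// ler_nat. Qed.

Let E_incr T n k j i : (k + j)%:R * tau n <= T ->
  `|E n (k + j) i - E n k i| <= j%:R * tau n * B T.
Proof.
elim: j => [|j IH] kjT; first by rewrite addn0 subrr normr0 !mul0r.
rewrite addnS in kjT *; have kjT' := kS kjT.
have -> : E n (k + j).+1 i - E n k i = (E n (k + j) i - E n k i) + tau n * F (E n (k + j)) i.
  by rewrite /E iterS {1}/step; ring.
rewrite (le_trans (ler_normD _ _))// -natr1 !mulrDl mul1r lerD ?IH//.
by rewrite normrM ger0_norm// ler_wpM2l// F_bound ?(T_ge0 kjT)//; exact: DET.
Qed.

(** Freezing the field during [j] steps makes an error of at most tau L (j tau B) per step, hence a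
    quadratic one over the time span j tau. In this form the bound survives the passage to the
    limit. *)
Let E_consistent T n k j i : (k + j)%:R * tau n <= T ->
  `|E n (k + j) i - E n k i - j%:R * tau n * F (E n k) i| <= L T * B T * (j%:R * tau n) ^+ 2.
Proof.
elim: j => [|j IH] kjT.
  by rewrite addn0 subrr !mul0r subrr normr0 expr0n/= mulr0.
rewrite addnS in kjT *; have kjT' := kS kjT.
have -> : E n (k + j).+1 i - E n k i - j.+1%:R * tau n * F (E n k) i =
   (E n (k + j) i - E n k i - j%:R * tau n * F (E n k) i) +
   tau n * (F (E n (k + j)) i - F (E n k) i).
  by rewrite /E iterS {1}/step -natr1; ring.
have kT : k%:R * tau n <= T.
  by apply: le_trans kjT'; rewrite ler_wpM2r// ler_nat leq_addr.
have T0 := T_ge0 kT.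
have H := F_lipschitz T0 (DET kjT') (DET kT) (fun i => E_incr i kjT') i.
have H2 : `|tau n * (F (E n (k + j)) i - F (E n k) i)| <= tau n * (L T * (j%:R * tau n * B T)).
  by rewrite normrM ger0_norm// ler_wpM2l.
rewrite (le_trans (ler_normD _ _))// (le_trans (lerD (IH kjT') H2))// -natr1.
have : 0 <= L T * B T * tau n ^+ 2 * (j%:R + 1).
  by rewrite !mulr_ge0// ?exprn_ge0// addr_ge0.
lra.
Qed.

(** Discrete Gronwall estimate: replacing one step by two half steps makes a local error of order
    tau^2 L B, and each step amplifies the earlier errors by 1 + L tau. *)
Let E_refine T n k i : k%:R * tau n <= T ->
  `|E n.+1 k.*2 i - E n k i| <= k%:R * tau n ^+ 2 * (L T * B T) * (1 + L T * tau n) ^+ k.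
Proof.
elim: k i => [|k IH] i kT; first by rewrite subrr normr0 !mul0r.
have kT' := kS kT; have T0 := T_ge0 kT.
rewrite doubleS; set y := E n.+1 k.*2; set x := E n k.
pose y' := step (tau n.+1) y.
have -> : E n.+1 k.*2.+2 i = y i + tau n / 2 * F y i + tau n / 2 * F y' i.
  by rewrite -tauS.
have -> : E n k.+1 i = x i + tau n * F x i by [].
set e := k%:R * tau n ^+ 2 * (L T * B T) * (1 + L T * tau n) ^+ k.
have xy j : `|y j - x j| <= e by exact: IH.
have e0 : 0 <= e by apply: le_trans (xy i).
have kk : (k.*2)%:R * tau n.+1 = k%:R * tau n by rewrite -muln2 natrM tauS; field.
have Dx : D T x by exact: DET.
have Dy : D T y by apply: DET; rewrite kk.
have Dy' : D T y'.
  have : D T (E n.+1 k.*2.+1).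
    apply: DET; rewrite -natr1 mulrDl kk mul1r tauS (le_trans _ kT)//.
    have -> : k.+1%:R = k%:R + 1 :> R by rewrite natr1.
    by have := tau_ge0 n; lra.
  by [].
have xy' j : `|y' j - x j| <= e + tau n / 2 * B T.
  rewrite /y' /step addrAC (le_trans (ler_normD _ _))// lerD//.
  rewrite normrM tauS ger0_norm ?divr_ge0// ler_wpM2l ?divr_ge0//.
  exact: F_bound.
have Fy := F_lipschitz T0 Dy Dx xy i.
have Fy' := F_lipschitz T0 Dy' Dx xy' i.
have -> : y i + tau n / 2 * F y i + tau n / 2 * F y' i - (x i + tau n * F x i) =
   (y i - x i) + (tau n / 2 * (F y i - F x i) + tau n / 2 * (F y' i - F x i)) by field.
have N1 : `|tau n / 2 * (F y i - F x i)| <= tau n / 2 * (L T * e).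
  by rewrite normrM ger0_norm ?divr_ge0// ler_wpM2l ?divr_ge0.
have N2 : `|tau n / 2 * (F y' i - F x i)| <= tau n / 2 * (L T * (e + tau n / 2 * B T)).
  by rewrite normrM ger0_norm ?divr_ge0// ler_wpM2l ?divr_ge0.
have := ler_normD (y i - x i) (tau n / 2 * (F y i - F x i) + tau n / 2 * (F y' i - F x i)).
have := ler_normD (tau n / 2 * (F y i - F x i)) (tau n / 2 * (F y' i - F x i)).
have c0 : 0 <= tau n ^+ 2 * (L T * B T) by rewrite !mulr_ge0// exprn_ge0.
have P1 : 1 <= (1 + L T * tau n) ^+ k.+1.
  by apply: exprn_ege1; rewrite lerDl mulr_ge0.
have -> : k.+1%:R * tau n ^+ 2 * (L T * B T) * (1 + L T * tau n) ^+ k.+1 =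
   (1 + L T * tau n) * e + tau n ^+ 2 * (L T * B T) * (1 + L T * tau n) ^+ k.+1.
  have -> : k.+1%:R = k%:R + 1 :> R by rewrite natr1.
  rewrite /e [(1 + _) ^+ k.+1]exprS; set z := (1 + _) ^+ k; ring.
have : tau n ^+ 2 * (L T * B T) * 1 <= tau n ^+ 2 * (L T * B T) * (1 + L T * tau n) ^+ k.+1.
  by rewrite ler_wpM2l.
have := xy i; lra.
Qed.

(** The first summand bounds the effect of halving the step, the second that of the one fine step by
    which [idx n.+1 t] may exceed twice [idx n t]. *)
Let C T := T * (L T * B T) * expR (L T * T) + B T.

Let E_refine_bound T n k i : k%:R * tau n <= T ->
  `|E n.+1 k.*2 i - E n k i| <= T * (L T * B T) * expR (L T * T) * tau n.
Proof.
move=> kT; have T0 := T_ge0 kT; rewrite (le_trans (E_refine i kT))//.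
have H : (1 + L T * tau n) ^+ k <= expR (L T * T).
  rewrite (@le_trans _ _ (expR (L T * tau n) ^+ k))//.
    by rewrite lerXn2r ?nnegrE ?addr_ge0 ?mulr_ge0 ?expR_ge0 ?expR_ge1Dx.
  by rewrite -expRM_natl ler_expR mulrCA ler_wpM2l.
have h1 : k%:R * tau n ^+ 2 * (L T * B T) <= T * tau n * (L T * B T).
  by rewrite ler_wpM2r ?mulr_ge0// expr2 mulrA ler_wpM2r.
apply: (le_trans (ler_pM _ _ h1 H)).
- by rewrite !mulr_ge0// exprn_ge0.
- by rewrite exprn_ge0// addr_ge0// mulr_ge0.
- by rewrite le_eqVlt; apply/orP; left; apply/eqP; ring.
Qed.

(** [Num.truncn] sends negative numbers to 0: for t <= 0 no step is made, and the limit is the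
    initial state. *)
Let idx n (t : R) := Num.truncn (t * 2 ^+ n).

Let tau2 n : 2 ^+ n * tau n = 1.
Proof. by rewrite /tau -exprMn divff ?expr1n. Qed.

Let idx_le n t : 0 <= t -> (idx n t)%:R * tau n <= t.
Proof.
move=> t0; have /andP[H _] := truncn_itv (mulr_ge0 t0 (exprn_ge0 n (ler0n R 2))).
have := ler_wpM2r (tau_ge0 n) H; by rewrite -mulrA tau2 mulr1.
Qed.

Let idx_gt n t : 0 <= t -> t < (idx n t)%:R * tau n + tau n.
Proof.
move=> t0; have /andP[_ H] := truncn_itv (mulr_ge0 t0 (exprn_ge0 n (ler0n R 2))).
move: H; rewrite -(ltr_pM2r (tau_gt0 n)) -mulrA tau2 mulr1 -natr1; lra.
Qed.

Let E_cauchy T t n i : 0 <= t <= T ->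
  `|E n.+1 (idx n.+1 t) i - E n (idx n t) i| <= C T * tau n.
Proof.
move=> /andP[t0 tT]; have T0 := le_trans t0 tT.
set k := idx n t; set k' := idx n.+1 t.
have kT : k%:R * tau n <= T by exact: le_trans (idx_le n t0) tT.
have k'T : k'%:R * tau n.+1 <= T by exact: le_trans (idx_le n.+1 t0) tT.
have H := E_refine_bound i kT.
have kt := idx_le n t0; have tk := idx_gt n t0.
have k't := idx_le n.+1 t0; have tk' := idx_gt n.+1 t0.
rewrite -/k in kt tk; rewrite -/k' tauS in k't tk'.
(* The integer part of 2a is twice that of a, plus a digit [b] equal to 0 or 1. *)
have [b kb] : exists b : nat, k' = (k.*2 + b)%N /\ (b <= 1)%N.
  exists (k' - k.*2)%N; have : (k.*2 < k'.+1)%N.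
    rewrite -(ltr_nat R) -(ltr_pM2r (tau_gt0 n)) -muln2 natrM -natr1; lra.
  have : (k' < k.*2.+2)%N.
    rewrite -(ltr_nat R) -(ltr_pM2r (tau_gt0 n)) -muln2 -addn2 natrD natrM; lra.
  by rewrite ltnS => h1 h2; split; [rewrite subnKC|rewrite leq_subLR addn1].
have [kE b1] := kb.
have := E_incr (k := k.*2) (j := b) i (T := T) (n := n.+1).
rewrite -kE => /(_ k'T) H2.
have H3 : b%:R * tau n.+1 * B T <= tau n * B T.
  rewrite ler_wpM2r// tauS; have : b%:R <= 1 :> R by rewrite (ler_nat _ b 1).
  have := tau_ge0 n; nra.
have := ler_normD (E n.+1 k' i - E n.+1 k.*2 i) (E n.+1 k.*2 i - E n k i).
rewrite addrA subrK /C mulrDl; lra.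
Qed.

Definition euler_limit (t : R) (i : X) : R := lim (E n (idx n t) i @[n --> \oo]).

Let euler_approx T t n i : 0 <= t <= T ->
  `|E n (idx n t) i - euler_limit t i| <= 2 * C T * tau n.
Proof. by move=> tT; apply: cvg_dyadic => {}n; exact: E_cauchy. Qed.

Lemma euler_limit_domain t : 0 <= t -> D t (euler_limit t).
Proof.
move=> t0; apply: (D_lim (u := fun n => E n (idx n t))).
  by move=> n; exact/DET/idx_le.
move=> i; apply: (is_cvg_dyadic (C := 2 * C t)) => n.
by apply: euler_approx; rewrite t0 lexx.
Qed.

Lemma euler_limit_flow T t s i : 0 <= t -> 0 <= s -> t + s <= T ->
  `|euler_limit (t + s) i - euler_limit t i - s * F (euler_limit t) i|
    <= L T * B T * s ^+ 2.
Proof.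
move=> t0 s0 tsT; have T0 : 0 <= T by rewrite (le_trans _ tsT)// addr_ge0.
have tT : 0 <= t <= T by rewrite t0 (le_trans _ tsT)// lerDl.
have tsT' : 0 <= t + s <= T by rewrite addr_ge0.
have C0 : 0 <= C T by rewrite /C addr_ge0// !mulr_ge0// expR_ge0.
(* The coefficient of 2^-n collects the two approximation errors, the rounding of [s] to a multiple
   [sg] of the step, the change of the field and the excess of sg^2 over s^2. *)
apply: (le_dyadic (C := 4 * C T + B T + s * L T * (2 * C T) + L T * B T * (2 * s + 1))) => n.
have a1 := euler_approx n i tsT'; have a2 j := euler_approx n j tT.
set k := idx n t in a2; set k' := idx n (t + s) in a1.
have kT : k%:R * tau n <= T by apply: le_trans (idx_le n t0) _; case/andP: tT.
have k'T : k'%:R * tau n <= T by apply: le_trans (idx_le n _) tsT; rewrite addr_ge0.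
have kk' : (k <= k')%N by apply: le_truncn; rewrite ler_wpM2r ?exprn_ge0// lerDl.
have DT : D T (E n k) by exact: DET.
have Dx : D T (euler_limit t).
  by apply: D_mono (euler_limit_domain t0); case/andP: tT.
have aF := F_lipschitz T0 DT Dx a2 i; have bF := F_bound i T0 DT.
have := E_consistent (k := k) (j := (k' - k)%N) i (T := T) (n := n).
rewrite subnKC// => /(_ k'T); set sg := (k' - k)%:R * tau n => aE.
have sgE : sg = k'%:R * tau n - k%:R * tau n by rewrite /sg natrB// mulrBl.
have h1 := idx_le n t0; have h2 := idx_gt n t0.
have h3 := idx_le n (addr_ge0 t0 s0); have h4 := idx_gt n (addr_ge0 t0 s0).
have sg1 : `|sg - s| <= tau n by rewrite sgE ler_norml; apply/andP; split; lra.
have sg0 : 0 <= sg by rewrite mulr_ge0.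
have sgs : sg <= s + tau n by move: sg1; rewrite ler_norml => /andP[_]; lra.
have sg2 : sg ^+ 2 <= s ^+ 2 + (2 * s + 1) * tau n.
  have : sg ^+ 2 <= (s + tau n) ^+ 2 by rewrite lerXn2r ?nnegrE ?addr_ge0.
  have := tau_le1 n; have := tau_ge0 n; nra.
set x1 := euler_limit (t + s) i in a1 *; set x := euler_limit t i.
set y1 := E n k' i in a1 aE; set y := E n k i in aE.
set fy := F (E n k) i in aF bF aE; set fx := F (euler_limit t) i in aF *.
have -> : x1 - x - s * fx = (x1 - y1) + (y - x) + (y1 - y - sg * fy) +
  (sg - s) * fy + s * (fy - fx) by ring.
have b4 : `|(sg - s) * fy| <= tau n * B T by rewrite normrM ler_pM.
have b5 : `|s * (fy - fx)| <= s * (L T * (2 * C T * tau n)).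
  by rewrite normrM ger0_norm// ler_wpM2l.
have b3 : L T * B T * sg ^+ 2 <= L T * B T * (s ^+ 2 + (2 * s + 1) * tau n).
  by rewrite ler_wpM2l// mulr_ge0.
have a1' : `|x1 - y1| <= 2 * C T * tau n by rewrite distrC.
have a2' : `|y - x| <= 2 * C T * tau n := a2 i.
have n1 := ler_normD (x1 - y1) (y - x).
have n2 := ler_normD (x1 - y1 + (y - x)) (y1 - y - sg * fy).
have n3 := ler_normD (x1 - y1 + (y - x) + (y1 - y - sg * fy)) ((sg - s) * fy).
have n4 := ler_normD (x1 - y1 + (y - x) + (y1 - y - sg * fy) + (sg - s) * fy) (s * (fy - fx)).
rewrite -/(tau n); lra.
Qed.

Lemma euler_limit_neg t : t <= 0 -> euler_limit t = x0.
Proof.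
move=> t0; apply/funext => i; rewrite /euler_limit.
have -> : (fun n => E n (idx n t) i) = fun=> x0 i.
  apply/funext => n; rewrite /idx (_ : Num.truncn _ = 0%N)//.
  by apply/truncn0Pn; rewrite -ltNge (le_lt_trans _ ltr01)// mulr_le0_ge0// exprn_ge0.
exact: lim_cst.
Qed.

(** For negative [s] the forward estimate is started at [t + s]; then [F] at time [t + s] is
    exchanged for [F] at time [t]. The exchange costs s^2 times [L T] times the Lipschitz constant B
    + L B T of the limit in time. *)
Lemma euler_limit_flow2 T : exists C, forall t s i, 0 <= t <= T -> 0 <= t + s <= T ->
  `|euler_limit (t + s) i - euler_limit t i - s * F (euler_limit t) i| <= C * s ^+ 2.
Proof.
exists (L T * B T + L T * (B T + L T * B T * T)) => t s i tT tsT.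
have [t0 tleT] := andP tT; have [ts0 tsleT] := andP tsT.
have T0 : 0 <= T := le_trans t0 tleT.
have s2 := sqr_ge0 s; have [L0 B0] := (L_ge0 T, B_ge0 T).
have K0 : 0 <= B T + L T * B T * T by rewrite addr_ge0// !mulr_ge0.
case: (leP 0 s) => s0.
  rewrite (le_trans (euler_limit_flow i t0 s0 tsleT))// ler_wpM2r// lerDl mulr_ge0//.
have s0' : 0 <= - s by rewrite oppr_ge0 ltW.
have tE : t + s + - s = t by ring.
have H j := @euler_limit_flow T (t + s) (- s) j ts0 s0'.
have {}H j : `|euler_limit t j - euler_limit (t + s) j - - s * F (euler_limit (t + s)) j| <= L T * B T * s ^+ 2.
  by have := H j; rewrite tE sqrrN; apply.
have Dt : D T (euler_limit t) by apply: D_mono (euler_limit_domain t0).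
have Dts : D T (euler_limit (t + s)) by apply: D_mono (euler_limit_domain ts0).
have I j : `|euler_limit t j - euler_limit (t + s) j| <= (B T + L T * B T * T) * - s.
  have h1 := H j; have h2 := F_bound j T0 Dts.
  have h3 : `|- s * F (euler_limit (t + s)) j| <= - s * B T.
    by rewrite normrM (ger0_norm s0') ler_wpM2l.
  have h4 : L T * B T * s ^+ 2 <= L T * B T * (T * - s).
    rewrite ler_wpM2l ?mulr_ge0// -sqrrN expr2 ler_wpM2r//; lra.
  have := ler_normD (euler_limit t j - euler_limit (t + s) j - - s * F (euler_limit (t + s)) j) (- s * F (euler_limit (t + s)) j).
  rewrite subrK; lra.
have FF := F_lipschitz T0 Dt Dts I i.
have -> : euler_limit (t + s) i - euler_limit t i - s * F (euler_limit t) i =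
  - (euler_limit t i - euler_limit (t + s) i - - s * F (euler_limit (t + s)) i) +
  - s * (F (euler_limit t) i - F (euler_limit (t + s)) i) by ring.
move: (H i) FF; set a := _ - _ - _; set b := _ - _ => ha hb.
have : `|- s * b| <= L T * (B T + L T * B T * T) * s ^+ 2.
  rewrite normrM (ger0_norm s0') -sqrrN expr2 mulrA mulrC ler_wpM2r//.
  by rewrite -mulrA.
by have := ler_normD (- a) (- s * b); rewrite normrN; lra.
Qed.

End EulerScheme.

(** * Calculus of primitives and of functions C^{1,1} in time *)

Section Gronwall.
Variable R : realType.

(** Stated without a derivative of [z], since an L^1 distance need not have one. The comparison
    function eta exp ((K + 1) t) grows faster than the rate [K] demands, and the spare rate 1
    absorbs the error term. *)
Lemma gronwall (z : R -> R) (T K : R) : 0 <= K -> z 0 <= 0 ->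
  (forall t, 0 <= t <= T -> 0 <= z t) ->
  (forall t, 0 <= t <= T -> forall e, 0 < e -> exists2 d, 0 < d &
     forall s, `|s| < d -> 0 <= t + s <= T -> `|z (t + s) - z t| <= `|s| * (K * z t + e)) ->
  forall t, 0 <= t <= T -> z t <= 0.
Proof.
move=> K0 z0 z_ge0 zd t tT; apply/ler_addgt0Pr => e0 e0_gt0; rewrite add0r.
(* Chosen so that the comparison function equals [e0] at time [T]. *)
pose eta := e0 / expR ((K + 1) * T).
have eta0 : 0 < eta by rewrite divr_gt0// expR_gt0.
pose phi t := eta * expR ((K + 1) * t).
have phi_ge x y : phi x * (1 + (K + 1) * (y - x)) <= phi y.
  rewrite /phi -mulrA ler_wpM2l ?(ltW eta0)//.
  have -> : (K + 1) * y = (K + 1) * x + (K + 1) * (y - x) by ring.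
  by rewrite expRD ler_wpM2l ?expR_ge0// expR_ge1Dx.
have phi_eta x : 0 <= x -> eta <= phi x.
  move=> x0; rewrite /phi ler_peMr ?(ltW eta0)// -[leLHS]expR0 ler_expR mulr_ge0//; lra.
suff zphi : z t <= phi t.
  rewrite (le_trans zphi)// /phi /eta mulrAC ler_pdivrMr ?expR_gt0//.
  rewrite ler_wpM2l ?(ltW e0_gt0)// ler_expR ler_wpM2l//; first lra.
  by case/andP: tT.
rewrite leNgt; apply/negP => zt.
pose A := [set u : R | 0 <= u <= T /\ phi u < z u].
have A0 : has_inf A by split; [exists t|exists 0 => u [/andP[]]].
set tau := inf A.
have At : tau <= t by apply: ge_inf => //; case: A0.
have tau0 : 0 <= tau by apply: lb_le_inf; [exists t|move=> u [/andP[]]].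
have tauT : 0 <= tau <= T by rewrite tau0 (le_trans At)//; case/andP: tT.
have below u : 0 <= u < tau -> z u <= phi u.
  move=> /andP[u0 ut]; rewrite leNgt; apply/negP => zu.
  have : tau <= u.
    apply: ge_inf; first by case: A0.
    split => //; rewrite u0/= (le_trans (ltW ut))//; case/andP: tauT => _; exact.
  by rewrite leNgt ut.
(* The inequality persists at the infimum: just before it [z] is at most [phi], and a short enough
   last step changes [z] by at most any given [e]. *)
have ztau : z tau <= phi tau.
  have [tau00|taun0] := eqVneq tau 0.
    by rewrite tau00 (le_trans z0)// (le_trans (ltW eta0))// phi_eta.
  have taup : 0 < tau by rewrite lt_neqAle eq_sym taun0.
  apply/ler_addgt0Pr => e e_gt0.
  have [d d0 H] := zd tau tauT 1 ltr01.
  pose c := K * z tau + 1; have c0 : 0 < c by rewrite ltr_wpDl// mulr_ge0// z_ge0.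
  pose s := Num.min (Num.min (d / 2) tau) (e / c).
  have s0 : 0 < s by rewrite !lt_min taup !divr_gt0.
  have sd : s <= d / 2 by rewrite /s !ge_min lexx.
  have st : s <= tau by rewrite /s !ge_min lexx orbT.
  have se : s <= e / c by rewrite /s !ge_min lexx !orbT.
  have sd' : s < d by lra.
  have st' : 0 <= tau - s <= T by apply/andP; split; [lra|move: tauT => /andP[_]; lra].
  have := H (- s); rewrite normrN gtr0_norm// => /(_ sd' st').
  rewrite -/c => Hs; have := below (tau - s).
  have -> : 0 <= tau - s < tau by apply/andP; split; lra.
  move=> /(_ isT) Hb.
  have sc : s * c <= e by rewrite -ler_pdivlMr.
  have : phi (tau - s) <= phi tau.
    by rewrite /phi ler_wpM2l ?(ltW eta0)// ler_expR ler_wpM2l//; lra.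
  by have := ler_norm (z tau - z (tau - s)); rewrite distrC; lra.
(* Just after [tau] the hypothesis with error [eta] keeps [z] below the tangent of [phi] at [tau],
   whereas points of [A] come arbitrarily near. *)
have [d d0 H] := zd tau tauT eta eta0.
have [u [/andP[u0 uT] zu] ud] := inf_adherent d0 A0.
have tu : tau <= u by apply: ge_inf; [case: A0|split => //; rewrite u0].
have [tue|tnu] := eqVneq tau u; first by move: zu; rewrite -tue ltNge ztau.
have tultu : tau < u by rewrite lt_neqAle tnu.
have := H (u - tau); rewrite gtr0_norm ?subr_gt0// (_ : tau + (u - tau) = u); last ring.
rewrite ltrBlDl u0 uT => /(_ ud isT) Hu.
have ph := phi_ge tau u; have pe := phi_eta tau tau0.
have us : 0 <= u - tau by rewrite subr_ge0.
have zle : z u - z tau <= (u - tau) * (K * z tau + eta) by rewrite (le_trans _ Hu)// ler_norm.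
have : (u - tau) * (K * z tau + eta) <= (u - tau) * (K * phi tau + phi tau).
  by rewrite ler_wpM2l// lerD// ler_wpM2l.
lra.
Qed.

(** The derivative of [G] vanishes: this is Gronwall's inequality with rate 0 for the distance to
    [G x]. *)
Lemma quadratic_increment_const (G : R -> R) C :
  (forall x y, x <= y -> `|G y - G x| <= C * (y - x) ^+ 2) -> forall x y, G x = G y.
Proof.
move=> GC; have C0 : 0 <= C.
  by have := GC 0 1 ler01; rewrite subr0 expr1n mulr1; exact: le_trans.
have H x y : x <= y -> G x = G y.
  move=> xy; apply/eqP; rewrite eq_sym -subr_eq0 -normr_eq0 eq_le normr_ge0 andbT.
  have := @gronwall (fun t => `|G (x + t) - G x|) (y - x) 0 (lexx 0).
  rewrite addr0 subrr normr0 => /(_ (lexx 0)) /(_ _ _ (y - x)).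
  rewrite (_ : x + (y - x) = y); last ring.
  apply=> //; last by rewrite subr_ge0 xy lexx.
  move=> t _ e e0; exists (e / (C + 1)); first by rewrite divr_gt0// ltr_wpDl.
  move=> s; rewrite ltr_pdivlMr ?ltr_wpDl// => se _.
  rewrite mul0r add0r (le_trans (ler_dist_dist _ _))//.
  have -> : G (x + (t + s)) - G x - (G (x + t) - G x) = G (x + (t + s)) - G (x + t) by ring.
  have : `|G (x + (t + s)) - G (x + t)| <= C * s ^+ 2.
    case: (leP 0 s) => s0.
      have := GC (x + t) (x + (t + s)); rewrite lerD2l lerDl => /(_ s0).
      by rewrite (_ : x + (t + s) - (x + t) = s)//; ring.
    have := GC (x + (t + s)) (x + t); rewrite lerD2l gerDl => /(_ (ltW s0)).
    by rewrite distrC (_ : x + t - (x + (t + s)) = - s) ?sqrrN//; ring.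
  move=> /le_trans; apply; rewrite -real_normK ?num_real// expr2 mulrCA ler_wpM2l//.
  by have := normr_ge0 s; lra.
by move=> x y; case: (leP x y) => [/H//|/ltW/H].
Qed.

End Gronwall.

Section Primitives.
Variable R : realType.
Implicit Types (f g : R -> R).

Definition primitive f f' :=
  [/\ bmeas f, bmeas f' & forall x y, ointg x y f' = f y - f x].

Lemma primitiveD f g f' g' : primitive f f' -> primitive g g' ->
  primitive (fun x => f x + g x) (fun x => f' x + g' x).
Proof.
move=> [bf bf' fE] [bg bg' gE]; split; [exact: bmeasD..|].
by move=> x y; rewrite ointgD; [|exact: bmeas_locint..]; rewrite fE gE; ring.
Qed.

Lemma primitiveZ c f f' : primitive f f' -> primitive (fun x => c * f x) (fun x => c * f' x).
Proof.
move=> [bf bf' fE]; split; [exact: bmeasZ..|].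
by move=> x y; rewrite ointgZ; [|exact: bmeas_locint]; rewrite fE; ring.
Qed.

(* The increments of [f g - \int (f g' + f' g)] are quadratic. *)
Lemma primitiveM f g f' g' : primitive f f' -> primitive g g' ->
  primitive (fun x => f x * g x) (fun x => f x * g' x + f' x * g x).
Proof.
move=> [bf bf' fE] [bg bg' gE].
have bfg : bmeas (fun x => f x * g' x + f' x * g x) by apply: bmeasD; exact: bmeasM.
split => //; first exact: bmeasM.
have lfg := bmeas_locint bfg.
pose H x := f x * g x - ointg 0 x (fun x => f x * g' x + f' x * g x).
have [_ [M fM]] := bf'; have [_ [N gN]] := bg'.
have lf' := bmeas_locint bf'; have lg' := bmeas_locint bg'.
have HC x y : x <= y -> `|H y - H x| <= (2 * M * N) * (y - x) ^+ 2.
  move=> xy.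
  (* With [f] frozen at [y] and [g] at [x], the integrals of [g'] and [f'] produce exactly f y g y -
     f x g x. What is left has first order factors, so its integral is quadratic. *)
  have -> : H y - H x = ointg x y (fun z => (f y - f z) * g' z + (g x - g z) * f' z).
    have -> : (fun z => (f y - f z) * g' z + (g x - g z) * f' z) =
       (fun z => (f y * g' z + g x * f' z) - (f z * g' z + f' z * g z)).
      by apply/funext => z; ring.
    rewrite ointgB//; last by apply: locintD; exact: locintZ.
    rewrite ointgD; [|exact: locintZ..].
    by rewrite !ointgZ// fE gE /H -(ointg_cat 0 x y lfg); ring.
  have -> : 2 * M * N * (y - x) ^+ 2 = (2 * M * N * (y - x)) * (y - x) by ring.
  apply: ointg_bound => //.
    apply: bmeas_locint; apply: bmeasD; apply: bmeasM => //; apply: bmeasB => //; exact: bmeas_cst.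
  move=> z /andP[xz zy].
  have b1 : `|f y - f z| <= M * (y - x).
    rewrite -fE (le_trans (ointg_bound lf' zy (fun z _ => fM z)))//.
    by apply: ler_wpM2l; [exact: le_trans (fM 0)|lra].
  have b2 : `|g x - g z| <= N * (y - x).
    rewrite distrC -gE (le_trans (ointg_bound lg' xz (fun z _ => gN z)))//.
    by apply: ler_wpM2l; [exact: le_trans (gN 0)|lra].
  have n1 : `|(f y - f z) * g' z| <= M * (y - x) * N by rewrite normrM ler_pM.
  have n2 : `|(g x - g z) * f' z| <= N * (y - x) * M by rewrite normrM ler_pM.
  by rewrite (le_trans (ler_normD _ _))//; lra.
have Hc := quadratic_increment_const HC.
move=> x y; have := Hc x y; rewrite /H -(ointg_cat 0 x y lfg); lra.
Qed.

End Primitives.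

(** * Time derivatives with a uniform quadratic remainder *)

Section TimeCalculus.
Variable R : realType.
Variable T : R.
Implicit Types f g : R -> R -> R.

(* [f' t x] is the time derivative of [f t x], with a quadratic remainder that is
   uniform in [t \in [0, T]] and [x \in [0, 1]]. *)
Definition C11 f f' := exists M C : R,
  (forall t x, 0 <= t <= T -> 0 <= x <= 1 -> `|f t x| <= M /\ `|f' t x| <= M) /\
  (forall t s x, 0 <= t <= T -> 0 <= t + s <= T -> 0 <= x <= 1 ->
     `|f (t + s) x - f t x - s * f' t x| <= C * s ^+ 2).

Lemma eq_C11 f f' g' : (forall t x, 0 <= t <= T -> 0 <= x <= 1 -> f' t x = g' t x) ->
  C11 f f' -> C11 f g'.
Proof.
move=> fg [M [C [fM fC]]]; exists M, C; split.
  by move=> t x tT x01; rewrite -fg//; exact: fM.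
by move=> t s x tT tsT x01; rewrite -fg//; exact: fC.
Qed.

Lemma C11_cst (c : R) : C11 (fun _ _ => c) (fun _ _ => 0).
Proof.
exists `|c|, 0; split; first by move=> *; rewrite normr0.
by move=> *; rewrite subrr mulr0 subrr normr0 mul0r.
Qed.

Lemma C11D f f' g g' : C11 f f' -> C11 g g' ->
  C11 (fun t x => f t x + g t x) (fun t x => f' t x + g' t x).
Proof.
move=> [M [C [fM fC]]] [N [D [gN gD]]]; exists (M + N), (C + D); split.
  move=> t x tT x01; have [? ?] := fM _ _ tT x01; have [? ?] := gN _ _ tT x01.
  by split; rewrite (le_trans (ler_normD _ _))// lerD.
move=> t s x tT tsT x01.
have -> : f (t + s) x + g (t + s) x - (f t x + g t x) - s * (f' t x + g' t x) =
  (f (t + s) x - f t x - s * f' t x) + (g (t + s) x - g t x - s * g' t x) by ring.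
by rewrite (le_trans (ler_normD _ _))// mulrDl lerD// ?fC ?gD.
Qed.

Lemma C11_incr f f' : C11 f f' -> exists2 N, 0 <= N &
  forall t s x, 0 <= t <= T -> 0 <= t + s <= T -> 0 <= x <= 1 ->
   `|f (t + s) x - f t x| <= N * `|s|.
Proof.
move=> [M [C [fM fC]]]; exists (`|M| + `|C| * `|T|); first by rewrite addr_ge0// mulr_ge0.
move=> t s x tT tsT x01; have [_ f'M] := fM _ _ tT x01.
have := fC _ _ _ tT tsT x01.
have sT : `|s| <= `|T|.
  have T0 : 0 <= T by move/andP: tT => [? ?]; lra.
  rewrite (ger0_norm T0) ler_norml; move/andP: tT => [? ?]; move/andP: tsT => [? ?].
  by apply/andP; split; lra.
have := ler_normD (f (t + s) x - f t x - s * f' t x) (s * f' t x).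
rewrite subrK normrM.
have h1 : `|s| * `|f' t x| <= `|s| * `|M| by rewrite ler_wpM2l// (le_trans f'M)// ler_norm.
have h2 : C * s ^+ 2 <= `|C| * `|T| * `|s|.
  rewrite -(real_normK (num_real s)) expr2 mulrA ler_wpM2r//.
  have a1 : C * `|s| <= `|C| * `|s| by rewrite ler_wpM2r// ler_norm.
  by rewrite (le_trans a1)// ler_wpM2l.
lra.
Qed.

Lemma C11M f f' g g' : C11 f f' -> C11 g g' ->
  C11 (fun t x => f t x * g t x) (fun t x => f' t x * g t x + f t x * g' t x).
Proof.
move=> Hf Hg; have [N N0 gN'] := C11_incr Hg.
move: Hf Hg => [M [C [fM fC]]] [P [D [gN gD]]].
exists (2 * (`|M| * `|P|)), (`|C| * `|P| + `|M| * N + `|M| * `|D|); split.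
  move=> t x tT x01; have [f1 f2] := fM _ _ tT x01; have [g1 g2] := gN _ _ tT x01.
  have A (a b : R) : `|a| <= M -> `|b| <= P -> `|a * b| <= `|M| * `|P|.
    by move=> ha hb; rewrite normrM ler_pM// (le_trans _ (ler_norm _)).
  have MP : 0 <= `|M| * `|P| by rewrite mulr_ge0.
  split; first by have := A _ _ f1 g1; lra.
  have := A _ _ f2 g1; have := A _ _ f1 g2.
  have := ler_normD (f' t x * g t x) (f t x * g' t x); lra.
move=> t s x tT tsT x01.
have [f1 f2] := fM _ _ tT x01; have [g1 _] := gN _ _ tsT x01.
have hf := fC _ _ _ tT tsT x01; have hg := gD _ _ _ tT tsT x01.
have hi := gN' _ _ _ tT tsT x01.
(* The middle term is quadratic because [g] is Lipschitz in time; the outer ones are the remainders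
   of [f] and [g]. *)
have -> : f (t + s) x * g (t + s) x - f t x * g t x - s * (f' t x * g t x + f t x * g' t x)
 = (f (t + s) x - f t x - s * f' t x) * g (t + s) x
   + (s * f' t x) * (g (t + s) x - g t x)
   + f t x * (g (t + s) x - g t x - s * g' t x) by ring.
have s2 : 0 <= s ^+ 2 by exact: sqr_ge0.
have up (a b : R) : `|a| <= b -> `|a| <= `|b| by move=> /le_trans; apply; exact: ler_norm.
have b1 : `|(f (t + s) x - f t x - s * f' t x) * g (t + s) x| <= `|C| * s ^+ 2 * `|P|.
  rewrite normrM ler_pM//; last exact: up.
  by rewrite (le_trans hf)// ler_wpM2r// ler_norm.
have b2 : `|(s * f' t x) * (g (t + s) x - g t x)| <= `|M| * N * s ^+ 2.
  rewrite 2!normrM -(real_normK (num_real s)).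
  have -> : `|M| * N * `|s| ^+ 2 = (`|s| * `|M|) * (N * `|s|) by ring.
  by rewrite ler_pM// ler_wpM2l//; exact: up.
have b3 : `|f t x * (g (t + s) x - g t x - s * g' t x)| <= `|M| * (`|D| * s ^+ 2).
  rewrite normrM ler_pM//; first exact: up.
  by rewrite (le_trans hg)// ler_wpM2r// ler_norm.
have n1 := ler_normD ((f (t + s) x - f t x - s * f' t x) * g (t + s) x) ((s * f' t x) * (g (t + s) x - g t x)).
have n2 := ler_normD ((f (t + s) x - f t x - s * f' t x) * g (t + s) x + (s * f' t x) * (g (t + s) x - g t x)) (f t x * (g (t + s) x - g t x - s * g' t x)).
lra.
Qed.

Lemma C11Z c f f' : C11 f f' -> C11 (fun t x => c * f t x) (fun t x => c * f' t x).
Proof.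
move=> Hf; apply: eq_C11 (C11M (C11_cst c) Hf) => t x _ _; ring.
Qed.

Lemma C11B f f' g g' : C11 f f' -> C11 g g' ->
  C11 (fun t x => f t x - g t x) (fun t x => f' t x - g' t x).
Proof.
move=> Hf Hg; have := C11D Hf (C11Z (-1) Hg).
have -> : (fun t x => f t x + -1 * g t x) = (fun t x => f t x - g t x).
  by apply/funext => t; apply/funext => x; ring.
by apply: eq_C11 => t x _ _; ring.
Qed.

Lemma C11_ointg f f' : (forall t, bmeas (f t)) -> (forall t, bmeas (f' t)) ->
  C11 f f' -> C11 (fun t x => ointg 0 x (f t)) (fun t x => ointg 0 x (f' t)).
Proof.
move=> bf bf' [M [C [fM fC]]]; exists `|M|, `|C|; split.
  move=> t x tT /andP[x0 x1].
  have H (u : R -> R) : bmeas u -> (forall y, 0 <= y <= 1 -> `|u y| <= M) ->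
      `|ointg 0 x u| <= `|M|.
    move=> bu uM; rewrite (le_trans (ointg_bound (M := `|M|) (bmeas_locint bu) x0 _))//.
      move=> y /andP[y0 yx]; rewrite (le_trans (uM y _)) ?ler_norm// y0 (le_trans yx)//.
    by rewrite subr0 ler_piMr.
  by split; apply: H => // y y01; have [] := fM _ _ tT y01.
move=> t s x tT tsT /andP[x0 x1].
have l1 := bmeas_locint (bf (t + s)); have l2 := bmeas_locint (bf t).
have l3 := bmeas_locint (bf' t).
have -> : ointg 0 x (f (t + s)) - ointg 0 x (f t) - s * ointg 0 x (f' t) =
   ointg 0 x (fun y => f (t + s) y - f t y - s * f' t y).
  by rewrite ointgB ?ointgB ?ointgZ//; [exact: locintB|exact: locintZ].
rewrite (le_trans (ointg_bound (M := `|C| * s ^+ 2) _ x0 _))//.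
- by apply: locintB; [exact: locintB|exact: locintZ].
- move=> y /andP[y0 yx]; rewrite (le_trans (fC _ _ _ tT tsT _))//.
    by rewrite y0 (le_trans yx).
  by rewrite ler_wpM2r ?sqr_ge0// ler_norm.
- by rewrite subr0 ler_piMr// mulr_ge0// sqr_ge0.
Qed.

Lemma C11_at f f' y : 0 <= y <= 1 -> C11 f f' -> C11 (fun t _ => f t y) (fun t _ => f' t y).
Proof.
move=> y01 [M [C [fM fC]]]; exists M, C; split.
  by move=> t _ tT _; exact: fM.
by move=> t s _ tT tsT _; exact: fC.
Qed.

Lemma C11_int01 f f' : (forall t, bmeas (f t)) -> (forall t, bmeas (f' t)) ->
  C11 f f' -> C11 (fun t _ => int01 (f t)) (fun t _ => int01 (f' t)).
Proof.
move=> bf bf' Hf; have := C11_at (y := 1) _ (C11_ointg bf bf' Hf).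
rewrite ler01 lexx => /(_ isT).
have -> : (fun t (_ : R) => ointg 0 1 (f t)) = (fun t _ => int01 (f t)).
  by apply/funext => t; apply/funext => _; rewrite int01E.
by apply: eq_C11 => t x _ _; rewrite int01E.
Qed.

Lemma C11_gronwall f f' K x : 0 <= K -> 0 <= x <= 1 -> C11 f f' ->
  (forall t, 0 <= t <= T -> 0 <= f t x) -> (forall t, 0 <= t <= T -> `|f' t x| <= K * f t x) ->
  f 0 x = 0 -> forall t, 0 <= t <= T -> f t x = 0.
Proof.
move=> K0 x01 [M [C [fM fC]]] f0 f'K f00 t tT.
apply/eqP; rewrite eq_le f0// andbT.
apply: (gronwall (z := fun t => f t x) (T := T) K0) => //; first by rewrite f00.
move=> {}t {}tT e e0; exists (e / (`|C| + 1)); first by rewrite divr_gt0// ltr_wpDl.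
move=> s; rewrite ltr_pdivlMr ?ltr_wpDl// => se tsT.
have := fC _ _ _ tT tsT x01.
have := ler_normD (f (t + s) x - f t x - s * f' t x) (s * f' t x).
rewrite subrK normrM.
have h1 : `|s| * `|f' t x| <= `|s| * (K * f t x) by rewrite ler_wpM2l// f'K.
have h2 : C * s ^+ 2 <= `|s| * e.
  rewrite -(real_normK (num_real s)) expr2 mulrCA ler_wpM2l//.
  have : C * `|s| <= `|C| * `|s| by rewrite ler_wpM2r// ler_norm.
  by have := normr_ge0 s; lra.
lra.
Qed.

(** Local C^{1,1} regularity; the constants depend on the ball because [expR] is not globally
    Lipschitz. The bounds [N] are included since [C11] records bounds of a function and of its
    derivative. *)
Definition taylor1 (phi phi' : R -> R) := forall M : R, exists K N : R, 0 <= K /\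
  forall x y : R, `|x| <= M -> `|y| <= M ->
   [/\ `|phi y - phi x - (y - x) * phi' x| <= K * (y - x) ^+ 2, `|phi x| <= N & `|phi' x| <= N].

Lemma C11_comp phi phi' f f' : taylor1 phi phi' -> C11 f f' ->
  C11 (fun t x => phi (f t x)) (fun t x => phi' (f t x) * f' t x).
Proof.
move=> tp Hf; have [P P0 fP] := C11_incr Hf.
have [M [C [fM fC]]] := Hf.
have [K [N [K0 KN]]] := tp M.
exists (`|N| + `|N| * `|M|), (K * P ^+ 2 + `|N| * `|C|); split.
  move=> t x tT x01; have [f1 f2] := fM _ _ tT x01.
  have [_ p1 p2] := KN _ _ f1 f1; split.
    by rewrite (le_trans p1)// (le_trans (ler_norm _))// lerDl mulr_ge0.
  rewrite normrM (le_trans (ler_pM _ _ (le_trans p2 (ler_norm _)) (le_trans f2 (ler_norm _))))//.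
  by rewrite lerDr.
move=> t s x tT tsT x01.
have [f1 f2] := fM _ _ tT x01; have [g1 _] := fM _ _ tsT x01.
have [p1 _ p2] := KN _ _ f1 g1.
have h1 := fP _ _ _ tT tsT x01; have h2 := fC _ _ _ tT tsT x01.
have -> : phi (f (t + s) x) - phi (f t x) - s * (phi' (f t x) * f' t x) =
  (phi (f (t + s) x) - phi (f t x) - (f (t + s) x - f t x) * phi' (f t x)) +
  phi' (f t x) * (f (t + s) x - f t x - s * f' t x) by ring.
set u := phi (f (t + s) x) - _ - _ in p1 *.
set v := phi' (f t x) * _.
have b1 : `|u| <= K * P ^+ 2 * s ^+ 2.
  rewrite (le_trans p1)// -mulrA ler_wpM2l// -exprMn -real_normK ?num_real//.
  by rewrite -[leRHS]real_normK ?num_real// normrM (ger0_norm P0) lerXn2r ?nnegrE ?mulr_ge0.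
have b2 : `|v| <= `|N| * (`|C| * s ^+ 2).
  rewrite normrM ler_pM ?(le_trans p2)// ?ler_norm//.
  by rewrite (le_trans h2)// ler_wpM2r ?sqr_ge0// ler_norm.
by have := ler_normD u v; lra.
Qed.

End TimeCalculus.

(** * Taylor estimates for sine, cosine and exponential *)

Section Taylor.
Variable R : realType.

(** The end points come in either order, and the intermediate point stays in every ball around 0
    that contains both, as local Lipschitz bounds require. *)
Lemma mvt_incr (phi phi' : R -> R) (a b : R) : (forall x : R, is_derive x 1 phi (phi' x)) ->
  exists2 c, `|c - a| <= `|b - a| /\ (`|c| <= Num.max `|a| `|b|) & phi b - phi a = phi' c * (b - a).
Proof.
move=> dphi.
have H x y : x < y -> exists2 c, x < c < y & phi y - phi x = phi' c * (y - x).
  move=> xy; have [|c] := @MVT _ phi phi' x y xy (fun z _ => dphi z).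
    apply: continuous_subspaceT => z; apply: differentiable_continuous.
    by apply/derivable1_diffP; have [] := dphi z.
  by rewrite in_itv/= => xcy E; exists c.
have N (x y c : R) : x <= c -> c <= y -> `|c| <= Num.max `|x| `|y|.
  move=> xc cy; rewrite le_max; case: (leP 0 c) => c0.
    by apply/orP; right; rewrite ger0_norm// (le_trans cy)// ler_norm.
  by apply/orP; left; rewrite ltr0_norm// -normrN (le_trans _ (ler_norm _))// lerN2.
have [ab|ba|->] := ltgtP a b.
- have [c /andP[ac cb] E] := H _ _ ab; exists c => //; split; last by apply: N; exact: ltW.
  by rewrite !gtr0_norm ?subr_gt0// lerD2r ltW.
- have [c /andP[ac cb] E] := H _ _ ba; exists c.
    split; last by rewrite maxC; apply: N; exact: ltW.
    by rewrite !ltr0_norm ?subr_lt0// lerN2 lerD2r ltW.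
  by rewrite -opprB E; ring.
- by exists b; [rewrite le_max lexx|rewrite !subrr mulr0].
Qed.

Lemma taylor1_derive (phi phi' : R -> R) (L N : R -> R) :
  (forall x : R, is_derive x 1 phi (phi' x)) -> (forall M : R, 0 <= L M) ->
  (forall M x y : R, `|x| <= M -> `|y| <= M -> `|phi' y - phi' x| <= L M * `|y - x|) ->
  (forall M x : R, `|x| <= M -> `|phi x| <= N M /\ `|phi' x| <= N M) ->
  taylor1 phi phi'.
Proof.
move=> dphi L0 lphi bphi M; exists (L M), (N M); split => // x y xM yM.
have [? ?] := bphi _ _ xM; split => //.
have [c [c1 c2] ->] := mvt_incr x y dphi.
have cM : `|c| <= M by rewrite (le_trans c2)// ge_max xM.
have -> : phi' c * (y - x) - (y - x) * phi' x = (phi' c - phi' x) * (y - x) by ring.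
rewrite normrM -(real_normK (num_real (y - x))) expr2 mulrA ler_wpM2r//.
by rewrite (le_trans (lphi _ _ _ xM cM))// ler_wpM2l.
Qed.

Lemma sin_lipschitz (x y : R) : `|sin y - sin x| <= `|y - x|.
Proof.
have [c _ ->] := mvt_incr x y (fun x => is_derive_sin x).
by rewrite normrM ler_piMl// cos_max.
Qed.

Lemma cos_lipschitz (x y : R) : `|cos y - cos x| <= `|y - x|.
Proof.
have [c _ ->] := mvt_incr x y (fun x => is_derive_cos x).
by rewrite normrM normrN ler_piMl// sin_max.
Qed.

Lemma expR_lipschitz (M x y : R) : `|x| <= M -> `|y| <= M ->
  `|expR y - expR x| <= expR M * `|y - x|.
Proof.
move=> xM yM; have [c [_ cM] ->] := mvt_incr x y (fun x => is_derive_expR x).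
rewrite normrM ler_wpM2r// ger0_norm ?expR_ge0// ler_expR.
by rewrite (le_trans (ler_norm _))// (le_trans cM)// ge_max xM.
Qed.

Lemma taylor1_sin : taylor1 sin (@cos R).
Proof.
apply: (taylor1_derive (L := fun=> 1) (N := fun=> 1)) => //.
- by move=> M x y _ _; rewrite mul1r; exact: cos_lipschitz.
- by move=> M x _; rewrite sin_max cos_max.
Qed.

Lemma taylor1_cos : taylor1 cos (fun x : R => - sin x).
Proof.
apply: (taylor1_derive (L := fun=> 1) (N := fun=> 1)) => //.
- by move=> M x y _ _; rewrite mul1r -opprD normrN; exact: sin_lipschitz.
- by move=> M x _; rewrite normrN sin_max cos_max.
Qed.

Lemma taylor1_expR : taylor1 expR (@expR R).
Proof.
apply: (taylor1_derive (L := expR) (N := expR)) => //.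
- exact: expR_lipschitz.
- move=> M x xM; rewrite ger0_norm ?expR_ge0// ler_expR.
  by rewrite (le_trans (ler_norm _)).
Qed.

End Taylor.

(* A solution all of whose components are everywhere defined, bounded and C^{1,1} in
   time uniformly in space; [Y] and [B] are the space derivatives of [gam + id] and [U],
   and [DU], [DB] the time derivatives of [U] and [B]. *)
Record regular_solution (R : realType) (h p : R) (gam U V W Q Y B DU DB : R -> R -> R) : Prop := RegularSolution {
  rs_gam_primitive : forall t, 0 <= t -> primitive (gam t) (fun x => Y t x - 1);
  rs_U_primitive : forall t, 0 <= t -> primitive (U t) (B t);
  rs_DU_primitive : forall t, 0 <= t -> primitive (DU t) (DB t);
  rs_gam_periodic : forall t, 0 <= t -> periodic1 (gam t);
  rs_U_periodic : forall t, periodic1 (U t);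
  rs_DU_periodic : forall t, 0 <= t -> periodic1 (DU t);
  rs_Y_periodic : forall t, periodic1 (Y t);
  rs_B_periodic : forall t, periodic1 (B t);
  rs_DB_periodic : forall t, periodic1 (DB t);
  rs_V : forall t, bmeas (V t) /\ periodic1 (V t);
  rs_W : forall t, bmeas (W t) /\ periodic1 (W t);
  rs_Q : forall t, bmeas (Q t) /\ periodic1 (Q t);
  rs_gam_C11 : forall T, C11 T gam (fun t x => - U t x ^+ 2);
  rs_Y_C11 : forall T, C11 T Y (fun t x => - 2 * U t x * B t x);
  rs_U_C11 : forall T, C11 T U DU;
  rs_B_C11 : forall T, C11 T B DB;
  rs_V_C11 : forall T, C11 T V (fun t x => - 2 * U t x * W t x + 2 * W t x * V t x * p);
  rs_W_C11 : forall T, C11 T W (fun t x => 2 * U t x * V t x - U t x - 2 * V t x ^+ 2 * p + V t x * p);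
  rs_Q_C11 : forall T, C11 T Q (fun t x => - 2 * W t x * Q t x * p);
  rs_P : forall t, 0 <= t -> Pone (U t) (V t) (Q t) = p;
  rs_rhsU : forall t x0 x, 0 <= t -> rhsU h (gam t) (U t) (V t) (Q t) x0 x = DU t x
}.

(** * The vector field *)

Section VectorField.
Variables (R : realType) (h p : R).
Implicit Types f r : R -> R.

Lemma measurable_comp_continuous (phi : R -> R) f : continuous phi ->
  measurable_fun setT f -> measurable_fun setT (fun x => phi (f x)).
Proof. by move=> cphi mf; apply: measurableT_comp => //; exact: continuous_measurable_fun. Qed.

Lemma periodic1_bound f e : periodic1 f -> (forall x, 0 <= x <= 1 -> `|f x| <= e) ->
  forall x, `|f x| <= e.
Proof. by move=> pf H x; have [z z01 ->] := periodic1_reduce x pf; exact: H. Qed.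

(* In the variables [f = 2 arctan u_x] and [r = ln Q], the paper's [2QV - Q] and [QW]
   are [densA] and [densB]; [velocity] is the function with derivative [densB]
   (up to its mean) whose integral against [densA] is [p]. *)
Definition densA f r x := expR (r x) * cos (f x).
Definition densB f r x := expR (r x) * sin (f x) / 2.
Definition meanB f r := int01 (densB f r).
Definition primB f r x := ointg 0 x (densB f r) - x * meanB f r.
Definition momentAB f r := int01 (fun x => densA f r x * primB f r x).
Definition velocity f r x := primB f r x + (p - momentAB f r) / (1 - h).

(** Only [r] is bounded: [f] enters the field through its sine and cosine alone. *)
Definition admissible (q : R) f r :=
  [/\ periodic1 f, measurable_fun setT f, periodic1 r, measurable_fun setT r &
      forall x, `|r x| <= q].

Section Bounds.
Variables (q : R) (f r : R -> R).
Hypothesis ok : admissible q f r.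

Lemma expR_bound x : expR (r x) <= expR q.
Proof. by case: ok => _ _ _ _ rq; rewrite ler_expR (le_trans (ler_norm _)). Qed.

Lemma bmeas_expR : bmeas (fun x => expR (r x)).
Proof.
split; first by case: ok => _ _ _ mr _; apply: measurable_comp_continuous => //; exact: continuous_expR.
by exists (expR q) => x; rewrite ger0_norm ?expR_ge0// expR_bound.
Qed.

Lemma bmeas_cos : bmeas (fun x => cos (f x)).
Proof.
split; first by case: ok => _ mf _ _ _; apply: measurable_comp_continuous => //; exact: continuous_cos.
by exists 1 => x; exact: cos_max.
Qed.

Lemma bmeas_sin : bmeas (fun x => sin (f x)).
Proof.
split; first by case: ok => _ mf _ _ _; apply: measurable_comp_continuous => //; exact: continuous_sin.
by exists 1 => x; exact: sin_max.
Qed.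

Lemma bmeas_densA : bmeas (densA f r).
Proof. exact: bmeasM bmeas_expR bmeas_cos. Qed.

Lemma bmeas_densB : bmeas (densB f r).
Proof. by apply: bmeasM; [exact: bmeasM bmeas_expR bmeas_sin|exact: bmeas_cst]. Qed.

Lemma periodic_densA : periodic1 (densA f r).
Proof. by case: ok => pf _ pr _ _ x; rewrite /densA pf pr. Qed.

Lemma periodic_densB : periodic1 (densB f r).
Proof. by case: ok => pf _ pr _ _ x; rewrite /densB pf pr. Qed.

Lemma densA_bound x : `|densA f r x| <= expR q.
Proof.
rewrite normrM ger0_norm ?expR_ge0//.
by rewrite (le_trans _ (expR_bound x))// ler_piMr ?expR_ge0// cos_max.
Qed.

Lemma densB_bound x : `|densB f r x| <= expR q.
Proof.
rewrite /densB -mulrA normrM ger0_norm ?expR_ge0//.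
rewrite (le_trans _ (expR_bound x))// ler_piMr ?expR_ge0//.
by rewrite normrM (ger0_norm (_ : 0 <= 2^-1))// ?invr_ge0//; have := sin_max (f x); lra.
Qed.

Lemma meanB_bound : `|meanB f r| <= expR q.
Proof.
rewrite /meanB int01E (le_trans (ointg_bound _ ler01 (fun x _ => densB_bound x)))//; last lra.
exact/bmeas_locint/bmeas_densB.
Qed.

Lemma periodic_primB : periodic1 (primB f r).
Proof. exact: periodic1_ointg periodic_densB (bmeas_locint bmeas_densB). Qed.

Lemma primB_bound x : `|primB f r x| <= 2 * expR q.
Proof.
apply: (periodic1_bound periodic_primB) => {}x /andP[x0 x1].
have lB := bmeas_locint bmeas_densB.
have h1 := ointg_bound lB x0 (fun x _ => densB_bound x).
have h2 : `|x * meanB f r| <= expR q.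
  rewrite normrM ger0_norm// -[leRHS]mul1r ler_pM//; exact: meanB_bound.
have h3 := ler_normB (ointg 0 x (densB f r)) (x * meanB f r).
have : expR q * (x - 0) <= expR q by rewrite subr0 ler_piMr ?expR_ge0.
by rewrite /primB; lra.
Qed.

Lemma bmeas_primB : bmeas (primB f r).
Proof.
split; last by exists (2 * expR q); exact: primB_bound.
apply: measurable_funB; first exact: (measurable_ointg 0 bmeas_densB).
by apply: measurable_funM.
Qed.

Lemma momentAB_bound : `|momentAB f r| <= 2 * expR q ^+ 2.
Proof.
rewrite /momentAB int01E.
have bAB := bmeas_locint (bmeasM bmeas_densA bmeas_primB).
rewrite (le_trans (ointg_bound (M := 2 * expR q ^+ 2) bAB ler01 _))//; last lra.
move=> x _; rewrite normrM (_ : 2 * expR q ^+ 2 = expR q * (2 * expR q)); last ring.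
by rewrite ler_pM// ?densA_bound// primB_bound.
Qed.

Definition velocity_bound := 2 * expR q + (`|p| + 2 * expR q ^+ 2) * `|(1 - h)^-1|.

Lemma velocity_le x : `|velocity f r x| <= velocity_bound.
Proof.
rewrite /velocity /velocity_bound (le_trans (ler_normD _ _))// lerD ?primB_bound//.
rewrite normrM ler_wpM2r// (le_trans (ler_normB _ _))// lerD2l; exact: momentAB_bound.
Qed.

Lemma bmeas_velocity : bmeas (velocity f r).
Proof. by apply: bmeasD; [exact: bmeas_primB|exact: bmeas_cst]. Qed.

Lemma periodic_velocity : periodic1 (velocity f r).
Proof. by move=> x; rewrite /velocity periodic_primB. Qed.

Lemma velocity_bound_ge0 : 0 <= velocity_bound.
Proof. exact: le_trans (velocity_le 0). Qed.

End Bounds.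

(** The first summand accounts for [primB], the second, with room to spare, for [momentAB]. *)
Definition velocity_lip q := 4 * expR q + 12 * expR q ^+ 2 * `|(1 - h)^-1|.

Lemma velocity_lip_ge0 q : 0 <= velocity_lip q.
Proof.
by rewrite /velocity_lip addr_ge0 ?mulr_ge0 ?exprn_ge0 ?expR_ge0.
Qed.

Section Lipschitz.
Variables (q e : R) (f1 r1 f2 r2 : R -> R).
Hypotheses (ok1 : admissible q f1 r1) (ok2 : admissible q f2 r2).
Hypotheses (fe : forall x, `|f1 x - f2 x| <= e) (re : forall x, `|r1 x - r2 x| <= e).

Let e0 : 0 <= e. Proof. exact: le_trans (fe 0). Qed.
Let q0 : 0 < expR q. Proof. exact: expR_gt0. Qed.

Let expR_diff x : `|expR (r1 x) - expR (r2 x)| <= expR q * e.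
Proof.
case: ok1 ok2 => _ _ _ _ h1 [_ _ _ _ h2].
by rewrite (le_trans (expR_lipschitz (h2 x) (h1 x)))// ler_wpM2l// ltW.
Qed.

Let prod_diff (phi : R -> R) x : (forall a b, `|phi b - phi a| <= `|b - a|) ->
  (forall a, `|phi a| <= 1) ->
  `|expR (r1 x) * phi (f1 x) - expR (r2 x) * phi (f2 x)| <= 2 * expR q * e.
Proof.
move=> lphi bphi.
have -> : expR (r1 x) * phi (f1 x) - expR (r2 x) * phi (f2 x) =
  (expR (r1 x) - expR (r2 x)) * phi (f1 x) + expR (r2 x) * (phi (f1 x) - phi (f2 x)) by ring.
rewrite (le_trans (ler_normD _ _))// !normrM (_ : 2 * expR q * e = expR q * e * 1 + expR q * e); last ring.
rewrite lerD//; first by rewrite ler_pM.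
rewrite ler_pM//; first by rewrite ger0_norm ?expR_ge0//; exact: expR_bound ok2 x.
exact: le_trans (lphi _ _) (fe x).
Qed.

Lemma densA_diff x : `|densA f1 r1 x - densA f2 r2 x| <= 2 * expR q * e.
Proof. by apply: prod_diff; [exact: cos_lipschitz|exact: cos_max]. Qed.

Lemma densB_diff x : `|densB f1 r1 x - densB f2 r2 x| <= 2 * expR q * e.
Proof.
rewrite /densB -mulrBl normrM (ger0_norm (_ : 0 <= 2^-1)) ?invr_ge0//.
have := prod_diff x (@sin_lipschitz R) (@sin_max R).
by have := normr_ge0 (expR (r1 x) * sin (f1 x) - expR (r2 x) * sin (f2 x)); lra.
Qed.

Let b1 := bmeas_locint (bmeas_densB ok1).
Let b2 := bmeas_locint (bmeas_densB ok2).

Let ointgB_diff x : 0 <= x <= 1 ->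
  `|ointg 0 x (densB f1 r1) - ointg 0 x (densB f2 r2)| <= 2 * expR q * e.
Proof.
move=> /andP[x0 x1]; rewrite -ointgB//.
rewrite (le_trans (ointg_bound _ x0 (fun x _ => densB_diff x)))//; first exact: locintB.
by rewrite subr0 ler_piMr// !mulr_ge0// ltW.
Qed.

Lemma primB_diff x : `|primB f1 r1 x - primB f2 r2 x| <= 4 * expR q * e.
Proof.
apply: (@periodic1_bound (fun x => primB f1 r1 x - primB f2 r2 x)) => [y|{}x x01].
  by rewrite (periodic_primB ok1) (periodic_primB ok2).
have h1 := ointgB_diff x01.
have h2 : `|meanB f1 r1 - meanB f2 r2| <= 2 * expR q * e.
  by rewrite /meanB !int01E; apply: ointgB_diff; rewrite ler01 lexx.
rewrite /primB (_ : _ - _ = (ointg 0 x (densB f1 r1) - ointg 0 x (densB f2 r2)) -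
  x * (meanB f1 r1 - meanB f2 r2)); last ring.
have := ler_normB (ointg 0 x (densB f1 r1) - ointg 0 x (densB f2 r2)) (x * (meanB f1 r1 - meanB f2 r2)).
have : `|x * (meanB f1 r1 - meanB f2 r2)| <= 1 * (2 * expR q * e).
  by case/andP: x01 => x0 x1; rewrite normrM ger0_norm// ler_pM.
lra.
Qed.

Lemma momentAB_diff : `|momentAB f1 r1 - momentAB f2 r2| <= 8 * expR q ^+ 2 * e.
Proof.
have m1 := bmeas_locint (bmeasM (bmeas_densA ok1) (bmeas_primB ok1)).
have m2 := bmeas_locint (bmeasM (bmeas_densA ok2) (bmeas_primB ok2)).
rewrite /momentAB !int01E -ointgB//.
rewrite (le_trans (ointg_bound (M := 8 * expR q ^+ 2 * e) _ ler01 _))//; [exact: locintB| |lra].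
move=> x _; rewrite (_ : _ - _ = (densA f1 r1 x - densA f2 r2 x) * primB f1 r1 x +
   densA f2 r2 x * (primB f1 r1 x - primB f2 r2 x)); last ring.
rewrite (le_trans (ler_normD _ _))//.
have n1 : `|(densA f1 r1 x - densA f2 r2 x) * primB f1 r1 x| <= (2 * expR q * e) * (2 * expR q).
  by rewrite normrM ler_pM// ?densA_diff//; exact: primB_bound ok1 x.
have n2 : `|densA f2 r2 x * (primB f1 r1 x - primB f2 r2 x)| <= expR q * (4 * expR q * e).
  by rewrite normrM ler_pM// ?primB_diff//; exact: densA_bound ok2 x.
lra.
Qed.

Lemma velocity_diff x : `|velocity f1 r1 x - velocity f2 r2 x| <= velocity_lip q * e.
Proof.
have n1 := primB_diff x; have n2 := momentAB_diff; rewrite /velocity /velocity_lip.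
move: n1 n2; move: (primB _ _ _) (primB _ _ _) (momentAB _ _) (momentAB _ _) => b a d c n1 n2.
move: (1 - h)^-1 => k; have k0 := normr_ge0 k.
have -> : a + (p - c) * k - (b + (p - d) * k) = (a - b) - (c - d) * k by ring.
have n3 : `|c - d| * `|k| <= 8 * expR q ^+ 2 * e * `|k| by rewrite ler_wpM2r.
have n4 : 0 <= expR q ^+ 2 * e * `|k| by rewrite !mulr_ge0// exprn_ge0// ltW.
have := ler_normB (a - b) ((c - d) * k); rewrite normrM; lra.
Qed.

End Lipschitz.

(** One index set for all components lets the scheme treat a state as a single real family in the
    sup distance. Index 0 stands for the angle, 1 for ln Q, 2 for gam. *)
Definition state := (nat * R -> R).

Definition phase (st : state) x := st (0%N, x).
Definition logdens (st : state) x := st (1%N, x).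

(** No component depends on the one of index 2, which merely integrates -U^2; its value at x = 0 is
    later read as gam (t, 0). *)
Definition field (st : state) (i : nat * R) : R :=
  match i.1 with
  | 0 => 2 * velocity (phase st) (logdens st) i.2 - p * (1 + cos (phase st i.2))
  | 1 => - p * sin (phase st i.2)
  | _ => - velocity (phase st) (logdens st) i.2 ^+ 2
  end.

Variable q : R.

Definition domain (t : R) (st : state) := admissible (q + `|p| * t) (phase st) (logdens st).

Let qt t := q + `|p| * t.
Let Ub t := velocity_bound (qt t).
Definition field_lip t := (2 + 2 * Ub t) * velocity_lip (qt t) + `|p|.
Definition field_bound t := 2 * Ub t + 2 * `|p| + Ub t ^+ 2.

Lemma domain_mono s t st : s <= t -> domain s st -> domain t st.
Proof.
move=> le_st [pf mf pr mr rq]; split => // x; rewrite (le_trans (rq x))// lerD2l ler_wpM2l//.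
Qed.

(** A limit taken at every point preserves measurability, periodicity and closed bounds. *)
Lemma domain_lim t (u : nat -> state) st : (forall n, domain t (u n)) ->
  (forall i, u n i @[n --> \oo] --> st i) -> domain t st.
Proof.
move=> Du ust.
have lim_per k : (forall n, periodic1 (fun x => u n (k, x))) -> periodic1 (fun x => st (k, x)).
  move=> pu x; rewrite -(cvg_lim _ (ust (k, x + 1)))// -(cvg_lim _ (ust (k, x)))//.
  by rewrite (_ : (fun n => u n (k, x + 1)) = (fun n => u n (k, x)))//; apply/funext => n; exact: pu.
have lim_mea k : (forall n, measurable_fun setT (fun x => u n (k, x))) ->
    measurable_fun setT (fun x => st (k, x)).
  by move=> mu; apply: (measurable_fun_cvg (h := fun n x => u n (k, x))) => // x _; exact: ust.
split.
- by apply: lim_per => n; case: (Du n).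
- by apply: lim_mea => n; case: (Du n).
- by apply: lim_per => n; case: (Du n).
- by apply: lim_mea => n; case: (Du n).
- move=> x; have c : `|u n (1%N, x)| @[n --> \oo] --> `|st (1%N, x)| by exact: cvg_norm.
  rewrite /logdens -(cvg_lim _ c)//; apply: limr_le; first by apply/cvg_ex; exists (`|st (1%N, x)|).
  by apply: nearW => n; case: (Du n) => _ _ _ _; exact.
Qed.

Lemma domain_step t s st : 0 <= t -> 0 <= s -> domain t st ->
  domain (t + s) (fun i => st i + s * field st i).
Proof.
move=> t0 s0 D; have [pf mf pr mr rq] := D.
have bU := bmeas_velocity D; have pU := periodic_velocity D.
have bs := bmeas_sin D; have bc := bmeas_cos D.
split.
- by move=> x; rewrite /phase /field/= pU -!/(phase st _) pf.
- apply: measurable_funD => //; apply: measurable_funM => //.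
  by have [] := bmeasB (bmeasZ 2 bU) (bmeasZ p (bmeasD (bmeas_cst 1) bc)).
- by move=> x; rewrite /logdens /field/= -!/(logdens st _) -!/(phase st _) pf pr.
- apply: measurable_funD => //; apply: measurable_funM => //.
  by have [] := bmeasZ (- p) bs.
- move=> x; rewrite /logdens /field/= (le_trans (ler_normD _ _))//.
  rewrite mulrDr addrA lerD//; first exact: rq.
  rewrite !normrM normrN (ger0_norm s0) [leRHS]mulrC ler_wpM2l// ler_piMr//; exact: sin_max.
Qed.

Lemma field_le t st i : 0 <= t -> domain t st -> `|field st i| <= field_bound t.
Proof.
move=> t0 D; have Ux := velocity_le D; have U0 := velocity_bound_ge0 D.
rewrite -/(qt t) -/(Ub t) in Ux U0; have p0 := normr_ge0 p; have U2 := sqr_ge0 (Ub t).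
have pc (a : R) : `|a| <= 1 -> `|p * a| <= `|p| by move=> a1; rewrite normrM ler_piMr.
case: i => [[|[|k]] x]; rewrite /field /field_bound /=.
- have h1 := Ux x; have h2 := pc _ (cos_max (phase st x)).
  have := ler_normB (2 * velocity (phase st) (logdens st) x) (p * (1 + cos (phase st x))).
  have := ler_normD p (p * cos (phase st x)).
  have -> : p * (1 + cos (phase st x)) = p + p * cos (phase st x) by ring.
  by rewrite (normrM 2) (ger0_norm (_ : 0 <= 2))//; lra.
- by rewrite mulNr normrN; have := pc _ (sin_max (phase st x)); lra.
- rewrite normrN normrX.
  have : `|velocity (phase st) (logdens st) x| ^+ 2 <= Ub t ^+ 2 by rewrite lerXn2r ?nnegrE.
  lra.
Qed.

Let Ub_ge0 t : 0 <= Ub t.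
Proof.
by rewrite /Ub /velocity_bound addr_ge0// ?mulr_ge0 ?expR_ge0// addr_ge0// mulr_ge0// exprn_ge0 ?expR_ge0.
Qed.

Lemma field_lip_ge0 t : 0 <= field_lip t.
Proof. by rewrite addr_ge0// mulr_ge0 ?velocity_lip_ge0// addr_ge0// mulr_ge0. Qed.

Lemma field_bound_ge0 t : 0 <= field_bound t.
Proof. by apply: addr_ge0; [apply: addr_ge0; exact: mulr_ge0|exact: sqr_ge0]. Qed.

Lemma field_diff t st1 st2 e : 0 <= t -> domain t st1 -> domain t st2 ->
  (forall i, `|st1 i - st2 i| <= e) ->
  forall i, `|field st1 i - field st2 i| <= field_lip t * e.
Proof.
move=> t0 D1 D2 H; have e0 : 0 <= e := le_trans (normr_ge0 _) (H (0%N, 0)).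
have hU := velocity_diff D1 D2 (fun x => H (0%N, x)) (fun x => H (1%N, x)).
have U1 := velocity_le D1; have U2 := velocity_le D2; have U0 := velocity_bound_ge0 D1.
rewrite -/(qt t) -/(Ub t) in hU U1 U2 U0; have L0 := velocity_lip_ge0 (qt t).
have p0 := normr_ge0 p.
have hp (a b : R) : `|a - b| <= e -> `|p * (a - b)| <= `|p| * e.
  by move=> ab; rewrite normrM ler_wpM2l.
have Le : 0 <= velocity_lip (qt t) * e by rewrite mulr_ge0.
have ULe : 0 <= Ub t * (velocity_lip (qt t) * e) by rewrite mulr_ge0.
have pe : 0 <= `|p| * e by rewrite mulr_ge0.
case=> [[|[|k]] x]; rewrite /field /field_lip /=; have hx := hU x.
- set U := velocity _ _ _ in hx *; set U' := velocity _ _ _ in hx *.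
  have hc := hp _ _ (le_trans (cos_lipschitz (phase st2 x) (phase st1 x)) (H (0%N, x))).
  have -> : 2 * U - p * (1 + cos (phase st1 x)) - (2 * U' - p * (1 + cos (phase st2 x))) =
    2 * (U - U') - p * (cos (phase st1 x) - cos (phase st2 x)) by ring.
  have := ler_normB (2 * (U - U')) (p * (cos (phase st1 x) - cos (phase st2 x))).
  by rewrite (normrM 2) (ger0_norm (_ : 0 <= 2))//; lra.
- have hs := hp _ _ (le_trans (sin_lipschitz (phase st2 x) (phase st1 x)) (H (0%N, x))).
  by rewrite -mulrBr mulNr normrN; lra.
- set U := velocity _ _ _ in hx *; set U' := velocity _ _ _ in hx *.
  have -> : - U ^+ 2 - - U' ^+ 2 = - ((U + U') * (U - U')) by ring.
  have : `|(U + U') * (U - U')| <= (2 * Ub t) * (velocity_lip (qt t) * e).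
    rewrite normrM ler_pM// (le_trans (ler_normD _ _))//.
    by rewrite (_ : 2 * Ub t = Ub t + Ub t) ?lerD ?U1 ?U2//; ring.
  rewrite normrN => /le_trans; apply.
  have -> : ((2 + 2 * Ub t) * velocity_lip (qt t) + `|p|) * e =
    2 * Ub t * (velocity_lip (qt t) * e) + (2 * (velocity_lip (qt t) * e) + `|p| * e) by ring.
  by rewrite lerDl addr_ge0// mulr_ge0.
Qed.

End VectorField.

(** * The solution *)

Section Solution.
Variables (R : realType) (h p q : R) (f0 r0 : R -> R).
Hypothesis h1 : 1 - h != 0.
Hypothesis q0 : 0 <= q.
Hypothesis ok0 : admissible q f0 r0.
Hypothesis f0_bounded : exists M : R, forall x, `|f0 x| <= M.
Hypothesis mean0 : meanB f0 r0 = 0.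
Hypothesis length0 : int01 (fun x => (expR (r0 x) + densA f0 r0 x) / 2) = 1.
Hypothesis weight0 : int01 (densA f0 r0) = 1 - h.

Definition initial_state : state R := fun i =>
  match i.1 with 0 => f0 i.2 | 1 => r0 i.2 | _ => 0 end.

Definition flow (t : R) : state R := euler_limit (field h p) initial_state t.

Definition sol_f t := phase (flow t).
Definition sol_r t := logdens (flow t).
Definition sol_A t := densA (sol_f t) (sol_r t).
Definition sol_B t := densB (sol_f t) (sol_r t).
Definition sol_U t := velocity h p (sol_f t) (sol_r t).
Definition sol_Q t x := expR (sol_r t x).
Definition sol_V t x := (1 + cos (sol_f t x)) / 2.
Definition sol_W t x := sin (sol_f t x) / 2.
Definition sol_Y t x := (sol_Q t x + sol_A t x) / 2.
(** gam is rebuilt from its value at 0 and its space derivative, so that it is a primitive by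
    construction; the equation gam_t = -U^2 then becomes something to prove, in [sol_gam_C11]. *)
Definition sol_gam t x := flow t (2%N, 0) + ointg 0 x (fun z => sol_Y t z - 1).

Let domain0 : domain p q 0 initial_state.
Proof. by rewrite /domain mulr0 addr0. Qed.

Let step_dom t s st : 0 <= t -> 0 <= s -> domain p q t st ->
  domain p q (t + s) (fun i => st i + s * field h p st i).
Proof. exact: domain_step. Qed.

Lemma flow_domain t : 0 <= t -> domain p q t (flow t).
Proof.
move=> t0; apply: (euler_limit_domain (L := field_lip h p q) (B := field_bound h p q)) => //.
- exact: domain_mono.
- exact: domain_lim.
- exact: field_lip_ge0.
- exact: field_bound_ge0.
- exact: field_diff.
- by move=> *; exact: field_le.
Qed.

Lemma flow0 t : t <= 0 -> flow t = initial_state.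
Proof. exact: euler_limit_neg. Qed.

Lemma flow_admissible T t : 0 <= T -> t <= T -> admissible (q + `|p| * T) (sol_f t) (sol_r t).
Proof.
move=> T0 tT; case: (leP 0 t) => t0; first exact: domain_mono (flow_domain t0).
by rewrite /sol_f /sol_r flow0 ?(ltW t0)//; exact: domain_mono domain0.
Qed.

Let flow_ok t : admissible (q + `|p| * `|t|) (sol_f t) (sol_r t).
Proof. by apply: flow_admissible => //; exact: ler_norm. Qed.

Lemma flow_C11 T k : C11 T (fun t x => flow t (k, x)) (fun t x => field h p (flow t) (k, x)).
Proof.
have [C fC] := @euler_limit_flow2 R (nat * R) (field h p) (domain p q) (field_lip h p q)
  (field_bound h p q) initial_state (domain_mono (p := p) (q := q)) (domain_lim (p := p) (q := q))
  step_dom domain0 (field_lip_ge0 h p q) (field_bound_ge0 h p q)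
  (fun t x y e => @field_diff R h p q t x y e) (fun t x i => @field_le R h p q t x i) T.
have [M f0M] := f0_bounded; have q0' := q0.
have bF t x : 0 <= t <= T -> `|field h p (flow t) (k, x)| <= field_bound h p q T.
  move=> /andP[t0 tT]; apply: field_le; first exact: le_trans tT.
  exact: domain_mono (flow_domain t0).
have M0 : 0 <= M by exact: le_trans (f0M 0).
exists ((M + q) + `|T| * field_bound h p q T + field_bound h p q T + `|C| * T ^+ 2), C; split; last first.
  by move=> t s x tT tsT _; exact: fC.
move=> t x tT _; have [t0 tleT] := andP tT; have T0 := le_trans t0 tleT.
have b0 := field_bound_ge0 h p q T; have c0 : 0 <= `|C| * T ^+ 2 by rewrite mulr_ge0// sqr_ge0.
have b1 : 0 <= `|T| * field_bound h p q T by rewrite mulr_ge0.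
have b2 := bF t x tT; split; last first.
  by rewrite (le_trans b2)// addrAC lerDr !addr_ge0.
have T00 : 0 <= (0 : R) <= T by rewrite lexx.
(* The size of the flow at time [t] is read off from the estimate started at time 0, where the state
   is bounded by M + q. *)
have := fC 0 t (k, x) T00; rewrite add0r => /(_ tT).
rewrite -!/(flow _) (flow0 (lexx 0)) => H1.
have H2 : `|initial_state (k, x)| <= M + q.
  case: ok0 => _ _ _ _ rq; rewrite /initial_state.
  by case: (k) => [|[|j]] /=; rewrite ?normr0; [have := f0M x|have := rq x|]; lra.
have H3 : `|t * field h p initial_state (k, x)| <= `|T| * field_bound h p q T.
  have := bF 0 x T00; rewrite (flow0 (lexx 0)) => H; rewrite normrM ler_pM//.
  by rewrite !ger0_norm.
have H4 : C * t ^+ 2 <= `|C| * T ^+ 2.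
  apply: (@le_trans _ _ (`|C| * t ^+ 2)); first by rewrite ler_wpM2r ?sqr_ge0// ler_norm.
  by rewrite ler_wpM2l// lerXn2r ?nnegrE.
move: H1 H2 H3; set a := flow t (k, x); set b := initial_state (k, x); set c := t * _ => H1 H2 H3.
have := ler_normD (a - b - c) (b + c); have := ler_normD b c.
rewrite (_ : a - b - c + (b + c) = a); last ring.
lra.
Qed.

Lemma sol_f_C11 T : C11 T sol_f (fun t x => 2 * sol_U t x - p * (1 + cos (sol_f t x))).
Proof. exact: (flow_C11 T 0). Qed.

Lemma sol_r_C11 T : C11 T sol_r (fun t x => - p * sin (sol_f t x)).
Proof. exact: (flow_C11 T 1). Qed.

Lemma sol_Q_C11 T : C11 T sol_Q (fun t x => - 2 * p * sol_B t x).
Proof.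
apply: eq_C11 (C11_comp (@taylor1_expR R) (sol_r_C11 T)) => t x _ _.
by rewrite /sol_B /densB; field.
Qed.

Let cos_C11 T := C11_comp (@taylor1_cos R) (sol_f_C11 T).
Let sin_C11 T := C11_comp (@taylor1_sin R) (sol_f_C11 T).

Lemma sol_V_C11 T : C11 T sol_V (fun t x => - 2 * sol_U t x * sol_W t x + 2 * sol_W t x * sol_V t x * p).
Proof.
have := C11Z 2^-1 (C11D (C11_cst T 1) (cos_C11 T)).
rewrite (_ : (fun t x => 2^-1 * (1 + cos (sol_f t x))) = sol_V); last first.
  by apply/funext => t; apply/funext => x; rewrite /sol_V mulrC.
by apply: eq_C11 => t x _ _; rewrite /sol_V /sol_W; field.
Qed.

Lemma sol_W_C11 T : C11 T sol_W (fun t x => 2 * sol_U t x * sol_V t x - sol_U t x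
    - 2 * sol_V t x ^+ 2 * p + sol_V t x * p).
Proof.
have := C11Z 2^-1 (sin_C11 T).
rewrite (_ : (fun t x => 2^-1 * sin (sol_f t x)) = sol_W); last first.
  by apply/funext => t; apply/funext => x; rewrite /sol_W mulrC.
by apply: eq_C11 => t x _ _; rewrite /sol_V; field.
Qed.

Lemma sol_A_C11 T : C11 T sol_A (fun t x => 2 * sol_B t x * (p - 2 * sol_U t x)).
Proof.
apply: eq_C11 (C11M (sol_Q_C11 T) (cos_C11 T)) => t x _ _.
by rewrite /sol_B /densB /sol_Q; field.
Qed.

(** The space derivative of K - P(1) y, as [sol_A] is 2QV - Q and [sol_Y] is QV. *)
Definition rate_B t x := sol_U t x * sol_A t x - p * sol_Y t x.

Lemma sol_B_C11 T : C11 T sol_B rate_B.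
Proof.
have := C11Z 2^-1 (C11M (sol_Q_C11 T) (sin_C11 T)).
rewrite (_ : (fun t x => 2^-1 * (sol_Q t x * sin (sol_f t x))) = sol_B); last first.
  by apply/funext => t; apply/funext => x; rewrite /sol_B /densB mulrC.
apply: eq_C11 => t x _ _; rewrite /rate_B /sol_Y /sol_A /sol_B /densA /densB /sol_Q.
have := cos2Dsin2 (sol_f t x); set c := cos _; set s := sin _; set E := expR _ => cs.
(* The squared sine from the derivative of Q and the squared cosine from that of the angle add up to
   1, which leaves [sol_Y]. *)
have -> : 2^-1 * (- 2 * p * (E * s / 2) * s + E * (c * (2 * sol_U t x - p * (1 + c)))) =
  sol_U t x * (E * c) - p * (E * c) / 2 - p * E * (c ^+ 2 + s ^+ 2) / 2 by field.
by rewrite cs; field.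
Qed.

Definition rate_Y t x := - 2 * sol_U t x * sol_B t x.

Lemma sol_Y_C11 T : C11 T sol_Y rate_Y.
Proof.
have := C11Z 2^-1 (C11D (sol_Q_C11 T) (sol_A_C11 T)).
rewrite (_ : (fun t x => 2^-1 * (sol_Q t x + sol_A t x)) = sol_Y); last first.
  by apply/funext => t; apply/funext => x; rewrite /sol_Y mulrC.
by apply: eq_C11 => t x _ _; rewrite /rate_Y; field.
Qed.

Lemma bmeas_sol_A t : bmeas (sol_A t). Proof. exact: bmeas_densA (flow_ok t). Qed.
Lemma bmeas_sol_B t : bmeas (sol_B t). Proof. exact: bmeas_densB (flow_ok t). Qed.
Lemma bmeas_sol_U t : bmeas (sol_U t). Proof. exact: bmeas_velocity (flow_ok t). Qed.
Lemma bmeas_sol_Q t : bmeas (sol_Q t). Proof. exact: bmeas_expR (flow_ok t). Qed.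

Lemma bmeas_sol_V t : bmeas (sol_V t).
Proof.
apply: bmeasM; last exact: bmeas_cst.
by apply: bmeasD; [exact: bmeas_cst|exact: bmeas_cos (flow_ok t)].
Qed.

Lemma bmeas_sol_W t : bmeas (sol_W t).
Proof. by apply: bmeasM; [exact: bmeas_sin (flow_ok t)|exact: bmeas_cst]. Qed.

Lemma bmeas_sol_Y t : bmeas (sol_Y t).
Proof.
apply: bmeasM; last exact: bmeas_cst.
by apply: bmeasD; [exact: bmeas_sol_Q|exact: bmeas_sol_A].
Qed.

Lemma bmeas_rate_B t : bmeas (rate_B t).
Proof.
apply: bmeasB; first by apply: bmeasM; [exact: bmeas_sol_U|exact: bmeas_sol_A].
exact/bmeasZ/bmeas_sol_Y.
Qed.

Lemma bmeas_rate_Y t : bmeas (rate_Y t).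
Proof. by apply: bmeasM; [exact/bmeasZ/bmeas_sol_U|exact: bmeas_sol_B]. Qed.

Let bmeas_rate_A t : bmeas (fun x => 2 * sol_B t x * (p - 2 * sol_U t x)).
Proof.
apply: bmeasM; first exact/bmeasZ/bmeas_sol_B.
by apply: bmeasB; [exact: bmeas_cst|exact/bmeasZ/bmeas_sol_U].
Qed.

Let per_f t : periodic1 (sol_f t). Proof. by case: (flow_ok t). Qed.
Let per_r t : periodic1 (sol_r t). Proof. by case: (flow_ok t). Qed.

Lemma periodic_sol_A t : periodic1 (sol_A t). Proof. exact: periodic_densA (flow_ok t). Qed.
Lemma periodic_sol_B t : periodic1 (sol_B t). Proof. exact: periodic_densB (flow_ok t). Qed.
Lemma periodic_sol_U t : periodic1 (sol_U t). Proof. exact: periodic_velocity (flow_ok t). Qed.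
Lemma periodic_sol_Q t : periodic1 (sol_Q t). Proof. by move=> x; rewrite /sol_Q per_r. Qed.
Lemma periodic_sol_V t : periodic1 (sol_V t). Proof. by move=> x; rewrite /sol_V per_f. Qed.
Lemma periodic_sol_W t : periodic1 (sol_W t). Proof. by move=> x; rewrite /sol_W per_f. Qed.
Lemma periodic_sol_Y t : periodic1 (sol_Y t).
Proof. by move=> x; rewrite /sol_Y periodic_sol_Q periodic_sol_A. Qed.

Let mB t := meanB (sol_f t) (sol_r t).
Let cst t := (p - momentAB (sol_f t) (sol_r t)) / (1 - h).

Let U_primitive t : primitive (sol_U t) (fun x => sol_B t x - mB t).
Proof.
split; [exact: bmeas_sol_U|by apply: bmeasB; [exact: bmeas_sol_B|exact: bmeas_cst]|].
move=> x y; have lB := bmeas_locint (bmeas_sol_B t).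
rewrite ointgB//; last exact: locint_cst.
rewrite ointg_cst /sol_U /velocity /primB -/(sol_B t) -(ointg_cat 0 x y lB) -/(mB t); ring.
Qed.

(** The derivative of U is B - mB, so U (B - mB) is half the derivative of the periodic function U^2
    and has integral 0. *)
Let int_UB t : int01 (fun x => sol_U t x * sol_B t x) = mB t * int01 (sol_U t).
Proof.
have [_ bUU UUE] := primitiveM (U_primitive t) (U_primitive t).
have := UUE 0 1; have -> : sol_U t 1 = sol_U t 0 by rewrite -(periodic_sol_U t 0) add0r.
rewrite subrr.
have lU := bmeas_locint (bmeas_sol_U t).
have lUB := bmeas_locint (bmeasM (bmeas_sol_U t) (bmeas_sol_B t)).
have -> : (fun x => sol_U t x * (sol_B t x - mB t) + (sol_B t x - mB t) * sol_U t x) =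
  (fun x => 2 * (sol_U t x * sol_B t x) - (2 * mB t) * sol_U t x).
  by apply/funext => x; ring.
by rewrite ointgB ?ointgZ//; [rewrite !int01E; lra|exact: locintZ..].
Qed.

(** The additive constant in [velocity] is tuned to the weight 1 - h. Any other weight of [sol_A]
    leaves a defect proportional to the difference, which keeps the system for the invariants
    homogeneous. *)
Let int_UA t : int01 (fun x => sol_U t x * sol_A t x) = p + cst t * (int01 (sol_A t) - (1 - h)).
Proof.
have lA := bmeas_locint (bmeas_sol_A t).
have bE := bmeas_primB (flow_ok t).
have lAE := bmeas_locint (bmeasM (bmeas_sol_A t) bE).
have -> : (fun x => sol_U t x * sol_A t x) =
   (fun x => sol_A t x * primB (sol_f t) (sol_r t) x + cst t * sol_A t x).
  by apply/funext => x; rewrite /sol_U /velocity -/(cst t); ring.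
rewrite int01E ointgD ?ointgZ//; last exact: locintZ.
rewrite -!int01E -[int01 (fun x => sol_A t x * _)]/(momentAB (sol_f t) (sol_r t)).
by rewrite /cst; field.
Qed.

Let al t := int01 (sol_Y t).
Let wt t := int01 (sol_A t).

Let mB_C11 T : C11 T (fun t (_ : R) => mB t)
  (fun t _ => cst t * (wt t - (1 - h)) - p * (al t - 1)).
Proof.
apply: eq_C11 (C11_int01 bmeas_sol_B bmeas_rate_B (sol_B_C11 T)) => t x _ _.
rewrite int01E /rate_B ointgB; last 2 first.
- exact/bmeas_locint/bmeasM/bmeas_sol_A/bmeas_sol_U.
- exact/locintZ/bmeas_locint/bmeas_sol_Y.
rewrite ointgZ; last exact/bmeas_locint/bmeas_sol_Y.
by rewrite -!int01E int_UA /al /wt; ring.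
Qed.

Let al_C11 T : C11 T (fun t (_ : R) => al t) (fun t _ => - 2 * mB t * int01 (sol_U t)).
Proof.
apply: eq_C11 (C11_int01 bmeas_sol_Y bmeas_rate_Y (sol_Y_C11 T)) => t x _ _.
rewrite (_ : rate_Y t = (fun x => - 2 * (sol_U t x * sol_B t x))); last first.
  by apply/funext => y; rewrite /rate_Y; ring.
rewrite int01E ointgZ; last exact/bmeas_locint/bmeasM/bmeas_sol_B/bmeas_sol_U.
by rewrite -int01E int_UB; ring.
Qed.

Let wt_C11 T : C11 T (fun t (_ : R) => wt t)
  (fun t _ => 2 * p * mB t - 4 * mB t * int01 (sol_U t)).
Proof.
apply: eq_C11 (C11_int01 bmeas_sol_A bmeas_rate_A (sol_A_C11 T)) => t x _ _.
rewrite (_ : (fun x => _) = (fun x => 2 * p * sol_B t x - 4 * (sol_U t x * sol_B t x))); last first.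
  by apply/funext => y; ring.
have lUB : locint (fun x => sol_U t x * sol_B t x).
  exact/bmeas_locint/bmeasM/bmeas_sol_B/bmeas_sol_U.
have lB := bmeas_locint (bmeas_sol_B t).
by rewrite int01E ointgB ?ointgZ//; [rewrite -!int01E int_UB /mB /meanB -/(sol_B t); ring|exact: locintZ..].
Qed.

(* [mB], [al - 1] and [wt - (1 - h)] solve a homogeneous linear system and vanish initially. *)
Lemma invariants t : 0 <= t ->
  [/\ mB t = 0, int01 (sol_Y t) = 1 & int01 (sol_A t) = 1 - h].
Proof.
move=> t0; pose z (s x : R) := mB s ^+ 2 + (al s - 1) ^+ 2 + (wt s - (1 - h)) ^+ 2.
have dal := C11B (al_C11 t) (C11_cst t 1).
have dwt := C11B (wt_C11 t) (C11_cst t (1 - h)).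
have dz := C11D (C11D (C11M (mB_C11 t) (mB_C11 t)) (C11M dal dal)) (C11M dwt dwt).
rewrite (_ : (fun s x => _) = z) in dz; last by [].
pose Ub := velocity_bound h p (q + `|p| * t).
have Ub_le s x : s <= t -> `|sol_U s x| <= Ub.
  by move=> st; exact: velocity_le (flow_admissible t0 st) x.
have Ub0 : 0 <= Ub by exact: le_trans (Ub_le 0 0 t0).
have iU s : s <= t -> `|int01 (sol_U s)| <= Ub.
  move=> st; rewrite int01E.
  rewrite (le_trans (ointg_bound (M := Ub) (bmeas_locint (bmeas_sol_U s)) ler01 _))//; last lra.
  by move=> x _; exact: Ub_le.
pose Cb := (`|p| + 2 * expR (q + `|p| * t) ^+ 2) * `|(1 - h)^-1|.
have ic s : s <= t -> `|cst s| <= Cb.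
  move=> st; rewrite /cst normrM ler_wpM2r// (le_trans (ler_normB _ _))// lerD2l.
  exact: momentAB_bound (flow_admissible t0 st).
have t01 : 0 <= (0 : R) <= 1 by rewrite lexx ler01.
have Cb0 : 0 <= Cb by exact: le_trans (ic 0 t0).
have p0 := normr_ge0 p.
have tt : 0 <= t <= t by rewrite t0 lexx.
have zt : z t 0 = 0.
  apply: (C11_gronwall (K := Cb + 3 * `|p| + 6 * Ub) _ t01 dz) => //.
- by lra.
- by move=> s _; rewrite /z !addr_ge0// sqr_ge0.
- move=> s /andP[s0 st]; have := iU s st; have := ic s st; rewrite /z.
  move: (mB s) (int01 (sol_U s)) (cst s) (al s - 1) (wt s - (1 - h)) => m u c a w cb ub.
  (* Every term of the derivative of [z] is a bounded factor times a product of two of the three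
     quantities; 2 |x y| <= x^2 + y^2 turns it into a multiple of [z]. *)
  have B (k x y K : R) : `|k| <= K -> `|k * (x * y)| <= K / 2 * (x ^+ 2 + y ^+ 2).
    move=> kK; rewrite normrM; have : `|x * y| <= (x ^+ 2 + y ^+ 2) / 2.
      rewrite normrM -(real_normK (num_real x)) -(real_normK (num_real y)).
      by have := sqr_ge0 (`|x| - `|y|); lra.
    by move=> H; rewrite (le_trans (ler_pM _ _ kK H))//; lra.
  have := B _ m w _ cb; have := B p m a _ (lexx _); have := B u a m _ ub.
  have := B p w m _ (lexx _); have := B u w m _ ub.
  move: (sqr_ge0 m) (sqr_ge0 a) (sqr_ge0 w).
  set A1 := u * (w * m); set A2 := p * (w * m); set A3 := u * (a * m).
  set A4 := p * (m * a); set A5 := c * (m * w) => m2 a2 w2 n1 n2 n3 n4 n5.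
  rewrite [X in `|X|](_ : _ = 2 * A5 - 2 * A4 - 4 * A3 + 4 * A2 - 8 * A1); last first.
    by rewrite /A1 /A2 /A3 /A4 /A5; ring.
  have e1 := ler_norm A1; have e1' := ler_norm (- A1); rewrite normrN in e1'.
  have e2 := ler_norm A2; have e2' := ler_norm (- A2); rewrite normrN in e2'.
  have e3 := ler_norm A3; have e3' := ler_norm (- A3); rewrite normrN in e3'.
  have e4 := ler_norm A4; have e4' := ler_norm (- A4); rewrite normrN in e4'.
  have e5 := ler_norm A5; have e5' := ler_norm (- A5); rewrite normrN in e5'.
  have q1 : 0 <= Cb * a ^+ 2 by rewrite mulr_ge0.
  have q2 : 0 <= Ub * a ^+ 2 by rewrite mulr_ge0.
  have q3 : 0 <= Ub * w ^+ 2 by rewrite mulr_ge0.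
  have q4 : 0 <= Ub * m ^+ 2 by rewrite mulr_ge0.
  have q5 : 0 <= `|p| * m ^+ 2 by rewrite mulr_ge0.
  have q6 : 0 <= `|p| * a ^+ 2 by rewrite mulr_ge0.
  have q7 : 0 <= `|p| * w ^+ 2 by rewrite mulr_ge0.
  rewrite ler_norml; apply/andP; split; lra.
- rewrite /z /mB /al /wt /sol_A /sol_Y /sol_f /sol_r (flow0 (lexx 0)).
  rewrite (_ : phase initial_state = f0)// (_ : logdens initial_state = r0)//.
  rewrite mean0 weight0 (_ : int01 _ = 1) ?subrr ?expr0n/= ?addr0//.
  by rewrite -[RHS]length0; congr int01; apply/funext => x; rewrite /sol_Q /sol_A /sol_r /sol_f (flow0 (lexx 0)).
rewrite /z in zt.
have [m2 a2 w2] : [/\ 0 <= mB t ^+ 2, 0 <= (al t - 1) ^+ 2 & 0 <= (wt t - (1 - h)) ^+ 2].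
  by split; exact: sqr_ge0.
split; apply/eqP.
- by rewrite -sqrf_eq0; apply/eqP; lra.
- by rewrite -subr_eq0 -sqrf_eq0 -/(al t); apply/eqP; lra.
- by rewrite -subr_eq0 -sqrf_eq0 -/(wt t); apply/eqP; lra.
Qed.

Let bmeas_periodic_primitive (g : R -> R) : periodic1 g -> bmeas g ->
  bmeas (fun x => ointg 0 x g - x * int01 g).
Proof.
move=> pg bg; have [_ [M gM]] := bg; have lg := bmeas_locint bg.
split.
  apply: measurable_funB; first exact: (measurable_ointg 0 bg).
  by apply: measurable_funM.
exists (M + `|int01 g|); apply: periodic1_bound; first exact: periodic1_ointg.
move=> x /andP[x0 x1]; rewrite (le_trans (ler_normB _ _))// lerD//.
  rewrite (le_trans (ointg_bound lg x0 (fun x _ => gM x)))// subr0 ler_piMr//.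
  by rewrite (le_trans _ (gM 0)).
by rewrite normrM ger0_norm// ler_piMl.
Qed.

Lemma sol_U_primitive t : 0 <= t -> primitive (sol_U t) (sol_B t).
Proof.
move=> t0; have [m0 _ _] := invariants t0; have := U_primitive t.
by rewrite m0; under [X in primitive _ X -> _]eq_fun do rewrite subr0.
Qed.

Let U1 t : sol_U t 1 = sol_U t 0.
Proof. by rewrite -(periodic_sol_U t 0) add0r. Qed.

Lemma int01_UA t : 0 <= t -> int01 (fun x => sol_U t x * sol_A t x) = p.
Proof. by move=> t0; have [_ _ w] := invariants t0; rewrite int_UA w subrr mulr0 addr0. Qed.

Lemma periodic_rate_B t : periodic1 (rate_B t).
Proof. by move=> x; rewrite /rate_B periodic_sol_U periodic_sol_A periodic_sol_Y. Qed.

Lemma int01_rate_B t : 0 <= t -> int01 (rate_B t) = 0.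
Proof.
move=> t0; have [_ y1 _] := invariants t0.
have lY := bmeas_locint (bmeas_sol_Y t).
rewrite int01E /rate_B ointgB; last exact: locintZ; last first.
  exact/bmeas_locint/bmeasM/bmeas_sol_A/bmeas_sol_U.
by rewrite ointgZ// -!int01E int01_UA// y1; ring.
Qed.

(** The time derivative of [primB]. The mean of [rate_B] is shown to vanish for t >= 0 only; keeping
    its term makes [dE] periodic and bounded whatever the sign of [t], as [C11_int01] demands. *)
Let dE t x := ointg 0 x (rate_B t) - x * int01 (rate_B t).

Let bmeas_dE t : bmeas (dE t).
Proof. by apply: bmeas_periodic_primitive; [exact: periodic_rate_B|exact: bmeas_rate_B]. Qed.

Let E_C11 T : C11 T (fun t x => primB (sol_f t) (sol_r t) x) dE.
Proof.
have id_C11 : C11 T (fun _ x => x) (fun _ _ => 0).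
  exists 1, 0; split; last by move=> *; rewrite subrr mulr0 subrr normr0 mul0r.
  by move=> _ x _ /andP[x0 x1]; rewrite normr0 ger0_norm.
apply: eq_C11 (C11B (C11_ointg bmeas_sol_B bmeas_rate_B (sol_B_C11 T))
  (C11M id_C11 (C11_int01 bmeas_sol_B bmeas_rate_B (sol_B_C11 T)))) => t x _ _.
by rewrite /dE; ring.
Qed.

(** The integrand is a polynomial in U times B = U', hence the derivative of a periodic function.
    Consequently the time derivative of A contributes nothing to that of [momentAB]. *)
Let int_dA_E t : 0 <= t ->
  int01 (fun x => 2 * sol_B t x * (p - 2 * sol_U t x) * primB (sol_f t) (sol_r t) x) = 0.
Proof.
move=> t0; have PU := sol_U_primitive t0; have PUU := primitiveM PU PU.
have PUUU := primitiveM PU PUU.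
(* The primitive is -(4/3) U^3 + (p + 2c) U^2 - 2pc U, where c is the additive constant of the
   velocity. *)
have [_ _ H] := primitiveD (primitiveZ (- (4 / 3)) PUUU)
  (primitiveD (primitiveZ (p + 2 * cst t) PUU) (primitiveZ (- 2 * p * cst t) PU)).
rewrite int01E (_ : (fun x => _) = (fun x =>
  - (4 / 3) * (sol_U t x * (sol_U t x * sol_B t x + sol_B t x * sol_U t x) +
     sol_B t x * (sol_U t x * sol_U t x)) +
  ((p + 2 * cst t) * (sol_U t x * sol_B t x + sol_B t x * sol_U t x) +
  - 2 * p * cst t * sol_B t x))).
  by rewrite H U1 subrr.
apply/funext => x.
have -> : primB (sol_f t) (sol_r t) x = sol_U t x - cst t by rewrite /sol_U /velocity -/(cst t); ring.
move: (cst t) (sol_U t x) (sol_B t x) => c U B.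
by field.
Qed.

Definition rate_U t x := ointg 0 x (rate_B t) -
  (1 - h)^-1 * int01 (fun z => sol_A t z * ointg 0 z (rate_B t)).

Lemma sol_U_C11 T : C11 T sol_U rate_U.
Proof.
have bE t : bmeas (primB (sol_f t) (sol_r t)) := bmeas_primB (flow_ok t).
have b1 t := bmeasM (bmeas_sol_A t) (bE t).
have b2 t : bmeas (fun x => 2 * sol_B t x * (p - 2 * sol_U t x) * primB (sol_f t) (sol_r t) x +
   sol_A t x * dE t x).
  by apply: bmeasD; [exact: bmeasM|apply: bmeasM => //; exact: bmeas_sol_A].
have e_C11 := C11_int01 b1 b2 (C11M (sol_A_C11 T) (E_C11 T)).
have := C11D (E_C11 T) (C11Z (1 - h)^-1 (C11B (C11_cst T p) e_C11)).
rewrite (_ : (fun t x => primB _ _ x + _) = sol_U); last first.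
  apply/funext => t; apply/funext => x.
  by rewrite /sol_U /velocity /momentAB -/(sol_A t); congr (_ + _); rewrite mulrC.
apply: eq_C11 => t x /andP[t0 _] _.
have dEE z : dE t z = ointg 0 z (rate_B t) by rewrite /dE int01_rate_B// mulr0 subr0.
rewrite /rate_U dEE; congr (_ + _); rewrite -mulrN; congr (_ * _).
have bA := bmeas_sol_A t.
rewrite int01E ointgD; last 2 first.
- exact/bmeas_locint/bmeasM.
- by apply: bmeas_locint; apply: bmeasM.
rewrite -!int01E int_dA_E// !add0r; congr (- int01 _).
by apply/funext => z; rewrite dEE.
Qed.

Lemma sol_gam_primitive t : 0 <= t -> primitive (sol_gam t) (fun x => sol_Y t x - 1).
Proof.
move=> t0; have [_ y1 _] := invariants t0.
have bY : bmeas (fun x => sol_Y t x - 1) by apply: bmeasB; [exact: bmeas_sol_Y|exact: bmeas_cst].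
have pY : periodic1 (fun x => sol_Y t x - 1) by move=> x; rewrite periodic_sol_Y.
have lY := bmeas_locint bY; split => //; last first.
  by move=> x y; rewrite /sol_gam -(ointg_cat 0 x y lY); ring.
have iY : int01 (fun x => sol_Y t x - 1) = 0.
  rewrite int01E ointgB; [|exact/bmeas_locint/bmeas_sol_Y|exact: locint_cst].
  by rewrite ointg_cst -int01E y1; lra.
have := bmeasD (bmeas_cst (flow t (2%N, 0))) (bmeas_periodic_primitive pY bY).
by rewrite iY; under eq_fun do rewrite mulr0 subr0.
Qed.

Lemma periodic_sol_gam t : 0 <= t -> periodic1 (sol_gam t).
Proof.
move=> t0 x; have [_ bY gE] := sol_gam_primitive t0.
have pY : periodic1 (fun x => sol_Y t x - 1) by move=> y; rewrite periodic_sol_Y.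
have := ointg_period x pY (bmeas_locint bY); rewrite gE.
have [_ y1 _] := invariants t0.
rewrite int01E ointgB; [|exact/bmeas_locint/bmeas_sol_Y|exact: locint_cst].
by rewrite ointg_cst -int01E y1; lra.
Qed.

(** At x = 0 the flow gives -U^2 directly; integrating -2UB, the derivative of -U^2, from 0 to x
    supplies the difference. *)
Lemma sol_gam_C11 T : C11 T sol_gam (fun t x => - sol_U t x ^+ 2).
Proof.
have b1 t : bmeas (fun x => sol_Y t x - 1).
  by apply: bmeasB; [exact: bmeas_sol_Y|exact: bmeas_cst].
have Y_C11 : C11 T (fun t x => sol_Y t x - 1) rate_Y.
  by apply: eq_C11 (C11B (sol_Y_C11 T) (C11_cst T 1)) => t x _ _; rewrite subr0.
have c0 := C11_at (y := 0) _ (flow_C11 T 2); rewrite lexx ler01 in c0.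
apply: eq_C11 (C11D (c0 isT) (C11_ointg b1 bmeas_rate_Y Y_C11)) => t x /andP[t0 _] _.
have PU := sol_U_primitive t0; have [_ _ UU] := primitiveM PU PU.
rewrite (_ : rate_Y t = (fun x => -1 * (sol_U t x * sol_B t x + sol_B t x * sol_U t x))); last first.
  by apply/funext => y; rewrite /rate_Y; ring.
have [_ bUU _] := primitiveM PU PU.
rewrite ointgZ; last exact: bmeas_locint.
by rewrite UU /field/= -/(sol_U t 0); ring.
Qed.

Lemma Pone_sol t : 0 <= t -> Pone (sol_U t) (sol_V t) (sol_Q t) = p.
Proof.
move=> t0; rewrite -(int01_UA t0); congr int01; apply/funext => x.
by rewrite /sol_V /sol_A /densA /sol_Q; field.
Qed.

(** K - P(1) y differs from the primitive of [rate_B] from 0 by a constant [k] that carries the base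
    point. Subtracting (1 - h)^-1 times the integral against A removes [k], because A has integral 1
    - h. *)
Lemma rhsU_sol t x0 x : 0 <= t ->
  rhsU h (sol_gam t) (sol_U t) (sol_V t) (sol_Q t) x0 x = rate_U t x.
Proof.
move=> t0; have [_ y1 w1] := invariants t0.
rewrite /rhsU Pone_sol// /Kfun.
rewrite (_ : (fun z => 2 * sol_U t z * sol_Q t z * sol_V t z - sol_U t z * sol_Q t z) =
   (fun z => sol_U t z * sol_A t z)); last first.
  by apply/funext => z; rewrite /sol_V /sol_A /densA /sol_Q; field.
have lY := bmeas_locint (bmeas_sol_Y t).
have bUA := bmeasM (bmeas_sol_U t) (bmeas_sol_A t); have lUA := bmeas_locint bUA.
pose k := - ointg 0 x0 (fun z => sol_U t z * sol_A t z) - p * flow t (2%N, 0).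
have E z : ointg x0 z (fun z => sol_U t z * sol_A t z) - p * (sol_gam t z + z) =
    ointg 0 z (rate_B t) + k.
  rewrite /sol_gam ointgB//; last exact: locint_cst.
  rewrite ointg_cst /rate_B ointgB//; last exact: locintZ.
  by rewrite ointgZ// -(ointg_cat 0 x0 z lUA) /k; ring.
rewrite E.
have -> : (fun eta => (2 * sol_Q t eta * sol_V t eta - sol_Q t eta) *
     (ointg x0 eta (fun z => sol_U t z * sol_A t z) - p * (sol_gam t eta + eta))) =
   (fun eta => sol_A t eta * ointg 0 eta (rate_B t) + k * sol_A t eta).
  apply/funext => z; rewrite E /sol_V /sol_A /densA /sol_Q.
  by move: (ointg 0 z _) => K; field.
have bK : bmeas (fun x => ointg 0 x (rate_B t)).
  have := bmeas_dE t; rewrite /dE int01_rate_B//.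
  by under [X in bmeas X -> _]eq_fun do rewrite mulr0 subr0.
have lAK := bmeas_locint (bmeasM (bmeas_sol_A t) bK).
have lA := bmeas_locint (bmeas_sol_A t).
rewrite int01E (ointgD 0 1 lAK (locintZ k lA)) ointgZ// -!int01E w1 /rate_U.
by move: (int01 _) (ointg _ _ _) => I K; field.
Qed.

Lemma rate_U_primitive t : 0 <= t -> primitive (rate_U t) (rate_B t).
Proof.
move=> t0; have bK := bmeas_dE t; have lB := bmeas_locint (bmeas_rate_B t).
split; [|exact: bmeas_rate_B|]; last first.
  by move=> x y; rewrite /rate_U -(ointg_cat 0 x y lB); ring.
apply: bmeasB; last exact: bmeas_cst.
move: bK; rewrite /dE int01_rate_B//.
by under [X in bmeas X -> _]eq_fun do rewrite mulr0 subr0.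
Qed.

Lemma periodic_rate_U t : 0 <= t -> periodic1 (rate_U t).
Proof.
move=> t0 x; have := periodic1_ointg (periodic_rate_B t) (bmeas_locint (bmeas_rate_B t)) x.
by rewrite /rate_U int01_rate_B// !mulr0 !subr0 => ->.
Qed.

Lemma sol_regular : regular_solution h p sol_gam sol_U sol_V sol_W sol_Q sol_Y sol_B rate_U rate_B.
Proof.
split.
- exact: sol_gam_primitive.
- exact: sol_U_primitive.
- exact: rate_U_primitive.
- exact: periodic_sol_gam.
- exact: periodic_sol_U.
- exact: periodic_rate_U.
- exact: periodic_sol_Y.
- exact: periodic_sol_B.
- exact: periodic_rate_B.
- by move=> t; split; [exact: bmeas_sol_V|exact: periodic_sol_V].
- by move=> t; split; [exact: bmeas_sol_W|exact: periodic_sol_W].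
- by move=> t; split; [exact: bmeas_sol_Q|exact: periodic_sol_Q].
- exact: sol_gam_C11.
- exact: sol_Y_C11.
- exact: sol_U_C11.
- exact: sol_B_C11.
- exact: sol_V_C11.
- exact: sol_W_C11.
- by move=> T; apply: eq_C11 (sol_Q_C11 T) => t x _ _; rewrite /sol_B /densB /sol_W /sol_Q; field.
- exact: Pone_sol.
- by move=> t x0 x t0; exact: rhsU_sol.
Qed.

End Solution.

(** * Regular solutions *)

Section RegularSolution.
Variables (R : realType) (h p : R).
Implicit Types (T : R) (gam U V W Q Y B DU DB f g : R -> R -> R).

Lemma C11_bound T f f' : C11 T f f' -> exists2 M, 0 <= M &
  forall t x, 0 <= t <= T -> 0 <= x <= 1 -> `|f t x| <= M /\ `|f' t x| <= M.
Proof.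
move=> [M [C [fM _]]]; exists `|M| => // t x tT x01; have [a b] := fM _ _ tT x01.
by split; rewrite (le_trans _ (ler_norm M)).
Qed.

Lemma C11_quotient T f f' : C11 T f f' -> exists2 C, 0 <= C &
  forall t s x, 0 <= t <= T -> 0 <= t + s <= T -> s != 0 -> 0 <= x <= 1 ->
  `|(f (t + s) x - f t x) / s - f' t x| <= C * `|s|.
Proof.
move=> [M [C [_ fC]]]; exists `|C| => // t s x tT tsT s0 x01.
have -> : (f (t + s) x - f t x) / s - f' t x = (f (t + s) x - f t x - s * f' t x) / s by field.
rewrite normrM normfV ler_pdivrMr ?normr_gt0// -mulrA -expr2 real_normK ?num_real//.
by rewrite (le_trans (fC _ _ _ tT tsT x01))// ler_wpM2r ?sqr_ge0// ler_norm.
Qed.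

Lemma C11_quotient_Linfnorm T f f' : C11 T f f' -> exists2 C, 0 <= C &
  forall t s, 0 <= t <= T -> 0 <= t + s <= T -> s != 0 ->
  Linfnorm (fun x => (f (t + s) x - f t x) / s - f' t x) <= C * `|s|.
Proof.
move=> /C11_quotient[C C0 fC]; exists C => // t s tT tsT s0.
by apply: Linfnorm_le; [rewrite mulr_ge0|apply: ae01W => x x01; exact: fC].
Qed.

(** The H^1 norm sees the space derivative of the quotient, so the uniform estimate is used for [f]
    and for its space derivative [g]. *)
Lemma C11_quotient_H1norm T f f' g g' : C11 T f f' -> C11 T g g' ->
  (forall t, 0 <= t -> primitive (f t) (g t)) ->
  (forall t, 0 <= t -> primitive (f' t) (g' t)) ->
  (forall t, 0 <= t -> periodic1 (f t)) -> (forall t, 0 <= t -> periodic1 (f' t)) ->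
  (forall t, 0 <= t -> periodic1 (g t)) -> (forall t, 0 <= t -> periodic1 (g' t)) ->
  exists2 C, 0 <= C &
  forall t s, 0 <= t <= T -> 0 <= t + s <= T -> s != 0 ->
  H1norm (fun x => (f (t + s) x - f t x) / s - f' t x) <= C * `|s|.
Proof.
move=> /C11_quotient[C C0 fC] /C11_quotient[D D0 gD] Pf Pf' pf pf' pg pg'.
exists (2 * (C + D)); first by rewrite mulr_ge0// addr_ge0.
move=> t s tT tsT s0; have [t0 _] := andP tT; have [ts0 _] := andP tsT.
have [b1 b2 E] := primitiveD (primitiveZ s^-1 (primitiveD (Pf _ ts0) (primitiveZ (-1) (Pf _ t0))))
  (primitiveZ (-1) (Pf' _ t0)).
have E1 : (fun x => (f (t + s) x - f t x) / s - f' t x) =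
    (fun x => s^-1 * (f (t + s) x + -1 * f t x) + -1 * f' t x).
  by apply/funext => x; field.
have E2 x : (g (t + s) x - g t x) / s - g' t x =
    s^-1 * (g (t + s) x + -1 * g t x) + -1 * g' t x by field.
rewrite -mulrA; rewrite {1}E1; apply: (H1norm_le b1 b2).
- by move=> x; rewrite pg// pg// pg'.
- by rewrite mulr_ge0// addr_ge0.
- by move=> x _; rewrite E; ring.
- apply: periodic1_bound => [x|x x01]; first by rewrite pf// pf// pf'.
  rewrite (_ : _ + _ = (f (t + s) x - f t x) / s - f' t x); last by field.
  by rewrite (le_trans (fC _ _ _ tT tsT s0 x01))// ler_wpM2r// lerDl.
- apply: periodic1_bound => [x|x x01]; first by rewrite pg// pg// pg'.
  by rewrite -E2 (le_trans (gD _ _ _ tT tsT s0 x01))// ler_wpM2r// lerDr.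
Qed.

Lemma C11_H1norm_bound T f f' g g' : C11 T f f' -> C11 T g g' ->
  (forall t, 0 <= t -> primitive (f t) (g t)) ->
  (forall t, 0 <= t -> periodic1 (f t)) -> (forall t, 0 <= t -> periodic1 (g t)) ->
  exists C, forall t, 0 <= t <= T -> H1norm (f t) <= C.
Proof.
move=> /C11_bound[M M0 fM] /C11_bound[N N0 gN] P pf pg.
exists (2 * (M + N)) => t tT; have [t0 _] := andP tT; have [b1 b2 E] := P t t0.
apply: (H1norm_le b1 b2); first exact: pg.
- by rewrite addr_ge0.
- by move=> x _; rewrite E; ring.
- apply: periodic1_bound; first exact: pf.
  by move=> x x01; have [a _] := fM _ _ tT x01; rewrite (le_trans a)// lerDl.
- apply: periodic1_bound; first exact: pg.
  by move=> x x01; have [a _] := gN _ _ tT x01; rewrite (le_trans a)// lerDr.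
Qed.

Lemma C11_Linfnorm_bound T f f' : C11 T f f' ->
  exists C, forall t, 0 <= t <= T -> Linfnorm (f t) <= C.
Proof.
move=> /C11_bound[M M0 fM]; exists M => t tT; apply: Linfnorm_le => //.
by apply: ae01W => x x01; have [] := fM _ _ tT x01.
Qed.

Lemma H1norm0 (f : R -> R) : (forall x, f x = 0) -> H1norm f = 0.
Proof.
move=> f0; rewrite (_ : f = fun=> 0); last exact/funext.
apply/eqP; rewrite eq_le H1norm_ge0 andbT.
have := @H1norm_le R (fun=> 0) (fun=> 0) 0 (bmeas_cst 0) (bmeas_cst 0).
rewrite mulr0; apply => //.
- by move=> x _; rewrite ointg_cst mul0r addr0.
- by move=> x; rewrite normr0.
- by move=> x; rewrite normr0.
Qed.

Lemma Linfnorm0 (f : R -> R) : ae01 (fun x => f x = 0) -> Linfnorm f = 0.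
Proof.
move=> f0; apply/eqP; rewrite eq_le Linfnorm_ge0 andbT; apply: Linfnorm_le => //.
by apply: ae01S f0 => x _ ->; rewrite normr0.
Qed.

(** If |gam| <= M, then gam + Id changes sign on [-M, M]. *)
Lemma exists_preimage0 (gam Y : R -> R) : primitive gam (fun x => Y x - 1) -> periodic1 gam ->
  exists x, gam x + x = 0.
Proof.
move=> [[_ [M gM]] bY gE] pg; have [_ [N YN]] := bY.
have M0 : 0 <= M by exact: le_trans (gM 0).
have lY := bmeas_locint bY.
have cg : continuous (fun x => gam x + x).
  apply: (@lipschitz_continuous _ _ (N + 1)) => x y.
  have := ointg_lipschitz lY YN 0 x y; rewrite !gE => H.
  have := ler_normD (gam x - gam 0 - (gam y - gam 0)) (x - y).
  have -> : gam x - gam 0 - (gam y - gam 0) + (x - y) = gam x + x - (gam y + y) by ring.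
  by rewrite mulrDl mul1r => /le_trans; apply; rewrite lerD2r.
have hM := gM M; have hNM := gM (- M).
have [c _ c0] : exists2 c, c \in `[- M, M] & gam c + c = 0.
  apply: (IVT (f := fun x => gam x + x)).
  - by rewrite lerNl (le_trans _ M0)// oppr_le0.
  - exact: continuous_subspaceT.
  - move: hM hNM; rewrite !ler_norml => /andP[a _] /andP[_ b].
    by rewrite ge_min le_max; apply/andP; split; apply/orP; [left|right]; lra.
by exists c.
Qed.

(** A zero is merely chosen. For a regular solution and t >= 0 one exists, so the default 0 of
    [xget] does not interfere. *)
Definition label_of_zero gam (t : R) := xget 0 [set x : R | gam t x + x = 0].

Lemma regular_solution_inW1inf gam U V W Q Y B DU DB t :
  regular_solution h p gam U V W Q Y B DU DB -> 0 <= t ->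
  [/\ inW1inf (gam t), inW1inf (U t), inLinf (V t), inLinf (W t) & inLinf (Q t)].
Proof.
move=> S t0; have [_ bY gE] := rs_gam_primitive S t0; have [_ bB UE] := rs_U_primitive S t0.
split.
- apply: bmeas_inW1inf bY _; first exact: rs_gam_periodic S _ t0.
    by move=> x; rewrite (rs_Y_periodic S).
  by move=> x; rewrite gE; ring.
- apply: bmeas_inW1inf bB _; first exact: rs_U_periodic S t.
    exact: rs_B_periodic S t.
  by move=> x; rewrite UE; ring.
- by have [? ?] := rs_V S t; exact: bmeas_inLinf.
- by have [? ?] := rs_W S t; exact: bmeas_inLinf.
- by have [? ?] := rs_Q S t; exact: bmeas_inLinf.
Qed.

Lemma regular_solution_inY gam U V W Q Y B DU DB t :
  regular_solution h p gam U V W Q Y B DU DB -> 0 <= t -> inY (gam t) (U t) (V t) (W t) (Q t).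
Proof.
move=> S t0; have [_ _ lV lW lQ] := regular_solution_inW1inf S t0.
have [_ bY gE] := rs_gam_primitive S t0; have [_ bB UE] := rs_U_primitive S t0.
split => //.
- apply: bmeas_inH1 bY _; first exact: rs_gam_periodic S _ t0.
    by move=> x; rewrite (rs_Y_periodic S).
  by move=> x; rewrite gE; ring.
- apply: bmeas_inH1 bB _; first exact: rs_U_periodic S t.
    exact: rs_B_periodic S t.
  by move=> x; rewrite UE; ring.
Qed.

Let Y1_C11 gam U V W Q Y B DU DB T : regular_solution h p gam U V W Q Y B DU DB ->
  C11 T (fun t x => Y t x - 1) (fun t x => - 2 * U t x * B t x).
Proof.
move=> S; apply: eq_C11 (C11B (rs_Y_C11 S T) (C11_cst T 1)) => t x _ _.
by rewrite subr0.
Qed.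

Lemma regular_solution_is_sol gam U V W Q Y B DU DB T (gam0 U0 V0 W0 Q0 : R -> R) :
  regular_solution h p gam U V W Q Y B DU DB ->
  (forall x, gam 0 x = gam0 x) -> (forall x, U 0 x = U0 x) -> ae01 (fun x => V 0 x = V0 x) ->
  ae01 (fun x => W 0 x = W0 x) -> (forall x, Q 0 x = Q0 x) ->
  is_sol_on h T gam0 U0 V0 W0 Q0 gam U V W Q (label_of_zero gam).
Proof.
move=> S g0 u0 v0 w0 q0; have Y1 := Y1_C11 T S.
have pY t : periodic1 (fun x => Y t x - 1) by move=> x; rewrite (rs_Y_periodic S).
split.
- by move=> t /andP[t0 _]; exact: regular_solution_inY S t0.
- have [C1 H1] := C11_H1norm_bound (rs_gam_C11 S T) Y1 (rs_gam_primitive S)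
    (rs_gam_periodic S) (fun t _ => pY t).
  have [C2 H2] := C11_H1norm_bound (rs_U_C11 S T) (rs_B_C11 S T) (rs_U_primitive S)
    (fun t _ => rs_U_periodic S t) (fun t _ => rs_B_periodic S t).
  have [C3 H3] := C11_Linfnorm_bound (rs_V_C11 S T).
  have [C4 H4] := C11_Linfnorm_bound (rs_W_C11 S T).
  have [C5 H5] := C11_Linfnorm_bound (rs_Q_C11 S T).
  by exists (C1 + C2 + C3 + C4 + C5) => t tT; rewrite /normY; 
    exact: lerD (lerD (lerD (lerD (H1 t tT) (H2 t tT)) (H3 t tT)) (H4 t tT)) (H5 t tT).
- rewrite /normY !H1norm0 ?Linfnorm0 ?addr0//.
  + by apply: ae01W => x _; rewrite q0 subrr.
  + by apply: ae01S w0 => x _ ->; rewrite subrr.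
  + by apply: ae01S v0 => x _ ->; rewrite subrr.
  + by move=> x; rewrite u0 subrr.
  + by move=> x; rewrite g0 subrr.
- move=> t /andP[t0 _].
  have H := exists_preimage0 (rs_gam_primitive S t0) (rs_gam_periodic S t0).
  exact: (xgetPex (P := [set x | gam t x + x = 0]) 0 H).
- have gUU t : 0 <= t -> primitive (fun x => - U t x ^+ 2) (fun x => - 2 * U t x * B t x).
    move=> t0; have := primitiveZ (-1) (primitiveM (rs_U_primitive S t0) (rs_U_primitive S t0)).
    rewrite (_ : (fun x => -1 * (U t x * U t x)) = (fun x => - U t x ^+ 2)); last first.
      by apply/funext => x; ring.
    by rewrite (_ : (fun x => -1 * _) = (fun x => - 2 * U t x * B t x))//; apply/funext => x; ring.
  have pUU t : periodic1 (fun x => - U t x ^+ 2) by move=> x; rewrite (rs_U_periodic S).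
  have pUB t : periodic1 (fun x => - 2 * U t x * B t x).
    by move=> x; rewrite (rs_U_periodic S) (rs_B_periodic S).
  have [C1 c1 H1] := C11_quotient_H1norm (rs_gam_C11 S T) Y1 (rs_gam_primitive S) gUU
    (rs_gam_periodic S) (fun t _ => pUU t) (fun t _ => pY t) (fun t _ => pUB t).
  have [C2 c2 H2] := C11_quotient_H1norm (rs_U_C11 S T) (rs_B_C11 S T) (rs_U_primitive S)
    (rs_DU_primitive S) (fun t _ => rs_U_periodic S t) (rs_DU_periodic S)
    (fun t _ => rs_B_periodic S t) (fun t _ => rs_DB_periodic S t).
  have [C3 c3 H3] := C11_quotient_Linfnorm (rs_V_C11 S T).
  have [C4 c4 H4] := C11_quotient_Linfnorm (rs_W_C11 S T).
  have [C5 c5 H5] := C11_quotient_Linfnorm (rs_Q_C11 S T).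
  move=> t tT /= e e0; have [t0 _] := andP tT.
  (* The summand 1 makes [C] positive even if all the other constants vanish. *)
  pose C := C1 + C2 + C3 + C4 + C5 + 1.
  have C0 : 0 < C by rewrite /C; lra.
  exists (e / C); first exact: divr_gt0.
  move=> s s0; rewrite ltr_pdivlMr// => se tsT; rewrite (rs_P S t0).
  under [X in normY _ X]eq_fun do rewrite (rs_rhsU S _ _ t0).
  apply: (le_trans (lerD (lerD (lerD (lerD (H1 t s tT tsT s0) (H2 t s tT tsT s0))
    (H3 t s tT tsT s0)) (H4 t s tT tsT s0)) (H5 t s tT tsT s0))).
  by have := normr_ge0 s; move: se; rewrite /C; move: `|s| => r; lra.
Qed.

End RegularSolution.

(** * Uniqueness *)

Section L1Tools.
Variable R : realType.
Implicit Types f g : R -> R.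
Local Notation mu := (@lebesgue_measure R).

Definition L1norm f := int01 (fun x => `|f x|).

Lemma L1norm_ge0 f : 0 <= L1norm f.
Proof. exact: int01_ge0. Qed.

(** Otherwise ]a, b[ would be a null set of positive length. *)
Lemma ae01_dense (P : R -> Prop) a b : 0 <= a -> a < b -> b <= 1 -> ae01 P ->
  exists2 y, a < y < b & P y.
Proof.
move=> a0 ab b1 /ae01_null aP; apply: contrapT => nP.
have : mu `]a, b[ = 0%E.
  apply: lebesgue_null_subset aP => y /=; rewrite in_itv/= => yab; split.
    by case/andP: yab => ay yb; rewrite (le_trans a0 (ltW ay)) (le_trans (ltW yb)).
  by move=> Py; apply: nP; exists y.
have := lebesgue_measure_itv (`]a, b[ : interval R) => /= ->.
rewrite lte_fin ab -EFinD => -[/eqP]; rewrite subr_eq0 => /eqP ba.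
by rewrite ba ltxx in ab.
Qed.

(** The L^1 estimate yields equality almost everywhere, whereas [H1norm] involves pointwise
    derivatives; continuity of H^1 functions bridges the gap. One-sided continuity at 0 and
    periodicity settle the end points. *)
Lemma inH1_ae0 f : inH1 f -> ae01 (fun x => f x = 0) -> forall x, f x = 0.
Proof.
move=> [pf [g [g2 fE]]] f0; have [[mg Ig] _] := inL2_locint g2.
have cG : {within `[0, 1], continuous (fun x => f 0 + Rintegral mu `[0, x] g)}.
  by move=> x; apply: cvgD; [exact: cvg_cst|exact: (parameterized_integral_continuous ler01 (Ig 0 1))].
have /(continuous_within_itvP _ ltr01)[ci c0 c1] := cG.
have fE' x : 0 <= x <= 1 -> f x = f 0 + Rintegral mu `[0, x] g.
  by move=> x01; rewrite fE// ointgE//; case/andP: x01.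
have inner x : 0 < x < 1 -> f x = 0.
  move=> x01; have x01' : x \in `]0, 1[ by rewrite in_itv.
  have := ci x x01'; have [x0 x1] := andP x01; move=> cx.
  have x01c : 0 <= x <= 1 by rewrite !ltW.
  apply/eqP; apply: contrapT => /negP fx0.
  have e0 : 0 < `|f x| by rewrite normr_gt0.
  move/cvgrPdist_lt: cx => /(_ _ e0)[d /= d0 dH].
  pose b := Num.min 1 (x + d).
  have xb : x < b by rewrite /b lt_min x1 ltrDl.
  have b1 : b <= 1 by rewrite /b ge_min lexx.
  have [y /andP[xy yb] fy] := ae01_dense (ltW x0) xb b1 f0.
  have y01 : 0 <= y <= 1 by rewrite (le_trans (ltW x0) (ltW xy)) (le_trans (ltW yb)).
  have : `|x - y| < d.
    rewrite distrC gtr0_norm ?subr_gt0// ltrBlDl (lt_le_trans yb)// /b ge_min lexx orbT//.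
  by move=> /dH; rewrite /= -!fE'// fy subr0 ltxx.
have lim0 : f 0 = 0.
  apply/eqP; apply: contrapT => /negP f00.
  have e0 : 0 < `|f 0| by rewrite normr_gt0.
  move/cvgrPdist_lt: c0 => /(_ _ e0) H; near (0 : R)^'+ => x.
  have x0 : 0 < x by [].
  have x1 : x < 1 by near: x; exact: nbhs_right_lt.
  have : `|f 0 + Rintegral mu `[0, 0] g - (f 0 + Rintegral mu `[0, x] g)| < `|f 0|.
    by near: x; exact: H.
  have i01 : 0 < x < 1 by rewrite x0.
  have xc : 0 <= x <= 1 by rewrite !ltW.
  have zc : 0 <= (0 : R) <= 1 by rewrite lexx ler01.
  by rewrite -(fE' 0 zc) -(fE' x xc) (inner x i01) subr0 ltxx.
have f1 : f 1 = 0 by rewrite -[1]add0r pf.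
move=> x; have [z /andP[z0 z1] ->] := periodic1_reduce x pf.
have [->//|zn0] := eqVneq z 0; have [->//|zn1] := eqVneq z 1.
by apply: inner; rewrite lt_neqAle eq_sym zn0 z0 lt_neqAle zn1.
Unshelve. all: by end_near. Qed.

Lemma L1norm_eq0 f : inLinf f -> L1norm f = 0 -> ae01 (fun x => f x = 0).
Proof.
move=> lf f0; have [mf If] := inLinf_locint lf.
have [_ /integrableP[_ fin]] := (mf, If 0 1).
have mfE : measurable_fun (`[0, 1]%classic : set (measurableTypeR R)) (EFin \o f).
  exact/measurable_EFinP/measurable_funTS.
have m01 : measurable (`[0, 1]%classic : set (measurableTypeR R)) by [].
have H : (\int[mu]_(x in `[0%R, 1%R]) `|(EFin \o f) x| = 0)%E.
  have E : fine (\int[mu]_(x in `[0%R, 1%R]) `|(EFin \o f) x|)%E = 0 by exact: f0.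
  rewrite -[LHS]fineK ?E// ge0_fin_numE//; exact: integral_ge0.
have := (ae_eq_integral_abs mu m01 mfE).1 H.
by apply: aeS => x + x01; rewrite /= in_itv/= => /(_ x01)[].
Qed.

(** [A], [B] are the values of one solution at times t + s and t, [a], [b] those of the other, [F],
    [G] their velocities. The increment of the difference is s times the two quotient errors and the
    difference of velocities, so the distance itself is never differentiated. *)
Lemma L1norm_increment (A B a b F G : R -> R) s :
  inLinf A -> inLinf B -> inLinf a -> inLinf b -> inLinf F -> inLinf G -> s != 0 ->
  `|L1norm (fun x => A x - a x) - L1norm (fun x => B x - b x)| <=
  `|s| * (L1norm (fun x => (A x - B x) / s - F x) + L1norm (fun x => (a x - b x) / s - G x)
    + L1norm (fun x => F x - G x)).
Proof.
move=> lA lB la lb lF lG s0.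
have l1 := inLinf_locint (inLinfB lA la); have l2 := inLinf_locint (inLinfB lB lb).
have l1n := locint_norm l1; have l2n := locint_norm l2.
have q1 : locint (fun x => (A x - B x) / s - F x).
  by apply: inLinf_locint; apply: inLinfB => //; apply: inLinfM; [exact: inLinfB|exact: inLinf_cst].
have q2 : locint (fun x => (a x - b x) / s - G x).
  by apply: inLinf_locint; apply: inLinfB => //; apply: inLinfM; [exact: inLinfB|exact: inLinf_cst].
have q3 := inLinf_locint (inLinfB lF lG).
have n1 := locint_norm q1; have n2 := locint_norm q2; have n3 := locint_norm q3.
rewrite /L1norm !int01E -ointgB// (le_trans (ointg_norm _ ler01))//; first exact: locintB.
rewrite -ointgD// -ointgD//; last exact: locintD.
rewrite -ointgZ; last by apply: locintD => //; exact: locintD.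
apply: ointg_le => //; first exact/locint_norm/locintB.
  by apply: locintZ; apply: locintD => //; exact: locintD.
move=> x _; rewrite (le_trans (ler_dist_dist _ _))//.
have -> : A x - a x - (B x - b x) = s * (((A x - B x) / s - F x) - ((a x - b x) / s - G x) + (F x - G x)).
  by field.
rewrite normrM ler_wpM2l// (le_trans (ler_normD _ _))// lerD2r.
exact: ler_normB.
Qed.

End L1Tools.

(** * Quantities controlled by the distance of two solutions *)

Section Control.
Variables (R : realType) (T : R) (dl : R -> R -> R).
Implicit Types f g phi : R -> R -> R.
Hypothesis dl_ge0 : forall t x, 0 <= dl t x.
Hypothesis dl_locint : forall t, 0 <= t <= T -> locint (dl t).

Let D t := int01 (dl t).

Let D0 t : 0 <= D t. Proof. exact: int01_ge0. Qed.

(* [f] and [f'] are bounded and their distance is at most a constant times the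
   pointwise distance [dl] of the two solutions plus its mean. *)
Definition controlled f f' := exists2 C : R, 0 <= C & forall t, 0 <= t <= T ->
  [/\ inLinf (f t), inLinf (f' t) & ae01 (fun x =>
    [/\ `|f t x| <= C, `|f' t x| <= C & `|f t x - f' t x| <= C * (dl t x + D t)])].

Lemma controlled_cst (c : R) : controlled (fun _ _ => c) (fun _ _ => c).
Proof.
exists `|c| => // t tT; split; [exact: inLinf_cst..|].
by apply: ae01W => x _; split => //; rewrite subrr normr0 mulr_ge0// addr_ge0.
Qed.

Lemma controlledD f f' g g' : controlled f f' -> controlled g g' ->
  controlled (fun t x => f t x + g t x) (fun t x => f' t x + g' t x).
Proof.
move=> [C C0 fC] [E E0 gE]; exists (C + E); first exact: addr_ge0.
move=> t tT; have [l1 l2 aF] := fC t tT; have [l3 l4 aG] := gE t tT.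
split; [exact: inLinfD..|].
apply: ae01S (ae01I aF aG) => x _ [[a b c] [d e k]]; split.
- by rewrite (le_trans (ler_normD _ _))// lerD.
- by rewrite (le_trans (ler_normD _ _))// lerD.
- rewrite (_ : _ - _ = (f t x - f' t x) + (g t x - g' t x)); last ring.
  by rewrite (le_trans (ler_normD _ _))// mulrDl lerD.
Qed.

Lemma controlledM f f' g g' : controlled f f' -> controlled g g' ->
  controlled (fun t x => f t x * g t x) (fun t x => f' t x * g' t x).
Proof.
move=> [C C0 fC] [E E0 gE]; exists (2 * (C * E)); first by rewrite !mulr_ge0.
have CE0 : 0 <= C * E by exact: mulr_ge0.
move=> t tT; have [l1 l2 aF] := fC t tT; have [l3 l4 aG] := gE t tT.
split; [exact: inLinfM..|].
apply: ae01S (ae01I aF aG) => x _ [[a b c] [d e k]]; split.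
- by rewrite normrM (le_trans (ler_pM _ _ a d))//; lra.
- by rewrite normrM (le_trans (ler_pM _ _ b e))//; lra.
- rewrite (_ : _ - _ = (f t x - f' t x) * g t x + f' t x * (g t x - g' t x)); last ring.
  have n1 : `|(f t x - f' t x) * g t x| <= C * (dl t x + D t) * E by rewrite normrM ler_pM.
  have n2 : `|f' t x * (g t x - g' t x)| <= C * (E * (dl t x + D t)) by rewrite normrM ler_pM.
  by have := ler_normD ((f t x - f' t x) * g t x) (f' t x * (g t x - g' t x)); lra.
Qed.

Lemma controlledZ c f f' : controlled f f' ->
  controlled (fun t x => c * f t x) (fun t x => c * f' t x).
Proof. exact: controlledM (controlled_cst c). Qed.

Lemma controlledB f f' g g' : controlled f f' -> controlled g g' ->
  controlled (fun t x => f t x - g t x) (fun t x => f' t x - g' t x).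
Proof.
move=> cf /(controlledZ (-1)) cg; have := controlledD cf cg.
by under [X in controlled X]eq_fun do under eq_fun do rewrite mulN1r;
   under [X in controlled _ X]eq_fun do under eq_fun do rewrite mulN1r.
Qed.

Lemma controlled_L1 f f' : controlled f f' -> exists2 C : R, 0 <= C &
  forall t, 0 <= t <= T ->
  [/\ L1norm (f t) <= C, L1norm (f' t) <= C & L1norm (fun x => f t x - f' t x) <= C * D t].
Proof.
move=> [C C0 fC]; exists (2 * C); first by rewrite mulr_ge0.
move=> t tT; have [l1 l2 aF] := fC t tT.
have B (u : R -> R) : inLinf u -> ae01 (fun x => `|u x| <= C) -> L1norm u <= 2 * C.
  move=> lu uC; apply: (@le_trans _ _ (int01 (fun=> C))); last by rewrite int01E ointg_cst; lra.
  by apply: le_int01_ae => //; [exact/locint_norm/inLinf_locint|exact: locint_cst].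
split.
- by apply: B => //; apply: ae01S aF => x _ [].
- by apply: B => //; apply: ae01S aF => x _ [].
have ld := dl_locint tT.
apply: (@le_trans _ _ (int01 (fun x => C * (dl t x + D t)))).
  apply: le_int01_ae; [exact/locint_norm/inLinf_locint/inLinfB| |by apply: ae01S aF => x _ []].
  by apply/locintZ/locintD => //; exact: locint_cst.
rewrite int01E ointgZ ?ointgD//; [|exact: locint_cst|by apply: locintD => //; exact: locint_cst].
by rewrite ointg_cst -int01E -/(D t); lra.
Qed.

Lemma int01_le_L1 (u : R -> R) : inLinf u -> `|int01 u| <= L1norm u.
Proof. by move=> lu; rewrite /L1norm !int01E; apply: ointg_norm => //; exact: inLinf_locint. Qed.

Lemma controlled_int01 f f' : controlled f f' ->
  controlled (fun t _ => int01 (f t)) (fun t _ => int01 (f' t)).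
Proof.
move=> cf; have [C C0 H] := controlled_L1 cf; have [C' _ fC] := cf; exists C => // t tT.
have [h1 h2 h3] := H t tT; have [l1 l2 _] := fC t tT.
split; [exact: inLinf_cst..|]; apply: ae01W => x _; split.
- exact: le_trans (int01_le_L1 l1) h1.
- exact: le_trans (int01_le_L1 l2) h2.
- rewrite !int01E -ointgB; [|exact: inLinf_locint..]; rewrite -int01E.
  rewrite (le_trans (int01_le_L1 (inLinfB l1 l2)))// (le_trans h3)// ler_wpM2l// lerDr//.
Qed.

(* The paper's [K - P(1) y] is periodic although neither term is. *)
Lemma controlled_K phi phi' g g' (a : R -> R) A : controlled phi phi' -> controlled g g' ->
  (forall t, 0 <= t <= T -> `|a t| <= A) ->
  controlled (fun t x => ointg (a t) x (phi t) - int01 (phi t) * (g t x + x))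
             (fun t x => ointg (a t) x (phi' t) - int01 (phi' t) * (g' t x + x)).
Proof.
move=> cphi cg aA; have [C C0 H] := controlled_L1 cphi.
have [C' _ phiC] := cphi; have [E E0 gE] := cg.
exists (`|A| * C + 5 * C + C * (E + 1) + C * E); first by rewrite !addr_ge0// !mulr_ge0// addr_ge0.
move=> t tT; have [h1 h2 h3] := H t tT; have [l1 l2 _] := phiC t tT; have [l3 l4 aG] := gE t tT.
have aA' : `|a t| <= `|A| by rewrite (le_trans (aA t tT))// ler_norm.
(* The constant 5 is 2 + 2 from the two primitives based at 0, plus 1 for |x| <= 1. *)
have ob (u : R -> R) x : inLinf u -> 0 <= x <= 1 -> `|ointg (a t) x u| <= (`|A| + 5) * L1norm u.
  move=> lu /andP[x0 x1]; have lu' := inLinf_locint lu; have pu : periodic1 u by case: lu.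
  rewrite -(ointg_cat _ 0 _ lu') (ointgC _ _ lu') (le_trans (ler_normD _ _))// normrN.
  have := periodic1_ointg_bound x pu lu'; have := periodic1_ointg_bound (a t) pu lu'.
  rewrite -/(L1norm u) (ger0_norm x0) => b1 b2.
  have b3 : `|a t| * L1norm u <= `|A| * L1norm u by rewrite ler_wpM2r ?L1norm_ge0.
  have b4 : x * L1norm u <= 1 * L1norm u by rewrite ler_wpM2r ?L1norm_ge0.
  lra.
have per (u k : R -> R) : inLinf u -> inLinf k -> periodic1 (fun x => ointg (a t) x u - int01 u * (k x + x)).
  move=> lu [pk _] x; have lu' := inLinf_locint lu; have pu : periodic1 u by case: lu.
  by rewrite pk -(ointg_cat _ x (x + 1) lu') ointg_period//; ring.
have mea (u k : R -> R) : inLinf u -> inLinf k ->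
    measurable_fun (`[0, 1] : set R) (fun x => ointg (a t) x u - int01 u * (k x + x)).
  move=> lu /inLinfP[_ mk _]; have lu' := inLinf_locint lu.
  apply: measurable_funB; last by apply: measurable_funM => //; exact: measurable_funD.
  rewrite (_ : (fun x => ointg (a t) x u) = (fun x => ointg (a t) 0 u + ointg 0 x u)); last first.
    by apply/funext => x; rewrite ointg_cat.
  by apply: measurable_funD => //; exact: measurable_primitive.
have bnd (u : R -> R) x y : inLinf u -> L1norm u <= C -> 0 <= x <= 1 -> `|y| <= E ->
    `|ointg (a t) x u - int01 u * (y + x)| <= `|A| * C + 5 * C + C * (E + 1).
  move=> lu uC x01 yE; have o1 := ob u x lu x01.
  have o2 : `|int01 u * (y + x)| <= C * (E + 1).
    rewrite normrM ler_pM//; first exact: le_trans (int01_le_L1 lu) uC.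
    rewrite (le_trans (ler_normD _ _))// lerD//; case/andP: x01 => x0 x1.
    by rewrite ger0_norm.
  have o3 : (`|A| + 5) * L1norm u <= (`|A| + 5) * C by rewrite ler_wpM2l// addr_ge0.
  by have := ler_normB (ointg (a t) x u) (int01 u * (y + x)); lra.
have CE : 0 <= C * E by exact: mulr_ge0.
split.
- apply/inLinfP; split; [exact: per|exact: mea|].
  exists (`|A| * C + 5 * C + C * (E + 1)); apply: ae01S aG => x x01 [yE _ _]; exact: bnd.
- apply/inLinfP; split; [exact: per|exact: mea|].
  exists (`|A| * C + 5 * C + C * (E + 1)); apply: ae01S aG => x x01 [_ yE _]; exact: bnd.
apply: ae01S aG => x x01 [y1 y2 y3]; split.
- by rewrite (le_trans (bnd _ _ _ l1 h1 x01 y1))// lerDl.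
- by rewrite (le_trans (bnd _ _ _ l2 h2 x01 y2))// lerDl.
have k1 := inLinf_locint l1; have k2 := inLinf_locint l2.
have -> : ointg (a t) x (phi t) - int01 (phi t) * (g t x + x) -
   (ointg (a t) x (phi' t) - int01 (phi' t) * (g' t x + x)) =
   ointg (a t) x (fun z => phi t z - phi' t z) -
   (int01 (phi t) * (g t x - g' t x) + int01 (fun z => phi t z - phi' t z) * (g' t x + x)).
  by rewrite int01E !int01E !ointgB//; ring.
have o1 := ob _ x (inLinfB l1 l2) x01; have s0 := dl_ge0 t x; have Dt0 := D0 t.
have o2 : `|int01 (phi t) * (g t x - g' t x)| <= C * (E * (dl t x + D t)).
  by rewrite normrM ler_pM//; exact: le_trans (int01_le_L1 l1) h1.
have o3 : `|int01 (fun z => phi t z - phi' t z) * (g' t x + x)| <= C * D t * (E + 1).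
  rewrite normrM ler_pM//; first exact: le_trans (int01_le_L1 (inLinfB l1 l2)) h3.
  rewrite (le_trans (ler_normD _ _))// lerD//; case/andP: x01 => x0 x1.
  by rewrite ger0_norm.
have o4 : (`|A| + 5) * L1norm (fun z => phi t z - phi' t z) <= (`|A| + 5) * (C * D t).
  by rewrite ler_wpM2l// addr_ge0.
have w1 : 0 <= `|A| * C * dl t x by rewrite !mulr_ge0.
have w2 : 0 <= C * dl t x by rewrite mulr_ge0.
have w3 : 0 <= C * E * dl t x by rewrite mulr_ge0.
have w4 : 0 <= C * E * D t by rewrite mulr_ge0.
set X1 := ointg _ _ _ in o1 *; set X2 := _ * _ in o2 *; set X3 := _ * (g' t x + x) in o3 *.
have := ler_normB X1 (X2 + X3); have := ler_normD X2 X3.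
move: o1 o2 o3 o4; move: `|X1| `|X2| `|X3| `|X2 + X3| `|X1 - (X2 + X3)| (L1norm _) => *; lra.
Qed.

End Control.

Lemma normY_L1norm (R : realType) (a b c d f : R -> R) e : inLinf a -> inLinf b -> inLinf c ->
  inLinf d -> inLinf f -> normY a b c d f <= e ->
  [/\ L1norm a <= e, L1norm b <= e, L1norm c <= e, L1norm d <= e & L1norm f <= e].
Proof.
move=> /int01_le_H1norm la /int01_le_H1norm lb /int01_le_Linfnorm lc /int01_le_Linfnorm ld
  /int01_le_Linfnorm lf; rewrite /normY.
have := L1norm_ge0 a; have := L1norm_ge0 b; have := L1norm_ge0 c; have := L1norm_ge0 d.
have := L1norm_ge0 f; move: la lb lc ld lf; rewrite -!/(L1norm _).
move: (L1norm a) (L1norm b) (L1norm c) (L1norm d) (L1norm f).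
move: (H1norm a) (H1norm b) (Linfnorm c) (Linfnorm d) (Linfnorm f) => *; split; lra.
Qed.

Lemma L1norm_distC (R : realType) (f g : R -> R) :
  L1norm (fun x => f x - g x) = L1norm (fun x => g x - f x).
Proof. by congr int01; apply/funext => x; rewrite distrC. Qed.

Lemma inL2B (R : realType) (f g : R -> R) : inL2 f -> inL2 g -> inL2 (fun x => f x - g x).
Proof.
move=> [pf [mf If]] [pg [mg Ig]]; split; first by move=> x; rewrite pf pg.
have mB : measurable_fun (`[0, 1] : set R) (fun x => f x - g x) by exact: measurable_funB.
split=> //.
have m01 : measurable (`[0, 1] : set (measurableTypeR R)) by [].
have I2 : (@lebesgue_measure R).-integrable `[0, 1] (fun x => (2 * f x ^+ 2 + 2 * g x ^+ 2)%:E).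
  rewrite (_ : (fun x => _) = (fun x => 2%:E * (f x ^+ 2)%:E + 2%:E * (g x ^+ 2)%:E)%E)//.
  by apply: integrableD => //; exact: integrableZl.
apply: le_integrable I2 => //; first exact/measurable_EFinP/measurable_funX.
move=> x _; rewrite !abse_EFin lee_fin !ger0_norm ?sqr_ge0//.
  by have := sqr_ge0 (f x + g x); rewrite !expr2; lra.
by rewrite addr_ge0// mulr_ge0// sqr_ge0.
Qed.

Lemma inH1B (R : realType) (f g : R -> R) : inH1 f -> inH1 g -> inH1 (fun x => f x - g x).
Proof.
move=> [pf [f' [f2 fE]]] [pg [g' [g2 gE]]]; split; first by move=> x; rewrite pf pg.
exists (fun x => f' x - g' x); split; first exact: inL2B.
move=> x x01; have [lf _] := inL2_locint f2; have [lg _] := inL2_locint g2.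
by rewrite ointgB// fE// gE//; ring.
Qed.

(** * Gronwall's inequality for two solutions *)

Section Uniqueness.
Variables (R : realType) (h T : R).
Variables (gam U V W Q gam' U' V' W' Q' : R -> R -> R) (xi xi' : R -> R).
Hypothesis sol : is_sol_on h T (gam 0) (U 0) (V 0) (W 0) (Q 0) gam U V W Q xi.
Hypothesis sol' : is_sol_on h T (gam 0) (U 0) (V 0) (W 0) (Q 0) gam' U' V' W' Q' xi'.
(* The right-hand side does not depend on the choice of the base point of [K]; this is
   required of one of the two solutions only. *)
Hypothesis base_point : forall t a b x, 0 <= t <= T ->
  rhsU h (gam t) (U t) (V t) (Q t) a x = rhsU h (gam t) (U t) (V t) (Q t) b x.

Let dl t x := `|gam t x - gam' t x| + `|U t x - U' t x| + `|V t x - V' t x| +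
  `|W t x - W' t x| + `|Q t x - Q' t x|.

Let dl0 t x : 0 <= dl t x. Proof. by rewrite !addr_ge0. Qed.

Let inLinf_sol t : 0 <= t <= T ->
  [/\ inLinf (gam t), inLinf (U t), inLinf (V t), inLinf (W t) & inLinf (Q t)].
Proof. by case: sol => H _ _ _ _ /H[? ? ? ? ?]; split => //; exact: inH1_inLinf. Qed.

Let inLinf_sol' t : 0 <= t <= T ->
  [/\ inLinf (gam' t), inLinf (U' t), inLinf (V' t), inLinf (W' t) & inLinf (Q' t)].
Proof. by case: sol' => H _ _ _ _ /H[? ? ? ? ?]; split => //; exact: inH1_inLinf. Qed.

Let dl_loc t : 0 <= t <= T -> locint (dl t).
Proof.
move=> tT; have [a b c d e] := inLinf_sol tT; have [a' b' c' d' e'] := inLinf_sol' tT.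
have H (u v : R -> R) : inLinf u -> inLinf v -> locint (fun x => `|u x - v x|).
  by move=> lu lv; exact/locint_norm/inLinf_locint/inLinfB.
by do 4 (apply: locintD; last exact: H); exact: H.
Qed.

Let bounds (gam0 U0 V0 W0 Q0 : R -> R) (g u v w q : R -> R -> R) (x0 : R -> R) :
  is_sol_on h T gam0 U0 V0 W0 Q0 g u v w q x0 -> exists2 M, 0 <= M & forall t, 0 <= t <= T ->
  [/\ (forall x, `|g t x| <= M), (forall x, `|u t x| <= M), ae01 (fun x => `|v t x| <= M),
     ae01 (fun x => `|w t x| <= M) & ae01 (fun x => `|q t x| <= M)].
Proof.
move=> [sY [M sM] _ _ _]; exists (2 * `|M|) => // t tT.
have [Hg Hu Lv Lw Lq] := sY t tT.
have [] : [/\ H1norm (g t) <= `|M|, H1norm (u t) <= `|M|, Linfnorm (v t) <= `|M|,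
    Linfnorm (w t) <= `|M| & Linfnorm (q t) <= `|M|].
  have := sM t tT; rewrite /normY; have := ler_norm M.
  have := H1norm_ge0 (g t); have := H1norm_ge0 (u t); have := Linfnorm_ge0 (v t).
  have := Linfnorm_ge0 (w t); have := Linfnorm_ge0 (q t); move: `|M|.
  move: (H1norm (g t)) (H1norm (u t)) (Linfnorm (v t)) (Linfnorm (w t)) (Linfnorm (q t)).
  by move=> *; split; lra.
move=> n1 n2 n3 n4 n5.
have M2 : `|M| <= 2 * `|M| by rewrite ler_peMl// ler1n.
split.
- by move=> x; apply: le_trans (inH1_bound x Hg) _; apply: ler_wpM2l; [|exact: n1].
- by move=> x; apply: le_trans (inH1_bound x Hu) _; apply: ler_wpM2l; [|exact: n2].
- by apply: ae01S (Linfnorm_ae Lv) => x _ /le_trans; apply; exact: le_trans n3 M2.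
- by apply: ae01S (Linfnorm_ae Lw) => x _ /le_trans; apply; exact: le_trans n4 M2.
- by apply: ae01S (Linfnorm_ae Lq) => x _ /le_trans; apply; exact: le_trans n5 M2.
Qed.

Let ctrl (f f' : R -> R -> R) := controlled T dl f f'.

Let le_dl t x : [/\ `|gam t x - gam' t x| <= dl t x, `|U t x - U' t x| <= dl t x,
  `|V t x - V' t x| <= dl t x, `|W t x - W' t x| <= dl t x & `|Q t x - Q' t x| <= dl t x].
Proof.
rewrite /dl.
have := normr_ge0 (gam t x - gam' t x); have := normr_ge0 (U t x - U' t x).
have := normr_ge0 (V t x - V' t x); have := normr_ge0 (W t x - W' t x).
have := normr_ge0 (Q t x - Q' t x).
move: `|gam t x - _| `|U t x - _| `|V t x - _| `|W t x - _| `|Q t x - _| => *; split; lra.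
Qed.

Let ctrl_base : [/\ ctrl gam gam', ctrl U U', ctrl V V', ctrl W W' & ctrl Q Q'].
Proof.
have [M M0 HM] := bounds sol; have [N N0 HN] := bounds sol'.
have K0 : 0 <= M + N + 1 by rewrite !addr_ge0.
have MK : M <= M + N + 1 by rewrite -addrA lerDl addr_ge0.
have NK : N <= M + N + 1 by rewrite addrAC addrC lerDl addr_ge0.
have H t x (a : R) : a <= dl t x -> a <= (M + N + 1) * (dl t x + int01 (dl t)).
  have s0 : 0 <= dl t x + int01 (dl t) by rewrite addr_ge0//; exact: int01_ge0.
  move=> /le_trans; apply; rewrite (@le_trans _ _ (1 * (dl t x + int01 (dl t))))//.
    by rewrite mul1r lerDl; exact: int01_ge0.
  by rewrite ler_wpM2r// lerDr addr_ge0.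
split; exists (M + N + 1) => // t tT; have [a b c d e] := inLinf_sol tT;
  have [a' b' c' d' e'] := inLinf_sol' tT; have [h1 h2 h3 h4 h5] := HM t tT;
  have [k1 k2 k3 k4 k5] := HN t tT; split => //.
- apply: ae01W => x _; have [] := le_dl t x => /H i1 _ _ _ _.
  by split => //; [exact: le_trans (h1 x) MK|exact: le_trans (k1 x) NK].
- apply: ae01W => x _; have [] := le_dl t x => _ /H i1 _ _ _.
  by split => //; [exact: le_trans (h2 x) MK|exact: le_trans (k2 x) NK].
- apply: ae01S (ae01I h3 k3) => x _ [u v]; have [] := le_dl t x => _ _ /H i1 _ _.
  by split => //; [exact: le_trans u MK|exact: le_trans v NK].
- apply: ae01S (ae01I h4 k4) => x _ [u v]; have [] := le_dl t x => _ _ _ /H i1 _.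
  by split => //; [exact: le_trans u MK|exact: le_trans v NK].
- apply: ae01S (ae01I h5 k5) => x _ [u v]; have [] := le_dl t x => _ _ _ _ /H i1.
  by split => //; [exact: le_trans u MK|exact: le_trans v NK].
Qed.

Let phi (u v q : R -> R -> R) t x := 2 * u t x * q t x * v t x - u t x * q t x.
Let PP (u v q : R -> R -> R) t := Pone (u t) (v t) (q t).

Let ctrl_rhs : [/\ ctrl (fun t x => - U t x ^+ 2) (fun t x => - U' t x ^+ 2),
  ctrl (fun t x => rhsU h (gam t) (U t) (V t) (Q t) (xi' t) x)
       (fun t x => rhsU h (gam' t) (U' t) (V' t) (Q' t) (xi' t) x),
  ctrl (fun t x => - 2 * U t x * W t x + 2 * W t x * V t x * PP U V Q t)
       (fun t x => - 2 * U' t x * W' t x + 2 * W' t x * V' t x * PP U' V' Q' t),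
  ctrl (fun t x => 2 * U t x * V t x - U t x - 2 * V t x ^+ 2 * PP U V Q t + V t x * PP U V Q t)
       (fun t x => 2 * U' t x * V' t x - U' t x - 2 * V' t x ^+ 2 * PP U' V' Q' t + V' t x * PP U' V' Q' t) &
  ctrl (fun t x => - 2 * W t x * Q t x * PP U V Q t) (fun t x => - 2 * W' t x * Q' t x * PP U' V' Q' t)].
Proof.
have [cg cu cv cw cq] := ctrl_base.
have M := @controlledM R T dl; have Z := @controlledZ R T dl dl0.
have B := @controlledB R T dl dl0; have A := @controlledD R T dl.
have cphi : ctrl (phi U V Q) (phi U' V' Q').
  by apply: (B); apply: (M) => //; apply: (M) => //; exact: (Z).
have cP : ctrl (fun t _ => PP U V Q t) (fun t _ => PP U' V' Q' t).
  exact: (controlled_int01 dl0 dl_loc cphi).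
have sq f f' : ctrl f f' -> ctrl (fun t x => f t x ^+ 2) (fun t x => f' t x ^+ 2).
  by move=> cf; exact: (M _ _ _ _ cf cf).
split.
- have := Z (-1) _ _ (sq _ _ cu).
  by under [X in controlled _ _ X]eq_fun do under eq_fun do rewrite mulN1r;
   under [X in controlled _ _ _ X]eq_fun do under eq_fun do rewrite mulN1r.
- have [N N0 HN] := bounds sol'.
  (* The base points of the second solution are bounded, because gam' takes the value -xi' at
     them. *)
  have xiN t : 0 <= t <= T -> `|xi' t| <= N.
    move=> tT; case: sol' => _ _ _ /(_ t tT) x0 _; have [gN _ _ _ _] := HN t tT.
    by have := gN (xi' t); rewrite (_ : gam' t (xi' t) = - xi' t) ?normrN//; lra.
  have cK := controlled_K dl0 dl_loc cphi cg xiN.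
  have crho : ctrl (fun t x => 2 * Q t x * V t x - Q t x) (fun t x => 2 * Q' t x * V' t x - Q' t x).
    by apply: (B) => //; apply: (M) => //; exact: (Z).
  exact: (B _ _ _ _ cK (Z (1 - h)^-1 _ _ (controlled_int01 dl0 dl_loc (M _ _ _ _ crho cK)))).
- by apply: (A); [apply: (M) => //; exact: (Z)|apply: (M) => //; apply: (M) => //; exact: (Z)].
- apply: (A); last exact: (M).
  apply: (B); last by apply: (M) => //; apply: (Z); exact: (sq).
  by apply: (B) => //; apply: (M) => //; exact: (Z).
- by apply: (M) => //; apply: (M) => //; exact: (Z).
Qed.

Let D t := int01 (dl t).

Let DE t : 0 <= t <= T -> D t = L1norm (fun x => gam t x - gam' t x) +
  L1norm (fun x => U t x - U' t x) + L1norm (fun x => V t x - V' t x) +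
  L1norm (fun x => W t x - W' t x) + L1norm (fun x => Q t x - Q' t x).
Proof.
move=> tT; have [a b c d e] := inLinf_sol tT; have [a' b' c' d' e'] := inLinf_sol' tT.
have H (u v : R -> R) : inLinf u -> inLinf v -> locint (fun x => `|u x - v x|).
  by move=> lu lv; exact/locint_norm/inLinf_locint/inLinfB.
have H1 := H _ _ a a'; have H2 := H _ _ b b'; have H3 := H _ _ c c'.
have H4 := H _ _ d d'; have H5 := H _ _ e e'.
have H12 := locintD H1 H2; have H123 := locintD H12 H3; have H1234 := locintD H123 H4.
by rewrite /D /L1norm !int01E (ointgD _ _ H1234 H5) (ointgD _ _ H123 H4) (ointgD _ _ H12 H3) (ointgD _ _ H1 H2).
Qed.

Let comp_step (f f' F F' : R -> R -> R) :
  (forall t, 0 <= t <= T -> inLinf (f t) /\ inLinf (f' t)) -> ctrl F F' ->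
  exists2 C, 0 <= C & forall t s e, 0 <= t <= T -> 0 <= t + s <= T -> s != 0 ->
  L1norm (fun x => (f (t + s) x - f t x) / s - F t x) <= e ->
  L1norm (fun x => (f' (t + s) x - f' t x) / s - F' t x) <= e ->
  `|L1norm (fun x => f (t + s) x - f' (t + s) x) - L1norm (fun x => f t x - f' t x)| <=
  `|s| * (C * D t + 2 * e).
Proof.
move=> lf cF; have [C C0 H] := controlled_L1 dl_loc cF; have [C' _ FC] := cF.
exists C => // t s e tT tsT s0 e1 e2; have [_ _ h3] := H t tT; have [l1 l2 _] := FC t tT.
have [a b] := lf _ tT; have [c d] := lf _ tsT.
rewrite (le_trans (L1norm_increment c a d b l1 l2 s0))// ler_wpM2l//.
by rewrite -/(D t) in h3; lra.
Qed.

Lemma L1_distance_eq0 : D 0 = 0 -> forall t, 0 <= t <= T -> D t = 0.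
Proof.
move=> D00 t tT; have [r1 r2 r3 r4 r5] := ctrl_rhs.
have L u : 0 <= u <= T -> _ := @inLinf_sol u.
have L' u : 0 <= u <= T -> _ := @inLinf_sol' u.
have [C1 c1 S1] := comp_step (f := gam) (f' := gam')
  (fun u uT => let: And5 a _ _ _ _ := L u uT in let: And5 a' _ _ _ _ := L' u uT in conj a a') r1.
have [C2 c2 S2] := comp_step (f := U) (f' := U')
  (fun u uT => let: And5 _ a _ _ _ := L u uT in let: And5 _ a' _ _ _ := L' u uT in conj a a') r2.
have [C3 c3 S3] := comp_step (f := V) (f' := V')
  (fun u uT => let: And5 _ _ a _ _ := L u uT in let: And5 _ _ a' _ _ := L' u uT in conj a a') r3.
have [C4 c4 S4] := comp_step (f := W) (f' := W')
  (fun u uT => let: And5 _ _ _ a _ := L u uT in let: And5 _ _ _ a' _ := L' u uT in conj a a') r4.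
have [C5 c5 S5] := comp_step (f := Q) (f' := Q')
  (fun u uT => let: And5 _ _ _ _ a := L u uT in let: And5 _ _ _ _ a' := L' u uT in conj a a') r5.
apply/eqP; rewrite eq_le; apply/andP; split; last exact: int01_ge0.
apply: (gronwall (z := D) (T := T) (K := C1 + C2 + C3 + C4 + C5)) => //.
- by rewrite !addr_ge0.
- by rewrite D00.
- by move=> *; exact: int01_ge0.
(* Five components with two quotient errors each share the error [e]. *)
move=> {}t {}tT e e0; have e10 : 0 < e / 10 by rewrite divr_gt0.
case: sol => _ _ _ _ /(_ t tT (e / 10) e10)[d1 d10 H1].
case: sol' => _ _ _ _ /(_ t tT (e / 10) e10)[d2 d20 H2].
exists (Num.min d1 d2); first by rewrite lt_min d10.
move=> s; rewrite lt_min => /andP[s1 s2] tsT.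
have [->|s0] := eqVneq s 0; first by rewrite addr0 subrr normr0 mul0r.
have := H1 s s0 s1 tsT; have := H2 s s0 s2 tsT; rewrite {H1 H2}.
(* The two velocities are comparable only with a common base point. It may be moved freely for the
   first solution, so that of the second is taken. *)
have -> : (fun x => (U (t + s) x - U t x) / s - rhsU h (gam t) (U t) (V t) (Q t) (xi t) x) =
    (fun x => (U (t + s) x - U t x) / s - rhsU h (gam t) (U t) (V t) (Q t) (xi' t) x).
  by apply/funext => x; rewrite (base_point (xi t) (xi' t) x tT).
have qL (f : R -> R -> R) (F : R -> R) : inLinf (f (t + s)) -> inLinf (f t) -> inLinf F ->
    inLinf (fun x => (f (t + s) x - f t x) / s - F x).
  by move=> l1 l2 l3; apply: inLinfB => //; apply: inLinfM; [exact: inLinfB|exact: inLinf_cst].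
have [la lb lc ld le] := L _ tT; have [la' lb' lc' ld' le'] := L' _ tT.
have [ka kb kc kd ke] := L _ tsT; have [ka' kb' kc' kd' ke'] := L' _ tsT.
have [_ _ /(_ t tT)[m1 m1' _]] := r1; have [_ _ /(_ t tT)[m2 m2' _]] := r2.
have [_ _ /(_ t tT)[m3 m3' _]] := r3; have [_ _ /(_ t tT)[m4 m4' _]] := r4.
have [_ _ /(_ t tT)[m5 m5' _]] := r5.
move=> /(normY_L1norm (qL _ _ ka' la' m1') (qL _ _ kb' lb' m2') (qL _ _ kc' lc' m3')
  (qL _ _ kd' ld' m4') (qL _ _ ke' le' m5'))[i1' i2' i3' i4' i5'].
move=> /(normY_L1norm (qL _ _ ka la m1) (qL _ _ kb lb m2) (qL _ _ kc lc m3)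
  (qL _ _ kd ld m4) (qL _ _ ke le m5))[i1 i2 i3 i4 i5].
have j1 := S1 t s _ tT tsT s0 i1 i1'; have j2 := S2 t s _ tT tsT s0 i2 i2'.
have j3 := S3 t s _ tT tsT s0 i3 i3'; have j4 := S4 t s _ tT tsT s0 i4 i4'.
have j5 := S5 t s _ tT tsT s0 i5 i5'.
rewrite (DE tsT) {1}(DE tT); move: j1 j2 j3 j4 j5.
move: (L1norm (fun x => gam (t + s) x - gam' (t + s) x)) (L1norm (fun x => gam t x - gam' t x)) => a1 b1.
move: (L1norm (fun x => U (t + s) x - U' (t + s) x)) (L1norm (fun x => U t x - U' t x)) => a2 b2.
move: (L1norm (fun x => V (t + s) x - V' (t + s) x)) (L1norm (fun x => V t x - V' t x)) => a3 b3.
move: (L1norm (fun x => W (t + s) x - W' (t + s) x)) (L1norm (fun x => W t x - W' t x)) => a4 b4.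
move: (L1norm (fun x => Q (t + s) x - Q' (t + s) x)) (L1norm (fun x => Q t x - Q' t x)) => a5 b5.
move: (D t) => Dt j1 j2 j3 j4 j5.
have -> : a1 + a2 + a3 + a4 + a5 - (b1 + b2 + b3 + b4 + b5) =
  a1 - b1 + (a2 - b2) + (a3 - b3) + (a4 - b4) + (a5 - b5) by ring.
have -> : `|s| * ((C1 + C2 + C3 + C4 + C5) * Dt + e) =
  `|s| * (C1 * Dt + 2 * (e / 10)) + `|s| * (C2 * Dt + 2 * (e / 10)) +
  `|s| * (C3 * Dt + 2 * (e / 10)) + `|s| * (C4 * Dt + 2 * (e / 10)) +
  `|s| * (C5 * Dt + 2 * (e / 10)) by field.
by do 4 (apply: le_trans (ler_normD _ _) _; apply: lerD => //).
Qed.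

Lemma solution_unique t : 0 <= t <= T ->
  normY (fun x => gam' t x - gam t x) (fun x => U' t x - U t x) (fun x => V' t x - V t x)
        (fun x => W' t x - W t x) (fun x => Q' t x - Q t x) = 0.
Proof.
move=> tT; have T0 : 0 <= (0 : R) <= T.
  by move: tT => /andP[t0 tT']; rewrite lexx (le_trans t0 tT').
have sub (u : R -> R) : L1norm u <= 0 -> L1norm u = 0.
  by move=> u0; apply/eqP; rewrite eq_le u0 L1norm_ge0.
have D00 : D 0 = 0.
  have [la lb lc ld le] := inLinf_sol T0; have [la' lb' lc' ld' le'] := inLinf_sol' T0.
  have : normY (fun x => gam' 0 x - gam 0 x) (fun x => U' 0 x - U 0 x) (fun x => V' 0 x - V 0 x)
        (fun x => W' 0 x - W 0 x) (fun x => Q' 0 x - Q 0 x) <= 0 by case: sol' => _ _ -> _ _.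
  move=> /(normY_L1norm (inLinfB la' la) (inLinfB lb' lb) (inLinfB lc' lc) (inLinfB ld' ld)
    (inLinfB le' le))[/sub h1 /sub h2 /sub h3 /sub h4 /sub h5].
  rewrite (DE T0); rewrite (L1norm_distC (gam 0)) (L1norm_distC (U 0)) (L1norm_distC (V 0)).
  by rewrite (L1norm_distC (W 0)) (L1norm_distC (Q 0)) h1 h2 h3 h4 h5 !addr0.
have Dt := L1_distance_eq0 D00 tT; rewrite (DE tT) in Dt.
have [la lb lc ld le] := inLinf_sol tT; have [la' lb' lc' ld' le'] := inLinf_sol' tT.
rewrite (L1norm_distC (gam t)) (L1norm_distC (U t)) (L1norm_distC (V t)) in Dt.
rewrite (L1norm_distC (W t)) (L1norm_distC (Q t)) in Dt.
have [h1 h2 h3 h4 h5] : [/\ L1norm (fun x => gam' t x - gam t x) = 0, L1norm (fun x => U' t x - U t x) = 0,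
   L1norm (fun x => V' t x - V t x) = 0, L1norm (fun x => W' t x - W t x) = 0 &
   L1norm (fun x => Q' t x - Q t x) = 0].
  have := L1norm_ge0 (fun x => gam' t x - gam t x); have := L1norm_ge0 (fun x => U' t x - U t x).
  have := L1norm_ge0 (fun x => V' t x - V t x); have := L1norm_ge0 (fun x => W' t x - W t x).
  have := L1norm_ge0 (fun x => Q' t x - Q t x); move: Dt.
  move: (L1norm _) (L1norm _) (L1norm _) (L1norm _) (L1norm _) => *; split; lra.
have [Ha Hb _ _ _] : inY (gam t) (U t) (V t) (W t) (Q t) by case: sol => + _ _ _ _; apply.
have [Ha' Hb' _ _ _] : inY (gam' t) (U' t) (V' t) (W' t) (Q' t) by case: sol' => + _ _ _ _; apply.
have z1 := inH1_ae0 (inH1B Ha' Ha) (L1norm_eq0 (inLinfB la' la) h1).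
have z2 := inH1_ae0 (inH1B Hb' Hb) (L1norm_eq0 (inLinfB lb' lb) h2).
have z3 := Linfnorm0 (L1norm_eq0 (inLinfB lc' lc) h3).
have z4 := Linfnorm0 (L1norm_eq0 (inLinfB ld' ld) h4).
have z5 := Linfnorm0 (L1norm_eq0 (inLinfB le' le) h5).
by rewrite /normY z3 z4 z5 (H1norm0 z1) (H1norm0 z2) !addr0.
Qed.

End Uniqueness.

(** * Initial data *)

Section HalfAngle.
Variable R : realType.
Implicit Type a : R.

Let sqrD1 a : 1 + a ^+ 2 != 0.
Proof. by rewrite gt_eqF// ltr_wpDr ?sqr_ge0. Qed.

Let cos2_atan a : cos (atan a) ^+ 2 = (1 + a ^+ 2)^-1.
Proof. by rewrite cos_atan exprVn sqr_sqrtr// addr_ge0// sqr_ge0. Qed.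

Lemma cos_2atan a : cos (atan a *+ 2) = (1 - a ^+ 2) / (1 + a ^+ 2).
Proof. by rewrite cos_mulr2n cos2_atan; have s := sqrD1 a; field. Qed.

Lemma sin_2atan a : sin (atan a *+ 2) = 2 * a / (1 + a ^+ 2).
Proof.
have c0 : cos (atan a) != 0 by rewrite -sqrf_eq0 cos2_atan invr_eq0.
have -> : sin (atan a *+ 2) = 2 * tan (atan a) * cos (atan a) ^+ 2.
  by rewrite sin_mulr2n /tan; field.
by rewrite atanK cos2_atan.
Qed.

End HalfAngle.

(** * The initial data in the angle variables *)

Section InitialData.
Variables (R : realType) (u0 q y : R -> R) (h : R).
Hypotheses (pq : periodic1 q) (lq : locint q) (lq2 : locint (fun x => q x ^+ 2)).
Hypothesis hE : h = int01 (fun x => q x ^+ 2).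
Hypothesis yE : forall xi, y xi + ointg 0 (y xi) (fun x => q x ^+ 2) = (1 + h) * xi.
Hypothesis pu : periodic1 u0.
Hypothesis u0E : forall x, u0 x = u0 0 + ointg 0 x q.
Hypothesis h1 : 1 - h != 0.

(** The angle as a function of the position x; composition with [y] gives the one in the label xi.
    [r] is constant because Q_0 = 1 + h. *)
Let f (x : R) := atan (q x) *+ 2.
Let r (_ : R) := ln (1 + h).

Let hD : 0 < 1 + h. Proof. by have := energy_ge0 hE; lra. Qed.

Let expr x : expR (r x) = 1 + h. Proof. by rewrite /r lnK. Qed.

Let sqrD1 x : 1 + q x ^+ 2 != 0.
Proof. by rewrite gt_eqF// ltr_wpDr ?sqr_ge0. Qed.

Let mf : measurable_fun setT f.
Proof.
rewrite /f; under eq_fun do rewrite mulr2n.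
have ma : measurable_fun setT (fun x => atan (q x)).
  apply: measurableT_comp; first by apply: continuous_measurable_fun => z; exact: continuous_atan.
  by case: lq.
exact: measurable_funD.
Qed.

Let ok : admissible `|ln (1 + h)| f r.
Proof. by split; [move=> x; rewrite /f pq|exact: mf|by []|exact: measurable_cst|by []]. Qed.

Let my := lagrangian_measurable lq2 hE yE.

Definition initial_phase x := f (y x).
Definition initial_logdens := r.

Lemma initial_admissible : admissible `|ln (1 + h)| initial_phase initial_logdens.
Proof.
split; [|exact: measurableT_comp mf my|by []|exact: measurable_cst|by []].
by move=> x; rewrite /initial_phase /f (lagrangianD1 pq lq2 hE yE) pq.
Qed.

Lemma initial_phase_bounded : exists M : R, forall x, `|initial_phase x| <= M.
Proof.
exists pi => x; rewrite /initial_phase /f mulr2n (splitr pi) ler_norml opprD.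
by rewrite !lerD// ltW// ?atan_gtNpi2// atan_ltpi2.
Qed.

(** Multiplied by the density (1 + q^2) / (1 + h) of the change of variables, the integrand becomes
    [q] itself. *)
Let B0 a b : a <= b -> ointg a b (densB initial_phase r) = u0 (y b) - u0 (y a).
Proof.
move=> ab; rewrite (lagrangian_change_of_variables lq2 hE yE (bmeas_densB ok) ab).
rewrite (_ : (fun x => _) = q); first by rewrite (u0E (y b)) (u0E (y a)) -(ointg_cat 0 (y a) (y b) lq); ring.
apply/funext => x; rewrite /densB expr /f sin_2atan; have s := sqrD1 x; field.
by rewrite s gt_eqF.
Qed.

Let Yd (g : R -> R) x := (expR (r x) + densA g r x) / 2.

Let bY (g : R -> R) : admissible `|ln (1 + h)| g r -> bmeas (Yd g).
Proof.
move=> okg; apply: bmeasM; last exact: bmeas_cst.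
by apply: bmeasD; [exact: bmeas_expR okg|exact: bmeas_densA okg].
Qed.

(** Here the product with the density is the constant 1. *)
Let Y0 a b : a <= b -> ointg a b (Yd initial_phase) = y b - y a.
Proof.
move=> ab; rewrite (lagrangian_change_of_variables lq2 hE yE (bY ok) ab).
rewrite (_ : (fun x => _) = fun=> 1); first by rewrite ointg_cst; ring.
apply/funext => x; rewrite /Yd /densA expr /f cos_2atan; have s := sqrD1 x; field.
by rewrite s gt_eqF.
Qed.

Let y0 := lagrangian0 lq2 hE yE.
Let y1 : y 1 = 1.
Proof. by rewrite -{1}[1]add0r (lagrangianD1 pq lq2 hE yE) y0 add0r. Qed.

Lemma initial_mean : meanB initial_phase initial_logdens = 0.
Proof. by rewrite /meanB int01E B0// y1 y0 -{1}[1]add0r pu subrr. Qed.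

Lemma initial_length :
  int01 (fun x => (expR (initial_logdens x) + densA initial_phase initial_logdens x) / 2) = 1.
Proof. by rewrite int01E -[ointg _ _ _]/(ointg 0 1 (Yd initial_phase)) Y0// y1 y0 subr0. Qed.

Lemma initial_weight : int01 (densA initial_phase initial_logdens) = 1 - h.
Proof.
rewrite (_ : densA _ _ = (fun x => 2 * Yd initial_phase x - (1 + h))); last first.
  by apply/funext => x; rewrite /Yd expr -/initial_logdens; field.
have lY := bmeas_locint (bY initial_admissible).
rewrite int01E ointgB; [|exact: locintZ|exact: locint_cst].
by rewrite ointgZ// ointg_cst Y0// y1 y0; ring.
Qed.

(** The value of P(1) at time 0, which serves as the constant p of the flow. *)
Definition initial_P := int01 (fun x => u0 (y x) * densA initial_phase initial_logdens x).

Let prim0 x : primB initial_phase initial_logdens x = u0 (y x) - u0 0.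
Proof.
have pB : periodic1 (densB initial_phase r) := periodic_densB initial_admissible.
have lB := bmeas_locint (bmeas_densB initial_admissible).
have pd : periodic1 (fun x => primB initial_phase initial_logdens x - u0 (y x)).
  move=> z; rewrite (lagrangianD1 pq lq2 hE yE) pu; congr (_ - _).
  exact: periodic1_ointg.
have [z /andP[z0 z1] /= zx] := periodic1_reduce x pd.
suff : primB initial_phase initial_logdens z = u0 (y z) - u0 0 by lra.
by rewrite /primB initial_mean mulr0 subr0 B0// y0.
Qed.

Local Notation sU := (sol_U h initial_P initial_phase initial_logdens).

(** For this p the additive constant of the velocity equals u0 0, because [primB] is u0 (y x) - u0 0
    and A has integral 1 - h. *)
Lemma initial_U x : sU 0 x = u0 (y x).
Proof.
have E : sU 0 x = velocity h initial_P initial_phase initial_logdens x.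
  by rewrite /sol_U /sol_f /sol_r flow0.
rewrite E /velocity prim0.
have -> : momentAB initial_phase initial_logdens = initial_P - u0 0 * (1 - h).
  have bA := bmeas_densA initial_admissible.
  have bE := bmeas_primB initial_admissible.
  have lAE := bmeas_locint (bmeasM bA bE); have lA := bmeas_locint bA.
  have -> : initial_P = int01 (fun x => densA initial_phase initial_logdens x *
      primB initial_phase initial_logdens x + u0 0 * densA initial_phase initial_logdens x).
    by congr int01; apply/funext => z; rewrite prim0; ring.
  rewrite [in RHS]int01E (ointgD 0 1 lAE (locintZ _ lA)) (ointgZ _ _ _ lA) -!int01E initial_weight.
  by rewrite -[int01 _]/(momentAB initial_phase initial_logdens); ring.
by field.
Qed.

Lemma initial_regular : regular_solution h initial_P
  (sol_gam h initial_P initial_phase initial_logdens) sU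
  (sol_V h initial_P initial_phase initial_logdens)
  (sol_W h initial_P initial_phase initial_logdens)
  (sol_Q h initial_P initial_phase initial_logdens)
  (sol_Y h initial_P initial_phase initial_logdens)
  (sol_B h initial_P initial_phase initial_logdens)
  (rate_U h initial_P initial_phase initial_logdens)
  (rate_B h initial_P initial_phase initial_logdens).
Proof.
exact: sol_regular h1 (normr_ge0 _) initial_admissible initial_phase_bounded initial_mean
  initial_length initial_weight.
Qed.

Lemma initial_gam x : sol_gam h initial_P initial_phase initial_logdens 0 x = y x - x.
Proof.
have pd : periodic1 (fun x => sol_gam h initial_P initial_phase initial_logdens 0 x - (y x - x)).
  move=> z; rewrite (lagrangianD1 pq lq2 hE yE) (rs_gam_periodic initial_regular (lexx 0)); ring.
have [z /andP[z0 z1] /= zx] := periodic1_reduce x pd.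
suff : sol_gam h initial_P initial_phase initial_logdens 0 z = y z - z by lra.
rewrite /sol_gam flow0//.
have -> : (fun z => sol_Y h initial_P initial_phase initial_logdens 0 z - 1) =
    (fun z => Yd initial_phase z - 1).
  by apply/funext => w; rewrite /sol_Y /sol_Q /sol_A /sol_f /sol_r flow0.
rewrite ointgB; [|exact/bmeas_locint/bY/initial_admissible|exact: locint_cst].
by rewrite Y0// ointg_cst y0 /initial_state/=; ring.
Qed.

Lemma initial_V x : sol_V h initial_P initial_phase initial_logdens 0 x = (1 + q (y x) ^+ 2)^-1.
Proof.
rewrite /sol_V /sol_f flow0// -[phase _ x]/(f (y x)) cos_2atan.
by have s := sqrD1 (y x); field.
Qed.

Lemma initial_W x :
  sol_W h initial_P initial_phase initial_logdens 0 x = q (y x) / (1 + q (y x) ^+ 2).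
Proof.
rewrite /sol_W /sol_f flow0// -[phase _ x]/(f (y x)) sin_2atan.
by have s := sqrD1 (y x); field.
Qed.

Lemma initial_Q x : sol_Q h initial_P initial_phase initial_logdens 0 x = 1 + h.
Proof. by rewrite /sol_Q /sol_r flow0// -[logdens _ x]/(r x) expr. Qed.

End InitialData.

(** The data enter only through a norm, which for V and W ignores null sets. *)
Lemma eq_is_sol_on (R : realType) (h T : R) (gam0 U0 V0 W0 Q0 gam1 U1 V1 W1 Q1 : R -> R)
    (gam U V W Q : R -> R -> R) (xi0 : R -> R) :
  (forall x, gam1 x = gam0 x) -> (forall x, U1 x = U0 x) -> ae01 (fun x => V1 x = V0 x) ->
  ae01 (fun x => W1 x = W0 x) -> (forall x, Q1 x = Q0 x) ->
  is_sol_on h T gam0 U0 V0 W0 Q0 gam U V W Q xi0 ->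
  is_sol_on h T gam1 U1 V1 W1 Q1 gam U V W Q xi0.
Proof.
move=> /funext -> /funext -> EV EW /funext -> [s1 s2 s3 s4 s5].
split; [exact: s1|exact: s2| |exact: s4|exact: s5].
rewrite -[RHS]s3 /normY.
have -> : Linfnorm (fun x => V 0 x - V1 x) = Linfnorm (fun x => V 0 x - V0 x).
  by apply: eq_Linfnorm; apply: ae01S EV => x _ ->.
suff -> : Linfnorm (fun x => W 0 x - W1 x) = Linfnorm (fun x => W 0 x - W0 x) by [].
by apply: eq_Linfnorm; apply: ae01S EW => x _ ->.
Qed.

Theorem theorem3p2 (R : realType) (u0 y0 : R -> R) :
  inH1 u0 ->
  let u0x := derive1 u0 in
  let h := int01 (fun x => u0x x ^+ 2) in
  h != 1 ->
  (forall xi, y0 xi + ointg 0 (y0 xi) (fun x => u0x x ^+ 2) = (1 + h) * xi) ->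
  let gam0 := fun xi => y0 xi - xi in
  let U0 := fun xi => u0 (y0 xi) in
  let V0 := fun xi => (1 + u0x (y0 xi) ^+ 2)^-1 in
  let W0 := fun xi => u0x (y0 xi) / (1 + u0x (y0 xi) ^+ 2) in
  let Q0 := fun _ : R => 1 + h in
  exists (gam U V W Q : R -> R -> R) (xi0 : R -> R),
    (forall T, 0 < T -> is_sol_on h T gam0 U0 V0 W0 Q0 gam U V W Q xi0) /\
    (forall t, 0 <= t ->
       [/\ inW1inf (gam t), inW1inf (U t), inLinf (V t), inLinf (W t) & inLinf (Q t)]) /\
    (forall (T : R) (gam' U' V' W' Q' : R -> R -> R) (xi0' : R -> R),
       0 < T -> is_sol_on h T gam0 U0 V0 W0 Q0 gam' U' V' W' Q' xi0' ->
       forall t, 0 <= t <= T ->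
         normY (fun x => gam' t x - gam t x) (fun x => U' t x - U t x)
               (fun x => V' t x - V t x) (fun x => W' t x - W t x)
               (fun x => Q' t x - Q t x) = 0).
Proof.
move=> Hu u0x h h1 yE gam0 U0 V0 W0 Q0.
have [q [pq lq lq2 uq u0E]] := inH1_weak_derivative Hu; have [pu _] := Hu.
have uq2 : {ae (@lebesgue_measure R), forall x, u0x x ^+ 2 = q x ^+ 2}.
  by apply: aeS uq => x; rewrite /u0x => ->.
(* The integrands agree only almost everywhere and [u0x] is not known to be measurable;
   nonnegativity is what makes the integrals equal. *)
have eI a b : Rintegral (@lebesgue_measure R) `[a, b] (fun x => u0x x ^+ 2) =
    Rintegral (@lebesgue_measure R) `[a, b] (fun x => q x ^+ 2).
  by apply: ge0_Rintegral_ae => // x; exact: sqr_ge0.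
have hE : h = int01 (fun x => q x ^+ 2) by exact: eI.
have h1' : 1 - h != 0 by rewrite subr_eq0 eq_sym.
have yE' xi : y0 xi + ointg 0 (y0 xi) (fun x => q x ^+ 2) = (1 + h) * xi.
  by rewrite -yE /ointg !eI.
(* V0 and W0 contain the pointwise derivative composed with [y0], so its exceptional set has to be
   pulled back. *)
have uy := lagrangian_ae lq2 hE yE' uq.
pose S := initial_regular pq lq lq2 hE yE' pu u0E h1'.
have gamE := initial_gam pq lq lq2 hE yE' pu u0E h1'.
have UE := initial_U pq lq lq2 hE yE' pu u0E h1'.
have VE := @initial_V R u0 q y0 h; have WE := @initial_W R u0 q y0 h.
have QE := initial_Q u0 y0 hE.
have aV : ae01 (fun x => sol_V h (initial_P u0 q y0 h) (initial_phase q y0) (initial_logdens h) 0 x = V0 x).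
  by apply: aeS uy => x; rewrite VE /V0 /u0x => ->.
have aW : ae01 (fun x => sol_W h (initial_P u0 q y0 h) (initial_phase q y0) (initial_logdens h) 0 x = W0 x).
  by apply: aeS uy => x; rewrite WE /W0 /u0x => ->.
do 5 eexists; eexists; split; [|split].
- by move=> T _; exact: regular_solution_is_sol S gamE UE aV aW QE.
- by move=> t; exact: regular_solution_inW1inf S.
move=> T gam' U' V' W' Q' xi0' _ sol t tT.
apply: solution_unique tT.
(* The constructed solution takes its own values at time 0 as data. The competitor is then
   transferred to these data, which match V0 and W0 only almost everywhere. *)
- by apply: regular_solution_is_sol S _ _ _ _ _; rewrite //; exact: ae01W.
- exact: eq_is_sol_on gamE UE aV aW QE sol.
- by move=> s a b x /andP[s0 _]; rewrite !(rs_rhsU S).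
Qed.
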